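(* Let $\mathfrak g$ be a finite-dimensional simple complex Lie algebra which is not of type $\mathsf G_2$. Let $\mathscr V$ be a finite-dimensional $\mathscr Y$-module regarded as a ${}^\imath\mathscr Y$-module via restriction along $\varphi$. Then every ${}^\imath\boldsymbol\ell$-weight $\boldsymbol\lambda=(\lambda_i(u))_{i\in\mathbb I}$ of $\mathscr V$ has the form $$\lambda_i(u)=\frac{\Xi_i(u+\frac12d_i)\,\Xi_i^-(u-\frac12d_i)}{\Xi_i(u-\frac12d_i)\,\Xi_i^-(u+\frac12d_i)},\qquad i\in\mathbb I,$$ where each $\Xi_i(u)$ is a monic polynomial in $u$.
   Context: All algebras are over $\mathbb C$, $\mathbb N=\{0,1,2,\dots\}$, $\{x,y\}=xy+yx$. For a monic polynomial $P(u)$, $P^-(u)=(-1)^{\deg P}P(-u)$. Lie algebra. $\mathfrak g$ has Cartan matrix $(c_{ij})_{i,j\in\mathbb I}$, simple roots $\alpha_i$, positive roots $\Phi^+$, a fixed invariant inner product $(\cdot,\cdot)$, $d_i=\frac12(\alpha_i,\alpha_i)$, $d_ic_{ij}=(\alpha_i,\alpha_j)$. Chevalley generators $x_i^\pm,\xi_i$ are normalized by $(x_i^+,x_i^-)=1$, $\xi_i=[x_i^+,x_i^-]$. The Chevalley involution is $\omega:\xi_i\mapsto-\xi_i$, $x_i^\pm\mapsto-x_i^\mp$. Root vectors $x_\alpha^\pm\in\mathfrak g_{\pm\alpha}$ ($\alpha\in\Phi^+$) satisfy $(x_\alpha^+,x_\alpha^-)=1$, $x_{\alpha_i}^\pm=x_i^\pm$,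 $\omega(x_\alpha^\pm)=-x_\alpha^\mp$. Yangian. $\mathscr Y$ is the unital associative algebra with generators $x_{i,r}^\pm,\xi_{i,r}$ ($i\in\mathbb I,r\in\mathbb N$) and relations $[\xi_{i,r},\xi_{j,s}]=0$; $[\xi_{i,0},x_{j,s}^\pm]=\pm(\alpha_i,\alpha_j)x_{j,s}^\pm$; $[x_{i,r}^+,x_{j,s}^-]=\delta_{ij}\xi_{i,r+s}$; $[\xi_{i,r+1},x_{j,s}^\pm]-[\xi_{i,r},x_{j,s+1}^\pm]=\pm\frac12(\alpha_i,\alpha_j)\{\xi_{i,r},x_{j,s}^\pm\}$; $[x_{i,r+1}^\pm,x_{j,s}^\pm]-[x_{i,r}^\pm,x_{j,s+1}^\pm]=\pm\frac12(\alpha_i,\alpha_j)\{x_{i,r}^\pm,x_{j,s}^\pm\}$; and for $i\ne j$, $m=1-c_{ij}$, $\sum_{\sigma\in\mathfrak S_m}[x^\pm_{i,r_{\sigma(1)}},[x^\pm_{i,r_{\sigma(2)}},\cdots,[x^\pm_{i,r_{\sigma(m)}},x^\pm_{j,s}]\cdots]]=0$. $\mathrm U(\mathfrak g)\subset\mathscr Y$ via $\xi_i\mapsto\xi_{i,0}$, $x_i^\pm\mapsto x_{i,0}^\pm$. Twisted Yangian. ${}^\imath\mathscr Y$ is the unital associative algebra generated by $h_{i,2r+1},b_{i,r}$ ($i\in\mathbb I,r\in\mathbb N$) with relations ($h_{i,-1}=1$, $h_{i,r}=0$ if $r$ is even or $r<-1$; $r,s\in\mathbb N$): $[h_{i,r},h_{j,s}]=0$;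 $[h_{i,r+1},b_{j,s}]-[h_{i,r-1},b_{j,s+2}]=(\alpha_i,\alpha_j)\{h_{i,r-1},b_{j,s+1}\}+\frac14(\alpha_i,\alpha_j)^2[h_{i,r-1},b_{j,s}]$; $[b_{i,r+1},b_{j,s}]-[b_{i,r},b_{j,s+1}]=\frac12(\alpha_i,\alpha_j)\{b_{i,r},b_{j,s}\}-2\delta_{ij}(-1)^sh_{i,r+s+1}$; $[b_{i,0},b_{j,0}]=0$ if $c_{ij}=0$; $\mathrm{ad}(b_{i,0})^2(b_{j,0})=-d_ib_{j,0}$ if $c_{ij}=-1$; $\mathrm{ad}(b_{i,0})^3(b_{j,0})=-4d_i[b_{i,0},b_{j,0}]$ if $c_{ij}=-2$; $\mathrm{ad}(b_{i,0})^4(b_{j,0})=-10d_i[b_{i,0},[b_{i,0},b_{j,0}]]-9d_i^2b_{j,0}$ if $c_{ij}=-3$. Embedding. $\varphi:{}^\imath\mathscr Y\to\mathscr Y$ is the injective algebra homomorphism determined by $b_{i,0}\mapsto x_i^+-x_i^-$, $h_{i,1}\mapsto2\xi_{i,1}-\xi_i^2+\sum_{\alpha\in\Phi^+}(\alpha,\alpha_i)(x_\alpha^+)^2$. ${}^\imath\boldsymbol\ell$-weights. An ${}^\imath\boldsymbol\ell$-weight is a tuple $\boldsymbol\lambda=(\lambda_i(u))_{i\in\mathbb I}$ with $\lambda_i(u)=1+\sum_{r>0}\lambda_{i,2r-1}u^{-2r}\in1+u^{-2}\mathbb C[\![u^{-2}]\!]$. For a finite-dimensional ${}^\imath\mathscr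 Y$-module $\mathcal M$, $\mathcal M_{\boldsymbol\lambda}=\{v\in\mathcal M:\forall i\in\mathbb I,\,r>0,\ \exists p>0,\ (h_{i,2r-1}-\lambda_{i,2r-1})^pv=0\}$; $\boldsymbol\lambda$ is an ${}^\imath\boldsymbol\ell$-weight of $\mathcal M$ if $\mathcal M_{\boldsymbol\lambda}\ne0$. In the displayed formula rational functions are expanded in powers of $u^{-1}$. *)

(* Defs.v *)
From HB Require Import structures.
From mathcomp Require Import all_boot all_order perm all_algebra.
From mathcomp Require Import boolp reals.
From mathcomp Require Import complex.
From mathcomp Require Import monalg.

Set Implicit Arguments.
Unset Strict Implicit.
Unset Printing Implicit Defensive.

Import GRing.Theory.
Local Open Scope ring_scope.
Local Open Scope quotient_scope.

Definition comm (A : pzRingType) (x y : A) : A := x * y - y * x.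
Definition acomm (A : pzRingType) (x y : A) : A := x * y + y * x.

(* [x_1, [x_2, ..., [x_m, y] ... ]] for s = x_1, ..., x_m *)
Definition iter_comm (A : pzRingType) (s : seq A) (y : A) : A :=
  foldr (@comm A) y s.

(* The free algebra K<X>, as the monoid algebra of the free monoid on X. *)
Record free_alg (K : fieldType) (X : choiceType) :=
  FreeAlg { free_val : {malg K[{fmonom X}]} }.

(* Locked, to keep unification from unfolding the monoid algebra. *)
HB.lock Definition free_zero K X : free_alg K X := FreeAlg 0.
HB.lock Definition free_one K X : free_alg K X := FreeAlg 1.
HB.lock Definition free_add K X (f g : free_alg K X) : free_alg K X :=
  FreeAlg (free_val f + free_val g).
HB.lock Definition free_opp K X (f : free_alg K X) : free_alg K X :=
  FreeAlg (- free_val f).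
HB.lock Definition free_mul K X (f g : free_alg K X) : free_alg K X :=
  FreeAlg (free_val f * free_val g).
HB.lock Definition free_scale (K : fieldType) X (k : K) (f : free_alg K X) :
  free_alg K X := FreeAlg (k *: free_val f).
HB.lock Definition fgen (K : fieldType) (X : choiceType) (x : X) :
  free_alg K X := FreeAlg << fmu x >>.
HB.lock Definition const_term (K : fieldType) X (f : free_alg K X) : K :=
  mcoeff (mone : {fmonom X}) (free_val f).

Section FreeAlg.
Variables (K : fieldType) (X : choiceType).
Local Notation M := {malg K[{fmonom X}]}.
Local Notation free_alg := (free_alg K X).
Implicit Types f g h : free_alg.

HB.instance Definition _ := gen_eqMixin free_alg.
HB.instance Definition _ := gen_choiceMixin free_alg.

Lemma free_addA : associative (@free_add K X).
Proof. rewrite !unlock => f g h; congr FreeAlg; apply: addrA. Qed.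
Lemma free_addC : commutative (@free_add K X).
Proof. rewrite !unlock => f g; congr FreeAlg; apply: addrC. Qed.
Lemma free_add0 : left_id (free_zero K X) (@free_add K X).
Proof. rewrite !unlock => -[f]; congr FreeAlg; apply: add0r. Qed.
Lemma free_addN : left_inverse (free_zero K X) (@free_opp K X) (@free_add K X).
Proof. rewrite !unlock => f; congr FreeAlg; apply: addNr. Qed.

HB.instance Definition _ :=
  GRing.isZmodule.Build free_alg free_addA free_addC free_add0 free_addN.

Lemma free_mulA : associative (@free_mul K X).
Proof.
rewrite !unlock => f g h.
exact: (congr1 (@FreeAlg K X) (fgmulA (free_val f) (free_val g) (free_val h))).
Qed.
Lemma free_mul1 : left_id (free_one K X) (@free_mul K X).
Proof. rewrite !unlock => -[f]; congr FreeAlg; apply: mul1r. Qed.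
Lemma free_mulr1 : right_id (free_one K X) (@free_mul K X).
Proof. rewrite !unlock => -[f]; congr FreeAlg; apply: mulr1. Qed.
Lemma free_mulDl : left_distributive (@free_mul K X) (@free_add K X).
Proof.
rewrite !unlock => f g h.
exact: (congr1 (@FreeAlg K X)
  (fgmulgDl (free_val f) (free_val g) (free_val h))).
Qed.
Lemma free_mulDr : right_distributive (@free_mul K X) (@free_add K X).
Proof.
rewrite !unlock => f g h.
exact: (congr1 (@FreeAlg K X)
  (fgmulgDr (free_val f) (free_val g) (free_val h))).
Qed.
Lemma free_one_neq0 : free_one K X != free_zero K X.
Proof.
rewrite !unlock; apply/eqP => /(congr1 (@free_val K X)) E.
by have /eqP := @fgoner_eq0 (fmonom X) K; apply; exact: E.
Qed.

HB.instance Definition _ := GRing.Zmodule_isNzRing.Build free_alg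
  free_mulA free_mul1 free_mulr1 free_mulDl free_mulDr free_one_neq0.

Lemma free_scaleA a b f : free_scale a (free_scale b f) = free_scale (a * b) f.
Proof.
by rewrite !unlock; exact: (congr1 (@FreeAlg K X) (scalerA a b (free_val f))).
Qed.
Lemma free_scale1 : left_id 1 (@free_scale K X).
Proof. rewrite !unlock => -[f]; congr FreeAlg; apply: scale1r. Qed.
Lemma free_scaleDr : right_distributive (@free_scale K X) (@free_add K X).
Proof. rewrite !unlock => a f g; congr FreeAlg; apply: scalerDr. Qed.
Lemma free_scaleDl f a b :
  free_scale (a + b) f = free_add (free_scale a f) (free_scale b f).
Proof. rewrite !unlock; by congr FreeAlg; apply: scalerDl. Qed.

HB.instance Definition _ := GRing.Zmodule_isLmodule.Build K free_alg
  free_scaleA free_scale1 free_scaleDr free_scaleDl.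

Lemma free_scaleAl (k : K) f g :
  free_scale k (free_mul f g) = free_mul (free_scale k f) g.
Proof. rewrite !unlock; by congr FreeAlg; apply: scalerAl. Qed.

HB.instance Definition _ :=
  GRing.Lmodule_isLalgebra.Build K free_alg free_scaleAl.

Lemma free_scaleAr (k : K) f g :
  free_scale k (free_mul f g) = free_mul f (free_scale k g).
Proof.
have cE (h : M) : h * malgC k = k *: h.
  rewrite malgM_def fgmulgU malgZ_def.
  by apply: eq_bigr => m _; rewrite mulm1 mulrC.
have E (p q : M) : k *: (p * q) = p * (k *: q).
  by rewrite -(cE (p * q)) -(cE q) mulrA.
rewrite !unlock; exact: (congr1 (@FreeAlg K X) (E (free_val f) (free_val g))).
Qed.

HB.instance Definition _ :=
  GRing.Lalgebra_isAlgebra.Build K free_alg free_scaleAr.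

Lemma const_term0 : const_term (0 : free_alg) = 0.
Proof.
change (const_term (free_zero K X) = 0).
rewrite !unlock; exact: mcoeff0. Qed.

Lemma const_termD f g : const_term (f + g) = const_term f + const_term g.
Proof.
change (const_term (free_add f g) = const_term f + const_term g).
rewrite !unlock; exact: mcoeffD. Qed.

Lemma const_termN f : const_term (- f) = - const_term f.
Proof.
change (const_term (free_opp f) = - const_term f).
rewrite !unlock; exact: mcoeffN. Qed.

Lemma const_term1 : const_term (1 : free_alg) = 1.
Proof.
change (const_term (free_one K X) = 1).
rewrite !unlock; exact: (rmorph1 (@mcoeff _ K (mone : {fmonom X}))). Qed.

Lemma const_termM f g : const_term (f * g) = const_term f * const_term g.
Proof.
change (const_term (free_mul f g) = const_term f * const_term g).
rewrite !unlock; exact: (rmorphM (@mcoeff _ K (mone : {fmonom X}))). Qed.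

Lemma const_termZ (k : K) f : const_term (k *: f) = k * const_term f.
Proof.
change (const_term (free_scale k f) = k * const_term f).
rewrite !unlock; exact: mcoeffZ. Qed.

Lemma const_term_gen (x : X) : const_term (fgen K x) = 0.
Proof. by rewrite !unlock mcoeffU fm1_eq1. Qed.

Lemma const_term_comm f g : const_term (comm f g) = 0.
Proof. by rewrite /comm const_termD const_termN !const_termM mulrC subrr. Qed.

Lemma const_term_acomm f (x : X) : const_term (acomm f (fgen K x)) = 0.
Proof.
by rewrite /acomm const_termD !const_termM const_term_gen mulr0 mul0r addr0.
Qed.

Lemma const_term_iter_comm s f :
  const_term f = 0 -> const_term (iter_comm s f) = 0.
Proof. by case: s => //= a s _; exact: const_term_comm. Qed.

End FreeAlg.

(* An algType is nonzero; relators without constant term ensure this. *)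
Record relators (K : fieldType) (X : choiceType) := Relators {
  relator :> free_alg K X -> Prop;
  relator_const : forall f, relator f -> const_term f = 0 }.

Section PresentedAlgebra.
Variables (K : fieldType) (X : choiceType) (R : relators K X).
Local Notation F := (free_alg K X).

Inductive in_ideal : F -> Prop :=
| in_ideal0 : in_ideal 0
| in_idealD f g : in_ideal f -> in_ideal g -> in_ideal (f + g)
| in_idealM a r b : R r -> in_ideal (a * r * b).

Lemma in_ideal_mull a f : in_ideal f -> in_ideal (a * f).
Proof.
elim=> [|g h _ IHg _ IHh|b r c Rr]; first by rewrite mulr0; exact: in_ideal0.
  by rewrite mulrDr; exact: in_idealD.
by rewrite !mulrA; exact: in_idealM.
Qed.

Lemma in_ideal_mulr a f : in_ideal f -> in_ideal (f * a).
Proof.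
elim=> [|g h _ IHg _ IHh|b r c Rr]; first by rewrite mul0r; exact: in_ideal0.
  by rewrite mulrDl; exact: in_idealD.
by rewrite -mulrA; exact: in_idealM.
Qed.

Lemma in_idealN f : in_ideal f -> in_ideal (- f).
Proof. by move=> If; rewrite -mulN1r; apply: in_ideal_mull. Qed.

Lemma in_idealZ k f : in_ideal f -> in_ideal (k *: f).
Proof. by move=> If; rewrite -[f]mul1r scalerAl; apply: in_ideal_mull. Qed.

Lemma in_ideal_const f : in_ideal f -> const_term f = 0.
Proof.
elim=> [|g h _ IHg _ IHh|a r b Rr]; first exact: const_term0.
  by rewrite const_termD IHg IHh addr0.
by rewrite !const_termM (relator_const Rr) mulr0 mul0r.
Qed.

Definition ideal_equiv (f g : F) : bool := `[< in_ideal (f - g) >].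

Lemma ideal_equiv_is_equiv : equiv_class_of ideal_equiv.
Proof.
split=> [f|f g|g f h].
- by apply/asboolP; rewrite subrr; exact: in_ideal0.
- by apply/asboolP/asboolP => /in_idealN; rewrite opprB.
- move=> /asboolP fg /asboolP gh; apply/asboolP.
  by have := in_idealD fg gh; rewrite addrA subrK.
Qed.

Canonical ideal_equivRel := EquivRelPack ideal_equiv_is_equiv.

Definition pres_alg := {eq_quot ideal_equiv}.

HB.instance Definition _ : EqQuotient F ideal_equiv pres_alg :=
  EqQuotient.on pres_alg.
HB.instance Definition _ := Choice.on pres_alg.

Definition pres_pi (f : F) : pres_alg := \pi_pres_alg f.

Lemma pres_piP f g : pres_pi f = pres_pi g <-> in_ideal (f - g).
Proof.
by split=> [/eqP|?]; [|apply/eqP]; rewrite eqmodE => *; apply/asboolP.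
Qed.

Lemma pres_repr f : in_ideal (repr (pres_pi f) - f).
Proof. by apply/pres_piP; rewrite /pres_pi reprK. Qed.

Lemma pres_ind (P : pres_alg -> Prop) :
  (forall f, P (pres_pi f)) -> forall q, P q.
Proof. by move=> PP q; rewrite -[q]reprK; apply: PP. Qed.

End PresentedAlgebra.

HB.lock Definition qadd K X (R : relators K X) (p q : pres_alg R) :
  pres_alg R := pres_pi R (repr p + repr q).
HB.lock Definition qopp K X (R : relators K X) (p : pres_alg R) :
  pres_alg R := pres_pi R (- repr p).
HB.lock Definition qmul K X (R : relators K X) (p q : pres_alg R) :
  pres_alg R := pres_pi R (repr p * repr q).
HB.lock Definition qscale (K : fieldType) X (R : relators K X) (k : K)
  (p : pres_alg R) : pres_alg R := pres_pi R (k *: repr p).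

Section PresentedAlgebraStructure.
Variables (K : fieldType) (X : choiceType) (R : relators K X).
Local Notation F := (free_alg K X).
Local Notation pres_alg := (pres_alg R).
Local Notation pres_pi := (pres_pi R).
Local Notation qadd := (@qadd K X R).
Local Notation qopp := (@qopp K X R).
Local Notation qmul := (@qmul K X R).
Local Notation qscale := (@qscale K X R).

Lemma qaddE f g : qadd (pres_pi f) (pres_pi g) = pres_pi (f + g).
Proof.
rewrite unlock; apply/pres_piP; rewrite opprD addrACA.
by apply: in_idealD; apply: pres_repr.
Qed.

Lemma qoppE f : qopp (pres_pi f) = pres_pi (- f).
Proof.
by rewrite unlock; apply/pres_piP; rewrite -opprD; apply/in_idealN/pres_repr.
Qed.

Lemma qmulE f g : qmul (pres_pi f) (pres_pi g) = pres_pi (f * g).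
Proof.
rewrite unlock; apply/pres_piP; set f' := repr _; set g' := repr _.
have -> : f' * g' - f * g = f' * (g' - g) + (f' - f) * g.
  by rewrite mulrBr mulrBl addrA subrK.
by apply: in_idealD;
  [apply: in_ideal_mull | apply: in_ideal_mulr]; apply: pres_repr.
Qed.

Lemma qscaleE k f : qscale k (pres_pi f) = pres_pi (k *: f).
Proof.
by rewrite unlock; apply/pres_piP; rewrite -scalerBr; apply/in_idealZ/pres_repr.
Qed.

Let qE := (qaddE, qoppE, qmulE, qscaleE).

Lemma qaddA : associative qadd.
Proof. by do 3!elim/pres_ind => ?; rewrite !qE addrA. Qed.
Lemma qaddC : commutative qadd.
Proof. by do 2!elim/pres_ind => ?; rewrite !qE addrC. Qed.
Lemma qadd0 : left_id (pres_pi 0) qadd.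
Proof. by elim/pres_ind => ?; rewrite !qE add0r. Qed.
Lemma qaddN : left_inverse (pres_pi 0) qopp qadd.
Proof. by elim/pres_ind => ?; rewrite !qE addNr. Qed.

HB.instance Definition _ :=
  GRing.isZmodule.Build pres_alg qaddA qaddC qadd0 qaddN.

Lemma qmulA : associative qmul.
Proof. by do 3!elim/pres_ind => ?; rewrite !qE mulrA. Qed.
Lemma qmul1 : left_id (pres_pi 1) qmul.
Proof. by elim/pres_ind => ?; rewrite !qE mul1r. Qed.
Lemma qmulr1 : right_id (pres_pi 1) qmul.
Proof. by elim/pres_ind => ?; rewrite !qE mulr1. Qed.
Lemma qmulDl : left_distributive qmul qadd.
Proof. by do 3!elim/pres_ind => ?; rewrite !qE mulrDl. Qed.
Lemma qmulDr : right_distributive qmul qadd.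
Proof. by do 3!elim/pres_ind => ?; rewrite !qE mulrDr. Qed.
Lemma qone_neq0 : pres_pi 1 != pres_pi 0.
Proof.
apply/eqP => /pres_piP; rewrite subr0 => /in_ideal_const/eqP.
by rewrite const_term1 oner_eq0.
Qed.

HB.instance Definition _ := GRing.Zmodule_isNzRing.Build pres_alg
  qmulA qmul1 qmulr1 qmulDl qmulDr qone_neq0.

Lemma qscaleA a b (q : pres_alg) : qscale a (qscale b q) = qscale (a * b) q.
Proof. by elim/pres_ind: q => ?; rewrite !qE scalerA. Qed.
Lemma qscale1 : left_id 1 qscale.
Proof. by elim/pres_ind => ?; rewrite !qE scale1r. Qed.
Lemma qscaleDr : right_distributive qscale qadd.
Proof. by move=> a; do 2!elim/pres_ind => ?; rewrite !qE scalerDr. Qed.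
Lemma qscaleDl (q : pres_alg) a b :
  qscale (a + b) q = qadd (qscale a q) (qscale b q).
Proof. by elim/pres_ind: q => ?; rewrite !qE scalerDl. Qed.

HB.instance Definition _ := GRing.Zmodule_isLmodule.Build K pres_alg
  qscaleA qscale1 qscaleDr qscaleDl.

Lemma qscaleAl k (p q : pres_alg) : k *: (p * q) = (k *: p) * q.
Proof.
elim/pres_ind: p => f; elim/pres_ind: q => g.
rewrite -[RHS]/(qmul (qscale _ _) _) -[LHS]/(qscale _ (qmul _ _)).
by rewrite !qE scalerAl.
Qed.

HB.instance Definition _ :=
  GRing.Lmodule_isLalgebra.Build K pres_alg qscaleAl.

Lemma qscaleAr k (p q : pres_alg) : k *: (p * q) = p * (k *: q).
Proof.
elim/pres_ind: p => f; elim/pres_ind: q => g.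
rewrite -[RHS]/(qmul _ (qscale _ _)) -[LHS]/(qscale _ (qmul _ _)).
by rewrite !qE scalerAr.
Qed.

HB.instance Definition _ :=
  GRing.Lalgebra_isAlgebra.Build K pres_alg qscaleAr.

Lemma pres_pi_is_zmod_morphism : zmod_morphism pres_pi.
Proof. by move=> f g; rewrite -qaddE -qoppE. Qed.

HB.instance Definition _ :=
  GRing.isZmodMorphism.Build F pres_alg pres_pi pres_pi_is_zmod_morphism.

Lemma pres_pi_is_monoid_morphism : monoid_morphism pres_pi.
Proof. by split=> // f g; rewrite -qmulE. Qed.

HB.instance Definition _ :=
  GRing.isMonoidMorphism.Build F pres_alg pres_pi pres_pi_is_monoid_morphism.

Lemma pres_pi_is_scalable : scalable pres_pi.
Proof. by move=> k f; rewrite -qscaleE. Qed.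

HB.instance Definition _ :=
  GRing.isScalable.Build K F pres_alg *:%R pres_pi pres_pi_is_scalable.

Lemma pres_rel f : R f -> pres_pi f = 0.
Proof.
move=> Rf; rewrite -[0]/(pres_pi 0); apply/pres_piP; rewrite subr0.
by rewrite -[f]mul1r -[1 * f]mulr1; exact: in_idealM.
Qed.

End PresentedAlgebraStructure.

Definition pgen (K : fieldType) (X : choiceType) (R : relators K X) (x : X) :
    pres_alg R :=
  pres_pi R (fgen K x).
Arguments pgen {K X} R x.

Record lie_algebra (K : fieldType) := LieAlgebra {
  lie_sort :> vectType K;
  lie : lie_sort -> lie_sort -> lie_sort;
  lie_linear_l : forall y, linear (lie^~ y);
  lie_linear_r : forall x, linear (lie x);
  lie_alt : forall x, lie x x = 0;
  lie_jacobi : forall x y z,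
    lie x (lie y z) + lie y (lie z x) + lie z (lie x y) = 0 }.

Section LieTheory.
Variables (K : fieldType) (g : lie_algebra K).

Definition lie_ideal (J : {vspace g}) : Prop :=
  forall x y, y \in J -> lie x y \in J.

Definition lie_simple : Prop :=
  (exists x y : g, lie x y != 0)
  /\ (forall J : {vspace g}, lie_ideal J -> J = 0%VS \/ J = fullv).

Definition ad_diagonalizable (x : g) : Prop :=
  exists b : seq g, basis_of fullv b
    /\ forall v, v \in b -> exists a : K, lie x v = a *: v.

(* Cartan subalgebra of a semisimple Lie algebra: a commutative subalgebra of
   semisimple elements that is its own centralizer. *)
Definition cartan_subalgebra (h : {vspace g}) : Prop :=
  [/\ forall x y, x \in h -> y \in h -> lie x y = 0,
      forall x, x \in h -> ad_diagonalizable x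
    & forall x, (forall y, y \in h -> lie x y = 0) -> x \in h].

Definition cartan_dual (h : {vspace g}) : vectType K := 'Hom(subvs_of h, K^o).

Section Roots.
Variables (h : {vspace g}) (I : finType).
Implicit Types alpha beta : cartan_dual h.

Definition in_root_space alpha (x : g) : Prop :=
  forall a : subvs_of h, lie (vsval a) x = alpha a *: x.

Definition is_root alpha : Prop :=
  alpha != 0 /\ exists2 x : g, x != 0 & in_root_space alpha x.

Definition is_root_base (simple : I -> cartan_dual h) : Prop :=
  [/\ basis_of fullv [seq simple i | i : I],
      forall i, is_root (simple i)
    & forall alpha, is_root alpha -> exists n : I -> nat,
        alpha = \sum_i simple i *+ n i \/ alpha = - \sum_i simple i *+ n i].

Definition is_positive_root (simple : I -> cartan_dual h) alpha : Prop :=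
  is_root alpha /\ exists n : I -> nat, alpha = \sum_i simple i *+ n i.

End Roots.

Definition invariant_inner_product (form : g -> g -> K) : Prop :=
  [/\ forall y, scalar (form^~ y),
      forall x y, form x y = form y x,
      forall x, (forall y, form x y = 0) -> x = 0
    & forall x y z, form (lie x y) z = form x (lie y z)].

(* The form induced on the dual of h through the isomorphism
   h -> h^*, a |-> (a, _), given by the restriction of form to h. *)
Definition riesz (form : g -> g -> K) (h : {vspace g}) :
    'Hom(subvs_of h, cartan_dual h) :=
  linfun (fun a => linfun (fun b => form (vsval a) (vsval b) : K^o)
                   : cartan_dual h).

Definition dual_form (form : g -> g -> K) (h : {vspace g})
    (alpha beta : cartan_dual h) : K :=
  form (vsval ((riesz form h)^-1%VF alpha)) (vsval ((riesz form h)^-1%VF beta)).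

End LieTheory.

Record chevalley_data (K : fieldType) (g : lie_algebra K) (I : finType) :=
  ChevalleyData {
  cd_form : g -> g -> K;
  cd_formP : invariant_inner_product cd_form;
  cd_cartan : {vspace g};
  cd_cartanP : cartan_subalgebra cd_cartan;
  cd_simple : I -> cartan_dual cd_cartan;
  cd_simpleP : is_root_base cd_simple;
  cd_pos : seq (cartan_dual cd_cartan);
  cd_pos_uniq : uniq cd_pos;
  cd_posP : forall alpha, alpha \in cd_pos <-> is_positive_root cd_simple alpha;
  cd_c : I -> I -> int;
  cd_cP : forall i j,
    dual_form cd_form (cd_simple i) (cd_simple i) / 2 * (cd_c i j)%:~R
    = dual_form cd_form (cd_simple i) (cd_simple j);
  cd_omega : {linear g -> g};
  cd_omega_lie : forall x y,
    cd_omega (lie x y) = lie (cd_omega x) (cd_omega y);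
  (* root vectors x_alpha^+ and x_alpha^-, meaningful for positive alpha only *)
  cd_xp : cartan_dual cd_cartan -> g;
  cd_xm : cartan_dual cd_cartan -> g;
  cd_xpP : forall alpha, alpha \in cd_pos -> in_root_space alpha (cd_xp alpha);
  cd_xmP : forall alpha, alpha \in cd_pos ->
    in_root_space (- alpha) (cd_xm alpha);
  cd_form_x : forall alpha, alpha \in cd_pos ->
    cd_form (cd_xp alpha) (cd_xm alpha) = 1;
  cd_omega_xp : forall alpha, alpha \in cd_pos ->
    cd_omega (cd_xp alpha) = - cd_xm alpha;
  cd_omega_xm : forall alpha, alpha \in cd_pos ->
    cd_omega (cd_xm alpha) = - cd_xp alpha;
  cd_omega_xi : forall i, let xi :=
      lie (cd_xp (cd_simple i)) (cd_xm (cd_simple i)) in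
    cd_omega xi = - xi }.

Section ChevalleyData.
Variables (K : fieldType) (g : lie_algebra K) (I : finType).
Variable D : chevalley_data g I.

Definition cd_ip (alpha beta : cartan_dual (cd_cartan D)) : K :=
  dual_form (cd_form D) alpha beta.

Definition cd_sp (i j : I) : K := cd_ip (cd_simple D i) (cd_simple D j).

Definition cd_d (i : I) : K := cd_sp i i / 2.

Definition chev_xp (i : I) : g := cd_xp (cd_simple D i).
Definition chev_xm (i : I) : g := cd_xm (cd_simple D i).
Definition chev_xi (i : I) : g := lie (chev_xp i) (chev_xm i).

Definition type_G2 : Prop :=
  exists i j : I, [/\ i != j, forall k, k = i \/ k = j,
    cd_c D i j = -1 & cd_c D j i = -3].

End ChevalleyData.

(* In this section sp i j stands for the inner product (alpha_i, alpha_j). *)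

Section Yangian.
Variables (K : fieldType) (I : finType) (c : I -> I -> int) (sp : I -> I -> K).

(* inl (e, i, r) is x_{i,r}^+ or x_{i,r}^- for e = true or false; inr (i, r)
   is xi_{i,r} *)
Definition ygen_index : choiceType := ((bool * I * nat) + (I * nat))%type.

Local Notation F := (free_alg K ygen_index).
Local Notation x e i r := (fgen K (inl (e, i, r) : ygen_index)).
Local Notation xi i r := (fgen K (inr (i, r) : ygen_index)).

Definition pm (e : bool) : K := if e then 1 else -1.

Definition serre_order (i j : I) : nat := `|1 - c i j|%N.

Inductive yangian_rel : F -> Prop :=
| yangian_xi_xi i j (r s : nat) :
    yangian_rel (comm (xi i r) (xi j s))
| yangian_xi0_x e i j (s : nat) :
    yangian_rel (comm (xi i 0) (x e j s) - (pm e * sp i j) *: x e j s)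
| yangian_xp_xm i j (r s : nat) :
    yangian_rel (comm (x true i r) (x false j s)
                 - (if i == j then xi i (r + s)%N else 0))
| yangian_xi_x e i j (r s : nat) :
    yangian_rel (comm (xi i r.+1) (x e j s) - comm (xi i r) (x e j s.+1)
                 - (pm e * (sp i j / 2)) *: acomm (xi i r) (x e j s))
| yangian_x_x e i j (r s : nat) :
    yangian_rel (comm (x e i r.+1) (x e j s) - comm (x e i r) (x e j s.+1)
                 - (pm e * (sp i j / 2)) *: acomm (x e i r) (x e j s))
| yangian_serre e i j (r : 'I_(serre_order i j) -> nat) (s : nat) : i != j ->
    yangian_rel (\sum_(sigma : 'S_(serre_order i j))
      iter_comm [seq x e i (r (sigma k)) | k <- enum 'I_(serre_order i j)]
                (x e j s)).

Lemma yangian_rel_const f : yangian_rel f -> const_term f = 0.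
Proof.
have E := (const_termD, const_termN, const_term_comm, const_termZ,
  const_term_acomm, const_term_gen).
case=> *; rewrite ?E ?(mulr0, oppr0, addr0) //.
  by case: eqP; rewrite ?E ?const_term0 subr0.
rewrite (big_morph _ (@const_termD _ _) (@const_term0 _ _)) big1 // => sigma _.
by apply: const_term_iter_comm; rewrite const_term_gen.
Qed.

Definition yangian := pres_alg (Relators yangian_rel_const).

Definition Yx (e : bool) (i : I) (r : nat) : yangian :=
  pgen _ (inl (e, i, r) : ygen_index).
Definition Yxi (i : I) (r : nat) : yangian :=
  pgen _ (inr (i, r) : ygen_index).

(* inl (i, r) is h_{i,2r+1}; inr (i, r) is b_{i,r} *)
Definition tgen_index : choiceType := ((I * nat) + (I * nat))%type.

Local Notation G := (free_alg K tgen_index).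
Local Notation b i r := (fgen K (inr (i, r) : tgen_index)).

(* h_{i,k} for all integers k, with the conventions h_{i,-1} = 1 and
   h_{i,k} = 0 if k is even or k < -1 *)
Definition hfree (i : I) (k : int) : G :=
  match k with
  | Posz n => if odd n then fgen K (inl (i, n./2) : tgen_index) else 0
  | Negz 0 => 1
  | Negz _ => 0
  end.

Inductive twisted_rel : G -> Prop :=
| twisted_h_h i j (r s : nat) :
    twisted_rel (comm (hfree i r) (hfree j s))
| twisted_h_b i j (r s : nat) :
    twisted_rel (comm (hfree i (r%:Z + 1)) (b j s)
                 - comm (hfree i (r%:Z - 1)) (b j s.+2)
                 - (sp i j *: acomm (hfree i (r%:Z - 1)) (b j s.+1)
                    + (sp i j ^+ 2 / 4) *: comm (hfree i (r%:Z - 1)) (b j s)))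
| twisted_b_b i j (r s : nat) :
    twisted_rel (comm (b i r.+1) (b j s) - comm (b i r) (b j s.+1)
                 - ((sp i j / 2) *: acomm (b i r) (b j s)
                    - (if i == j
                       then (2 * (-1) ^+ s) *: hfree i (r%:Z + s%:Z + 1)
                       else 0)))
| twisted_serre0 i j : c i j = 0 ->
    twisted_rel (comm (b i 0) (b j 0))
| twisted_serre1 i j : c i j = -1 ->
    twisted_rel (iter_comm [:: b i 0; b i 0] (b j 0)
                 + (sp i i / 2) *: b j 0)
| twisted_serre2 i j : c i j = -2 ->
    twisted_rel (iter_comm [:: b i 0; b i 0; b i 0] (b j 0)
                 + (4 * (sp i i / 2)) *: comm (b i 0) (b j 0))
| twisted_serre3 i j : c i j = -3 ->
    twisted_rel (iter_comm [:: b i 0; b i 0; b i 0; b i 0] (b j 0)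
                 + ((10 * (sp i i / 2)) *: comm (b i 0) (comm (b i 0) (b j 0))
                    + (9 * (sp i i / 2) ^+ 2) *: b j 0)).

Lemma twisted_rel_const f : twisted_rel f -> const_term f = 0.
Proof.
have E := (const_termD, const_termN, const_term_comm, const_termZ,
  const_term_acomm, const_term_gen).
case=> *; rewrite /= ?E ?(mulr0, oppr0, addr0) ?add0r //.
rewrite opprK; case: eqP => _; last exact: const_term0.
by rewrite const_termZ; case: ifP => _; rewrite ?E ?const_term0 mulr0.
Qed.

Definition twisted_yangian := pres_alg (Relators twisted_rel_const).

(* Th i r is h_{i,2r+1} *)
Definition Th (i : I) (r : nat) : twisted_yangian :=
  pgen _ (inl (i, r) : tgen_index).
Definition Tb (i : I) (r : nat) : twisted_yangian :=
  pgen _ (inr (i, r) : tgen_index).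

End Yangian.

Section Embeddings.
Variables (K : fieldType) (g : lie_algebra K) (I : finType).
Variable D : chevalley_data g I.

Definition Yangian : algType K := yangian (cd_c D) (cd_sp D).
Definition TwistedYangian : algType K := twisted_yangian (cd_c D) (cd_sp D).

(* iota is the restriction to g of the embedding of U(g) into the Yangian;
   since the Chevalley generators generate g it is uniquely determined. *)
Definition is_lie_inclusion (iota : {linear g -> Yangian}) : Prop :=
  [/\ forall x y, iota (lie x y) = comm (iota x) (iota y),
      forall i, iota (chev_xi D i) = Yxi _ _ i 0,
      forall i, iota (chev_xp D i) = Yx _ _ true i 0
    & forall i, iota (chev_xm D i) = Yx _ _ false i 0].

(* This determines phi, because the b_{i,0} and h_{i,1} generate the twisted
   Yangian. *)
Definition is_twisted_embedding (iota : {linear g -> Yangian})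
    (phi : {lrmorphism TwistedYangian -> Yangian}) : Prop :=
  (forall i, phi (Tb _ _ i 0) = iota (chev_xp D i) - iota (chev_xm D i))
  /\ (forall i, phi (Th _ _ i 0) =
        2 *: Yxi _ _ i 1 - iota (chev_xi D i) ^+ 2
        + \sum_(alpha <- cd_pos D)
            cd_ip alpha (cd_simple D i) *: iota (cd_xp alpha) ^+ 2).

End Embeddings.

Record fd_module (K : fieldType) (A : algType K) := FdModule {
  fdm_sort :> vectType K;
  fdm_act : {linear A -> 'End(fdm_sort)};
  fdm_act1 : fdm_act 1 = \1%VF;
  fdm_actM : forall a b, fdm_act (a * b) = (fdm_act a \o fdm_act b)%VF }.

Section Restriction.
Variables (K : fieldType) (A B : algType K) (phi : {lrmorphism A -> B}).
Variable V : fd_module B.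

Definition restrict_act : {linear A -> 'End(V)} := fdm_act V \o phi.

Fact restrict_act1 : restrict_act 1 = \1%VF.
Proof. by rewrite /= rmorph1 fdm_act1. Qed.

Fact restrict_actM a b :
  restrict_act (a * b) = (restrict_act a \o restrict_act b)%VF.
Proof. by rewrite /= rmorphM fdm_actM. Qed.

Definition restrict_module : fd_module A :=
  FdModule restrict_act1 restrict_actM.

End Restriction.

Section Weights.
Variables (K : fieldType) (g : lie_algebra K) (I : finType).
Variable D : chevalley_data g I.

(* lam i r is lambda_{i,2r+1}, the coefficient of u^{-2r-2} in lambda_i(u). *)
Definition il_weight := I -> nat -> K.

Definition il_weight_space (M : fd_module (TwistedYangian D))
    (lam : il_weight) (v : M) : Prop :=
  forall i r, exists2 p : nat, (0 < p)%N &
    iter p (fun w => fdm_act M (Th _ _ i r) w - lam i r *: w) v = 0.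

Definition is_il_weight (M : fd_module (TwistedYangian D))
    (lam : il_weight) : Prop :=
  exists2 v : M, v != 0 & il_weight_space lam v.

End Weights.

(* The coefficient of u^{-m} in 1 + sum_(r >= 0) l_r u^{-2r-2} *)
Definition even_series (K : fieldType) (l : nat -> K) (m : nat) : K :=
  if m == 0%N then 1 else if odd m then 0 else l (m./2).-1.

(* N / D = sum_m l_m u^{-m} in the field of Laurent series in u^{-1}: for every
   integer k, the coefficients of u^k in D(u) * sum_m l_m u^{-m} and in N(u)
   agree. For D != 0 at most one l satisfies this. *)
Definition expands_to (K : fieldType) (N D : {poly K}) (l : nat -> K) : Prop :=
  forall k : int,
    \sum_(j < size D | k <= j%:Z) D`_j * l `|j%:Z - k|%N
    = if k is Posz n then N`_n else 0.

Definition shift_poly (K : fieldType) (a : K) (P : {poly K}) : {poly K} :=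
  P \Po ('X + a%:P).

Definition poly_minus (K : fieldType) (P : {poly K}) : {poly K} :=
  (-1) ^+ (size P).-1 *: (P \Po (- 'X)).

(* Main.v *)
(* The rational functions of the required form constitute a group. By the
   relation between h_i(u) and b_j(v), each b_{j,s} multiplies generalized
   weights by (u^2 - (a-c)^2) / (u^2 - (a+c)^2) with c in (d_i/2) Z, which lies
   in that group. So the sum N of the generalized weight spaces with weights of
   the required form is a submodule over the twisted Yangian. Let F be the
   largest Yangian submodule contained in N, and suppose N <> V. A highest
   weight vector w of V/F is an eigenvector of h_i(u) with eigenvalue
   gamma(u) gamma(-u), where gamma(u) is its xi_i(u)-eigenvalue; as
   x_{i,0}^+ x_i^-(v)^m w = m (gamma(v) x_i^-(v+d)^(m-1) - x_i^-(v)^(m-1)) w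
   for the current x_i^-(v), finite-dimensionality gives
   sum_k (-1)^k binom(m,k) prod_{j<k} gamma(v+jd) = 0 for large m, hence
   gamma(u) = p(u+d)/p(u) with p rational. So the eigenvalue is of the required
   form and w lies in N. Since b_{j,s} = -(-1)^s x_{j,s}^- modulo operators of
   larger degree, the twisted Yangian generates from w everything that the
   Yangian does (as in the Iwasawa decomposition), so Yw lies in N,
   contradicting the choice of F. *)

(* The map [phi] is prescribed only on [b_{i,0}] and [h_{i,1}], so the other images must be
   recovered from relations: [[h_{i,1}, b_{i,r}] = 4 d_i b_{i,r+1}], then [[b_{i,r+1}, b_{i,r}]],
   which yields [h_{i,2r+1}]. This is feasible because on a highest weight vector only the parts of
   degree -1 and 1 of [b_{i,r}] matter; degree is measured by a Cartan element on which every simple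
   root is 1. N is not known in advance to be stable under the Yangian, whereas highest weight
   vectors live in Yangian modules; this is why F has to mediate. The node i is fixed: N is built
   from the [h_{i,r}] alone, yet must be stable under every [b_{j,s}]. In the factor of the overview
   c is half of (alpha_i, alpha_j), that is c_ij d_i/2, and a is an eigenvalue, modulo N, of the
   shift from [b_{j,s}] to [b_{j,s+1}], which [h_{i,1}] realizes when c is nonzero. Reflection u ->
   -u of Xi inverts the weight attached to it; this turns the rational p into a polynomial Xi. *)
From HB Require Import structures.
Require Import Defs.
From mathcomp Require Import all_boot all_order perm all_algebra.
From mathcomp Require Import boolp reals complex ring zify monalg.

Set Implicit Arguments.
Unset Strict Implicit.
Unset Printing Implicit Defensive.

Import GRing.Theory Num.Theory Order.TTheory.
Local Open Scope ring_scope.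

(** * Normalization of linear and noncommutative identities *)

(* Both sides of an identity are reflected and collected by words in the atoms;
   that the resulting scalar coefficients vanish is left to [ring]. *)
Inductive nc_expr (K : Type) :=
| NcVar of nat | NcZero | NcOne
| NcAdd of nc_expr K & nc_expr K
| NcOpp of nc_expr K
| NcMul of nc_expr K & nc_expr K
| NcScale of K & nc_expr K.
Arguments NcVar {K}. Arguments NcZero {K}. Arguments NcOne {K}.

Section NcRing.
Variables (K : fieldType) (A : algType K) (env : seq A).

Fixpoint nc_eval (e : nc_expr K) : A :=
  match e with
  | NcVar n => nth 0 env n
  | NcZero => 0
  | NcOne => 1
  | NcAdd a b => nc_eval a + nc_eval b
  | NcOpp a => - nc_eval a
  | NcMul a b => nc_eval a * nc_eval b
  | NcScale k a => k *: nc_eval a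
  end.

Definition nc_word (w : seq nat) : A := foldr (fun n a => nth 0 env n * a) 1 w.
Definition nc_sum (s : seq (K * seq nat)) : A :=
  foldr (fun t a => t.1 *: nc_word t.2 + a) 0 s.

Fixpoint nc_insert (k : K) (w : seq nat) (s : seq (K * seq nat)) :=
  match s with
  | [::] => [:: (k, w)]
  | t :: s' => if w == t.2 then (t.1 + k, w) :: s' else t :: nc_insert k w s'
  end.

Fixpoint nc_norm (k : K) (e : nc_expr K) : seq (K * seq nat) :=
  match e with
  | NcVar n => [:: (k, [:: n])]
  | NcZero => [::]
  | NcOne => [:: (k, [::])]
  | NcAdd a b => foldr (fun t => nc_insert t.1 t.2) (nc_norm k b) (nc_norm k a)
  | NcOpp a => nc_norm (- k) a
  | NcMul a b =>
      let sb := nc_norm 1 b in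
      foldr (fun t s => foldr (fun u => nc_insert (t.1 * u.1) (t.2 ++ u.2)) s sb)
        [::] (nc_norm k a)
  | NcScale c a => nc_norm (c * k) a
  end.

Lemma nc_insertE k w s : nc_sum (nc_insert k w s) = k *: nc_word w + nc_sum s.
Proof.
elim: s => [|[c v] s IHs] //=; case: eqP => [->|_] /=.
  by rewrite scalerDl addrA [_ + k *: _]addrC.
by rewrite IHs addrCA.
Qed.

Lemma nc_word_cat v w : nc_word (v ++ w) = nc_word v * nc_word w.
Proof. by elim: v => [|n v IHv] /=; rewrite ?mul1r // IHv mulrA. Qed.

Lemma nc_normE k e : nc_sum (nc_norm k e) = k *: nc_eval e.
Proof.
elim: e k => [n|||a IHa b IHb|a IHa|a IHa b IHb|c a IHa] k /=.
- by rewrite mulr1 addr0.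
- by rewrite scaler0.
- by rewrite addr0.
- rewrite scalerDr -IHa -IHb; elim: (nc_norm k a) => [|t s IHs] /=.
    by rewrite add0r.
  by rewrite nc_insertE IHs addrA.
- by rewrite IHa scaleNr scalerN.
- rewrite scalerAl -[nc_eval b]scale1r -IHa -IHb.
  elim: (nc_norm k a) => [|t s IHs] /=; first by rewrite mul0r.
  rewrite mulrDl -IHs; move: (foldr _ [::] s) => r.
  elim: (nc_norm 1 b) => [|u s' IHs'] /=; first by rewrite mulr0 add0r.
  rewrite nc_insertE IHs' nc_word_cat mulrDr addrA; congr (_ + _ + _).
  by rewrite -scalerAl -scalerAr scalerA.
- by rewrite IHa scalerA mulrC.
Qed.

Fixpoint nc_zero (s : seq (K * seq nat)) : Prop :=
  match s with [::] => True | t :: s' => t.1 = 0 /\ nc_zero s' end.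

Lemma nc_correct a b : nc_zero (nc_norm 1 (NcAdd a (NcOpp b))) ->
  nc_eval a = nc_eval b.
Proof.
move=> E; apply/eqP; rewrite -subr_eq0; apply/eqP.
rewrite -[LHS]scale1r -[_ - _]/(nc_eval (NcAdd a (NcOpp b))) -nc_normE.
by elim: (nc_norm _ _) E => //= t s IHs [-> /IHs ->]; rewrite scale0r addr0.
Qed.

End NcRing.

(** Atoms are compared by [unify], so convertible subterms that are displayed differently share one
    index. *)
Ltac nc_mem x env :=
  lazymatch env with
  | nil => constr:(false)
  | ?y :: ?env' => match constr:(tt) with
      | _ => let _ := match constr:(tt) with _ => unify x y end in constr:(true)
      | _ => nc_mem x env'
      end
  end.

Ltac nc_index x env :=
  lazymatch env with
  | ?y :: ?env' => match constr:(tt) with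
      | _ => let _ := match constr:(tt) with _ => unify x y end in constr:(O)
      | _ => let n := nc_index x env' in constr:(S n)
      end
  end.

Ltac nc_atoms t env :=
  lazymatch t with
  | @GRing.add _ ?a ?b => let env := nc_atoms a env in nc_atoms b env
  | @GRing.opp _ ?a => nc_atoms a env
  | @GRing.mul _ ?a ?b => let env := nc_atoms a env in nc_atoms b env
  | @GRing.scale _ _ _ ?a => nc_atoms a env
  | @GRing.zero _ => env
  | @GRing.one _ => env
  | _ => let m := nc_mem t env in
         lazymatch m with true => env | false => constr:(t :: env) end
  end.

Ltac nc_reify t env :=
  lazymatch t with
  | @GRing.add _ ?a ?b =>
      let a := nc_reify a env in let b := nc_reify b env in open_constr:(NcAdd a b)
  | @GRing.opp _ ?a => let a := nc_reify a env in open_constr:(NcOpp a)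
  | @GRing.mul _ ?a ?b =>
      let a := nc_reify a env in let b := nc_reify b env in open_constr:(NcMul a b)
  | @GRing.scale _ _ ?k ?a => let a := nc_reify a env in open_constr:(NcScale k a)
  | @GRing.zero _ => open_constr:(@NcZero _)
  | @GRing.one _ => open_constr:(@NcOne _)
  | _ => let n := nc_index t env in open_constr:(@NcVar _ n)
  end.

Ltac ncring_coef :=
  rewrite ?expr2;
  lazymatch goal with
  | |- @eq ?A ?x ?y =>
    let env := nc_atoms x (@nil A) in
    let env := nc_atoms y env in
    let a := nc_reify x env in
    let b := nc_reify y env in
    apply: (@nc_correct _ _ env a b)
  end; cbn -[GRing.add GRing.opp GRing.mul GRing.zero GRing.one].

Ltac ncring := rewrite /comm /acomm; ncring_coef; repeat split; ring.

Section LinRing.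
Variables (K : fieldType) (V : lmodType K) (env : seq V).

(** Module terms reuse the syntax of algebra terms: a monomial is a one-letter word, and
    constructors without meaning in a module evaluate to 0. *)
Fixpoint lm_eval (e : nc_expr K) : V :=
  match e with
  | NcVar n => nth 0 env n
  | NcAdd a b => lm_eval a + lm_eval b
  | NcOpp a => - lm_eval a
  | NcScale k a => k *: lm_eval a
  | _ => 0
  end.

Definition lm_sum (s : seq (K * seq nat)) : V :=
  foldr (fun t v => t.1 *: nth 0 env (head 0%N t.2) + v) 0 s.

Fixpoint lm_norm (k : K) (e : nc_expr K) : seq (K * seq nat) :=
  match e with
  | NcVar n => [:: (k, [:: n])]
  | NcAdd a b => foldr (fun t => nc_insert t.1 t.2) (lm_norm k b) (lm_norm k a)
  | NcOpp a => lm_norm (- k) a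
  | NcScale c a => lm_norm (c * k) a
  | _ => [::]
  end.

Lemma lm_insertE k w s :
  lm_sum (nc_insert k w s) = k *: nth 0 env (head 0%N w) + lm_sum s.
Proof.
elim: s => [|[c v] s IHs] //=; case: eqP => [->|_] /=.
  by rewrite scalerDl addrA [_ + k *: _]addrC.
by rewrite IHs addrCA.
Qed.

Lemma lm_normE k e : lm_sum (lm_norm k e) = k *: lm_eval e.
Proof.
elim: e k => [n|||a IHa b IHb|a IHa|a _ b _|c a IHa] k /=; rewrite ?scaler0 //.
- by rewrite addr0.
- rewrite scalerDr -IHa -IHb; elim: (lm_norm k a) => [|t s IHs] /=.
    by rewrite add0r.
  by rewrite lm_insertE IHs addrA.
- by rewrite IHa scaleNr scalerN.
- by rewrite IHa scalerA mulrC.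
Qed.

Lemma lm_correct a b : nc_zero (lm_norm 1 (NcAdd a (NcOpp b))) ->
  lm_eval a = lm_eval b.
Proof.
move=> E; apply/eqP; rewrite -subr_eq0; apply/eqP.
rewrite -[LHS]scale1r -[_ - _]/(lm_eval (NcAdd a (NcOpp b))) -lm_normE.
by elim: (lm_norm _ _) E => //= t s IHs [-> /IHs ->]; rewrite scale0r addr0.
Qed.

End LinRing.

Ltac lmring_coef :=
  lazymatch goal with
  | |- @eq ?A ?x ?y =>
    let env := nc_atoms x (@nil A) in
    let env := nc_atoms y env in
    let a := nc_reify x env in
    let b := nc_reify y env in
    apply: (@lm_correct _ _ env a b)
  end; cbn -[GRing.add GRing.opp GRing.mul GRing.zero GRing.one].

Ltac lmring := lmring_coef; repeat split; ring.

(** * Currents and the highest weight series *)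

Section JordanPlane.
Variables (K : fieldType) (A : algType K) (f g : A).
Hypothesis gf : g * f = f * g + g * g.

(** In the application f is the lowering current at v and f + g the one at v + d. Moving g to the
    left lowers the coefficient 2 of g to 1, which drives the next induction. *)
Lemma jordan_shift : (f + 2 *: g) * g = g * (f + g).
Proof.
have -> : g * (f + g) = g * f + g * g by ncring.
rewrite gf; ncring.
Qed.

Lemma jordan_expand m :
  (f + 2 *: g) ^+ m.+1 = (f + g) ^+ m.+1 + m.+1%:R *: (g * (f + g) ^+ m).
Proof.
elim: m => [|m IHm]; first by rewrite !expr1 !expr0; ncring.
rewrite exprS IHm mulrDr -scalerAr mulrA jordan_shift -mulrA -exprS.
have -> : (f + 2 *: g) * (f + g) ^+ m.+1 =
    (f + g) ^+ m.+2 + g * (f + g) ^+ m.+1 by rewrite [in RHS]exprS; ncring.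
rewrite -(natr1 m.+1); ncring.
Qed.

Lemma jordan_sum m :
  m.+1%:R *: (f * (f + g) ^+ m) + (f + 2 *: g) ^+ m.+1 =
  m.+2%:R *: (f + g) ^+ m.+1.
Proof.
rewrite jordan_expand -(natr1 m.+1) [in RHS]exprS.
rewrite exprS; ncring.
Qed.

Variables (e xi w : A) (c : K).
Hypothesis xif : xi * f = (f + 2 *: g) * xi.
Hypothesis ef : comm e f = xi - 1.
Hypotheses (ew : e * w = 0) (xiw : xi * w = c *: w).

(** Moving e past one factor f at a time leaves c times m f (f + g)^(m-1) + (f + 2g)^m, which
    [jordan_sum] collapses to (m+1) (f + g)^m. Hence only the currents at v and v + d survive. *)
Lemma raise_current m :
  e * f ^+ m.+1 * w = m.+1%:R *: ((c *: (f + g) ^+ m - f ^+ m) * w).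
Proof.
have xifX n : xi * f ^+ n = (f + 2 *: g) ^+ n * xi.
  elim: n => [|n IHn]; first by rewrite !expr0 mul1r mulr1.
  by rewrite exprSr mulrA IHn -mulrA xif mulrA -exprSr.
elim: m => [|m IHm].
  rewrite !expr0 expr1; have -> : e * f = f * e + xi - 1.
    by rewrite -addrA -ef; ncring.
  have -> : (f * e + xi - 1) * w = f * (e * w) + xi * w - w by ncring.
  rewrite ew xiw; ncring.
rewrite exprS mulrA; have -> : e * f = f * e + xi - 1.
  by rewrite -addrA -ef; ncring.
have -> : (f * e + xi - 1) * f ^+ m.+1 * w =
   f * (e * f ^+ m.+1 * w) + xi * f ^+ m.+1 * w - f ^+ m.+1 * w by ncring.
rewrite IHm xifX -mulrA xiw.
have -> : (f + 2 *: g) ^+ m.+1 =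
    m.+2%:R *: (f + g) ^+ m.+1 - m.+1%:R *: (f * (f + g) ^+ m).
  by rewrite -jordan_sum [RHS]addrC addKr.
rewrite !(exprS f m) -(natr1 m.+1); ncring.
Qed.

End JordanPlane.

Section LinearCombination.
Variables (K : fieldType) (V : lmodType K).
Implicit Types (x y a b : V) (k : K).

(** Certificates for linear consequences of known relations: the multipliers are given by hand and
    the remaining identity is left to normalization. *)
Lemma lincomb1 k a b x y : a = b -> x - y = k *: (a - b) -> x = y.
Proof. by move=> ->; rewrite subrr scaler0 => /eqP; rewrite subr_eq0 => /eqP. Qed.

Lemma lincomb2 k1 k2 a1 b1 a2 b2 x y : a1 = b1 -> a2 = b2 ->
  x - y = k1 *: (a1 - b1) + k2 *: (a2 - b2) -> x = y.
Proof.
by move=> -> E; rewrite subrr scaler0 add0r; apply: lincomb1.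
Qed.

Lemma lincomb3 k1 k2 k3 a1 b1 a2 b2 a3 b3 x y : a1 = b1 -> a2 = b2 -> a3 = b3 ->
  x - y = k1 *: (a1 - b1) + k2 *: (a2 - b2) + k3 *: (a3 - b3) -> x = y.
Proof.
by move=> -> E2 E3; rewrite subrr scaler0 add0r; apply: lincomb2.
Qed.

End LinearCombination.

Section Currents.
Variables (K : numFieldType) (chi : {poly K}).

(* If y is chi-recurrent, then the series sum_r u^(-r-1) y_r is rational in u
   with denominator chi(u); current v y is its value at u = v. *)
Definition cur_coef (v : K) (r : nat) : K :=
  (drop_poly r.+1 chi).[v] / chi.[v].

Definition current (V : lmodType K) (v : K) (y : nat -> V) : V :=
  \sum_(r < size chi) cur_coef v r *: y r.

Definition chi_recurrent (V : lmodType K) (y : nat -> V) : Prop :=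
  forall r, \sum_(k < size chi) chi`_k *: y (r + k)%N = 0.

Lemma drop_polyS_horner (p : {poly K}) r v :
  (drop_poly r p).[v] = p`_r + v * (drop_poly r.+1 p).[v].
Proof.
have -> : drop_poly r p = (p`_r)%:P + 'X * drop_poly r.+1 p.
  apply/polyP => k; rewrite coefD coefC coefXM !coef_drop_poly.
  by case: k => [|k] /=; rewrite ?addr0 // add0r addnS.
by rewrite hornerD hornerC hornerM hornerX.
Qed.

(** For Y(v) = sum y_r v^(-r-1) the shifted series is v Y(v) - y_0. After clearing chi(v), the
    Horner scheme C_r = chi_r + v C_(r+1) reduces the claim to sum chi_r y_r = 0, the recurrence at
    0. *)
Lemma current_shift (V : lmodType K) (y : nat -> V) v :
  chi_recurrent y -> chi.[v] != 0 ->
  current v (fun r => y r.+1) = v *: current v y - y 0.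
Proof.
move=> yrec chiv.
apply: (scalerI chiv); rewrite scalerBr [v *: _]scaler_sumr !scaler_sumr.
pose C r := (drop_poly r chi).[v].
have E r (z : V) : chi.[v] *: (cur_coef v r *: z) = C r.+1 *: z.
  by rewrite scalerA /cur_coef mulrC divfK.
under eq_bigr => r _ do rewrite E.
under [in RHS]eq_bigr => r _ do
  rewrite [v *: _]scalerA [v * _]mulrC -scalerA E scalerA.
have Cs : C (size chi) = 0.
  by rewrite /C drop_poly_eq0 // horner0.
have C0 : C 0 = chi.[v] by rewrite /C drop_poly0l.
have S1 : \sum_(i < size chi) C i.+1 *: y i.+1 =
    \sum_(i < size chi) C i *: y i - chi.[v] *: y 0.
  have -> : \sum_(i < size chi) C i.+1 *: y i.+1 =
     \sum_(i < (size chi).+1) C i *: y i - C 0 *: y 0.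
    by rewrite big_ord_recl addrC addKr.
  by rewrite big_ord_recr /= Cs scale0r addr0 C0.
rewrite S1; congr (_ - _).
have S0 : \sum_(k < size chi) chi`_k *: y k = 0 := yrec 0%N.
rewrite -[RHS]add0r -[X in X + _]S0 -big_split /=; apply: eq_bigr => i _.
by rewrite -scalerDl {1}/C drop_polyS_horner [v * _]mulrC.
Qed.

Section Algebra.
Variable A : algType K.
Implicit Types a b x : nat -> A.

Lemma current_mull z v a : z * current v a = current v (fun r => z * a r).
Proof. by rewrite mulr_sumr; apply: eq_bigr => r _; rewrite scalerAr. Qed.

Lemma current_mulr z v a : current v a * z = current v (fun r => a r * z).
Proof. by rewrite mulr_suml; apply: eq_bigr => r _; rewrite scalerAl. Qed.

Lemma current_comm z v a : comm z (current v a) = current v (fun r => comm z (a r)).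
Proof.
rewrite /comm current_mull current_mulr -sumrB.
by apply: eq_bigr => r _; rewrite scalerBr.
Qed.

Definition current2 u v (F : nat -> nat -> A) : A :=
  \sum_(r < size chi) \sum_(s < size chi)
    (cur_coef u r * cur_coef v s) *: F r s.

Lemma current2_comm u v a b :
  comm (current u a) (current v b) = current2 u v (fun r s => comm (a r) (b s)).
Proof.
rewrite /comm {1}/current mulr_suml current_mull /current -sumrB.
rewrite /current2; under [RHS]eq_bigr => r _ do
  under eq_bigr => s _ do rewrite scalerBr.
under [RHS]eq_bigr => r _ do rewrite sumrB.
rewrite !sumrB; congr (_ - _).
  apply: eq_bigr => r _; rewrite mulr_sumr; apply: eq_bigr => s _.
  by rewrite -scalerAr -scalerAl scalerA mulrC.
apply: eq_bigr => r _; rewrite mulr_suml scaler_sumr; apply: eq_bigr => s _.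
by rewrite -scalerAl scalerA.
Qed.

Lemma current2_acomm u v a b :
  acomm (current u a) (current v b) =
  current2 u v (fun r s => acomm (a r) (b s)).
Proof.
rewrite /acomm {1}/current mulr_suml current_mull /current -big_split.
rewrite /current2; under [RHS]eq_bigr => r _ do
  under eq_bigr => s _ do rewrite scalerDr.
under [RHS]eq_bigr => r _ do rewrite big_split.
rewrite !big_split /=; congr (_ + _).
  apply: eq_bigr => r _; rewrite mulr_sumr; apply: eq_bigr => s _.
  by rewrite -scalerAr -scalerAl scalerA mulrC.
apply: eq_bigr => r _; rewrite mulr_suml scaler_sumr; apply: eq_bigr => s _.
by rewrite -scalerAl scalerA.
Qed.

Lemma current_rel (k : K) u v a b :
  (forall r s, comm (a r.+1) (b s) - comm (a r) (b s.+1)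
     = k *: acomm (a r) (b s)) ->
  comm (current u (fun r => a r.+1)) (current v b)
  - comm (current u a) (current v (fun s => b s.+1))
  = k *: acomm (current u a) (current v b).
Proof.
move=> ab; rewrite !current2_comm current2_acomm /current2 -sumrB scaler_sumr.
apply: eq_bigr => r _; rewrite -sumrB scaler_sumr; apply: eq_bigr => s _.
by rewrite -scalerBr ab !scalerA mulrC.
Qed.

Variables (d : K) (e : A) (x xi : nat -> A).
Hypothesis d0 : d != 0.
Hypothesis xi0x : forall s, comm (xi 0%N) (x s) = (- (2 * d)) *: x s.
Hypothesis ex : forall r, comm e (x r) = xi r.
Hypothesis xix : forall r s,
  comm (xi r.+1) (x s) - comm (xi r) (x s.+1) = (- d) *: acomm (xi r) (x s).
Hypothesis xx : forall r s,
  comm (x r.+1) (x s) - comm (x r) (x s.+1) = (- d) *: acomm (x r) (x s).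
Hypothesis xrec : chi_recurrent x.

Lemma xi_recurrent : chi_recurrent xi.
Proof.
move=> r; have := congr1 (comm e) (xrec r); rewrite /comm mulr0 mul0r subrr.
rewrite mulr_sumr mulr_suml -sumrB => S0; rewrite -[RHS]S0; apply: eq_bigr => k _.
by rewrite -ex /comm scalerBr scalerAr scalerAl.
Qed.

Local Notation f v := (current v x).
Local Notation xiv v := (1 + current v xi).

Lemma current_ef v : comm e (f v) = xiv v - 1.
Proof.
by rewrite current_comm [RHS]addrC addKr /current; under eq_bigr do rewrite ex.
Qed.

(** The diagonal case u = v, where only the boundary terms of [current_shift] remain; it serves to
    eliminate [x 0] for general u and v. *)
Lemma current_x0f u : chi.[u] != 0 -> comm (x 0%N) (f u) = d *: (f u * f u).
Proof.
move=> cu; have := current_rel u u xx; rewrite !current_shift //.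
move=> E; apply: (lincomb1 (k := - 2^-1) E).
by rewrite /comm /acomm; ncring_coef; repeat split; field.
Qed.

Lemma current_ff u v : chi.[u] != 0 -> chi.[v] != 0 ->
  (u - v) *: comm (f u) (f v) = d *: ((f u - f v) * (f u - f v)).
Proof.
move=> cu cv; have := current_rel u v xx; rewrite !current_shift // => E.
apply: (lincomb3 (k1 := 1) (k2 := 1) (k3 := 1) E (current_x0f cu)
  (current_x0f cv)).
ncring.
Qed.

Lemma current_xif u v : chi.[u] != 0 -> chi.[v] != 0 ->
  (u - v) *: comm (xiv u) (f v) = (- d) *: acomm (xiv u) (f v - f u).
Proof.
have key u' v' : chi.[u'] != 0 -> chi.[v'] != 0 ->
    (u' - v') *: comm (xiv u') (f v') + (2 * d) *: f v'
    + comm (current u' xi) (x 0%N) = (- d) *: acomm (current u' xi) (f v').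
  move=> cu cv; have := current_rel u' v' xix.
  rewrite !current_shift //; last exact: xi_recurrent.
  move=> E; have E0 : comm (xi 0%N) (f v') = (- (2 * d)) *: f v'.
    rewrite current_comm /current scaler_sumr; apply: eq_bigr => r _.
    by rewrite xi0x !scalerA mulrC.
  apply: (lincomb2 (k1 := 1) (k2 := 1) E E0); ncring.
(* The term with [x 0] depends on u alone and cancels between the instances (u, v) and (u, u). *)
move=> cu cv; apply: (lincomb2 (k1 := 1) (k2 := -1) (key _ _ cu cv) (key _ _ cu cu)).
ncring.
Qed.

Definition dshift v := f (v + d) - f v.

Lemma current_jordan v : chi.[v] != 0 -> chi.[v + d] != 0 ->
  dshift v * f v = f v * dshift v + dshift v * dshift v.
Proof.
move=> cv cvd; apply: (lincomb1 (k := d^-1) (current_ff cvd cv)).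
by rewrite /dshift /comm; ncring_coef; repeat split; field.
Qed.

Lemma current_xi_jordan v : chi.[v] != 0 -> chi.[v + d] != 0 ->
  xiv v * f v = (f v + 2 *: dshift v) * xiv v.
Proof.
move=> cv cvd; apply: (lincomb1 (k := - d^-1) (current_xif cv cvd)).
by rewrite /dshift /comm /acomm; ncring_coef; repeat split; field.
Qed.

Lemma raise_currentX (c : K) w m v : chi.[v] != 0 -> chi.[v + d] != 0 ->
  e * w = 0 -> xiv v * w = c *: w ->
  e * f v ^+ m.+1 * w
  = m.+1%:R *: ((c *: f (v + d) ^+ m - f v ^+ m) * w).
Proof.
move=> cv cvd ew xiw.
have := raise_current (current_jordan cv cvd) (current_xi_jordan cv cvd)
  (current_ef v) ew xiw m.
by have -> : f v + dshift v = f (v + d) by rewrite /dshift addrC subrK.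
Qed.

End Algebra.
End Currents.

Lemma shift_polyE (K : fieldType) (a v : K) (p : {poly K}) :
  (shift_poly a p).[v] = p.[v + a].
Proof. by rewrite /shift_poly horner_comp hornerD hornerX hornerC. Qed.

Lemma shift_polyM (K : fieldType) (a : K) (p q : {poly K}) :
  shift_poly a (p * q) = shift_poly a p * shift_poly a q.
Proof. exact: comp_polyM. Qed.

Lemma poly_eq0_everywhere (K : numFieldType) (p : {poly K}) :
  (forall v, p.[v] = 0) -> p = 0.
Proof.
move=> p0; apply/eqP; apply/negPn/negP => pn0.
pose s := [seq (k%:R : K) | k <- iota 0 (size p)].
suff: (size s < size p)%N by rewrite size_map size_iota ltnn.
apply: max_poly_roots => //; first by apply/allP => v _; rewrite /root p0.
rewrite map_inj_uniq ?iota_uniq // => a b /eqP.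
by rewrite eqr_nat => /eqP.
Qed.

Lemma shift_poly_eq0 (K : fieldType) (a : K) (p : {poly K}) :
  (shift_poly a p == 0) = (p == 0).
Proof. by rewrite comp_poly2_eq0 // size_XaddC. Qed.

(** * The difference equation satisfied by the highest weight series *)

Section FiniteDifferences.
Variables (K : numFieldType) (d : K) (chi N : {poly K}).

(* For gamma = N / chi, diff_poly m is chi_string m times
   sum_k (-1)^k binom(m,k) prod_{j<k} gamma(v+jd). *)
Fixpoint diff_poly (m : nat) : {poly K} :=
  if m is m'.+1 then
    diff_poly m' * shift_poly (d *+ m') chi - N * shift_poly d (diff_poly m')
  else 1.

Definition chi_string (m : nat) : {poly K} :=
  \prod_(j < m) shift_poly (d *+ j) chi.

Lemma chi_string_recl m :
  chi_string m.+1 = chi * shift_poly d (chi_string m).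
Proof.
rewrite /chi_string big_ord_recl /shift_poly mulr0n addr0 comp_polyXr.
congr (_ * _).
rewrite (big_morph (fun p => p \Po ('X + d%:P))
  (fun p q => comp_polyM p q _) (comp_polyC _ _)).
apply: eq_bigr => j _.
rewrite -comp_polyA comp_polyD comp_polyX comp_polyC -addrA -polyCD.
by rewrite -mulrS.
Qed.

(** At the last index k with [diff_poly k] nonzero, the vanishing of the next one is the asserted
    equation. It says gamma(u) = p(u+d)/p(u) for p = [chi_string k] / E. *)
Lemma diff_poly_root m :
  chi != 0 -> diff_poly m = 0 ->
  exists E k, E != 0 /\ N * shift_poly d E = E * shift_poly (d *+ k) chi.
Proof.
move=> chi0; elim: m => [|m IHm] /=; first by move/eqP; rewrite oner_eq0.
have [/IHm //|Em0] := eqVneq (diff_poly m) 0.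
move/eqP; rewrite subr_eq0 => /eqP E.
by exists (diff_poly m), m.
Qed.

End FiniteDifferences.

Section HighestWeightSeries.
Variables (K : numFieldType) (chi : {poly K}) (A : algType K).
Variables (d : K) (e : A) (x xi : nat -> A).
Hypothesis d0 : d != 0.
Hypothesis xi0x : forall s, comm (xi 0%N) (x s) = (- (2 * d)) *: x s.
Hypothesis ex : forall r, comm e (x r) = xi r.
Hypothesis xix : forall r s,
  comm (xi r.+1) (x s) - comm (xi r) (x s.+1) = (- d) *: acomm (xi r) (x s).
Hypothesis xx : forall r s,
  comm (x r.+1) (x s) - comm (x r) (x s.+1) = (- d) *: acomm (x r) (x s).
Hypothesis xrec : chi_recurrent chi x.
Variables (w : A) (gamma : nat -> K).
Hypotheses (ew : e * w = 0) (xiw : forall r, xi r * w = gamma r *: w).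

(** This is chi(u) (1 + sum gamma_r u^(-r-1)), which is a polynomial once gamma satisfies the
    recurrence given by chi. *)
Definition weight_num : {poly K} :=
  chi + \sum_(r < size chi) gamma r *: drop_poly r.+1 chi.

Local Notation f v := (current chi v x).
Local Notation E := (diff_poly d chi weight_num).
Local Notation B := (chi_string d chi).

Lemma xiv_w v : chi.[v] != 0 ->
  (1 + current chi v xi) * w = (weight_num.[v] / chi.[v]) *: w.
Proof.
move=> cv; rewrite mulrDl mul1r current_mulr /weight_num hornerD mulrDl divff //.
rewrite scalerDl scale1r; congr (_ + _).
rewrite horner_sum mulr_suml scaler_suml; apply: eq_bigr => r _.
by rewrite xiw scalerA hornerZ /cur_coef -mulrA mulrC.
Qed.

(** One application of e produces the currents at v + d and at v, so the induction hypothesis is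
    needed at both points. Splitting a factor of [chi_string m.+1] off either end matches the
    recursion of [diff_poly]. *)
Lemma raise_string m v : (forall j, (j <= m)%N -> chi.[v + d *+ j] != 0) ->
  (B m).[v] *: (e ^+ m * f v ^+ m * w) =
  ((-1) ^+ m * m`!%:R * (E m).[v]) *: w.
Proof.
elim: m v => [|m IHm] v cv.
  by rewrite /chi_string big_ord0 !expr0 /= hornerC !mul1r scale1r.
have cv0 : chi.[v] != 0 by have := cv 0%N isT; rewrite mulr0n addr0.
have cv1 : chi.[v + d] != 0 by have := cv 1%N isT; rewrite mulr1n.
have IH0 := IHm v (fun j jm => cv j (leqW jm)).
have IH1 : (B m).[v + d] *: (e ^+ m * f (v + d) ^+ m * w) =
    ((-1) ^+ m * m`!%:R * (E m).[v + d]) *: w.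
  by apply: IHm => j jm; have := cv j.+1 jm; rewrite mulrS addrA.
have B1 : (B m.+1).[v] = chi.[v] * (B m).[v + d].
  by rewrite chi_string_recl hornerM shift_polyE.
have B2 : (B m.+1).[v] = chi.[v + d *+ m] * (B m).[v].
  by rewrite /chi_string big_ord_recr /= hornerM shift_polyE mulrC.
rewrite exprSr -!mulrA [e * (_ * _)]mulrA.
rewrite (raise_currentX d0 xi0x ex xix xx xrec m cv0 cv1 ew (xiv_w cv0)).
set c := weight_num.[v] / chi.[v].
have -> : (B m.+1).[v] *: (e ^+ m * (m.+1%:R *:
     ((c *: f (v + d) ^+ m - f v ^+ m) * w))) =
  m.+1%:R *: (((B m.+1).[v] * c) *: (e ^+ m * f (v + d) ^+ m * w)
     - (B m.+1).[v] *: (e ^+ m * f v ^+ m * w)).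
  ncring.
have -> : (B m.+1).[v] * c = weight_num.[v] * (B m).[v + d].
  by rewrite B1 /c; field.
rewrite B2 -!scalerA IH0 IH1 /= !hornerE !shift_polyE factS natrM exprS; ncring.
Qed.

Lemma weight_num_factor :
  chi != 0 -> w != 0 ->
  (exists M, forall v, f v ^+ M * w = 0) ->
  exists F k, F != 0 /\
    weight_num * shift_poly d F = F * shift_poly (d *+ k) chi.
Proof.
move=> chi0 w0 [M fM]; apply: (diff_poly_root (m := M)) => //.
have B0 : B M.+1 != 0.
  by apply/prodf_neq0 => j _; rewrite shift_poly_eq0.
(* The evaluation is available only where no chi(v + jd) vanishes; the factor [B M.+1] is zero
   elsewhere and makes the identity hold at every v. *)
have : E M * B M.+1 = 0.
  apply: poly_eq0_everywhere => v; rewrite hornerM.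
  have [->|Bv] := eqVneq (B M.+1).[v] 0; first by rewrite mulr0.
  have cv j : (j <= M)%N -> chi.[v + d *+ j] != 0.
    move=> jM; apply: contra Bv => /eqP cj.
    rewrite /chi_string horner_prod (bigD1 (inord j)) //= shift_polyE inordK //.
    by rewrite cj mul0r.
  have := raise_string cv; rewrite -mulrA fM mulr0 scaler0 => /esym/eqP.
  rewrite scaler_eq0 (negPf w0) orbF !mulf_eq0 signr_eq0 pnatr_eq0.
  by rewrite -leqn0 leqNgt fact_gt0 /= => /eqP ->; rewrite mul0r.
by move/eqP; rewrite mulf_eq0 (negPf B0) orbF => /eqP.
Qed.

End HighestWeightSeries.

(** * The twisted Cartan currents on a highest weight vector *)

Section Degrees.
Variables (K : numFieldType) (A : algType K) (H : A).
Implicit Types (a b : A) (j k : int).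

Definition homogeneous k a : Prop := comm H a = k%:~R *: a.

(** A filtration, because the images of the twisted generators spread over several degrees of which
    only the lowest are computed. *)
Inductive deg_ge k : A -> Prop :=
| deg_ge0 : deg_ge k 0
| deg_geD j a b : k <= j -> homogeneous j a -> deg_ge k b -> deg_ge k (a + b).

Lemma homogeneousM j k a b :
  homogeneous j a -> homogeneous k b -> homogeneous (j + k) (a * b).
Proof.
rewrite /homogeneous => Ha Hb.
have -> : comm H (a * b) = comm H a * b + a * comm H b by ncring.
rewrite Ha Hb rmorphD /=; ncring.
Qed.

Lemma homogeneousZ k c a : homogeneous k a -> homogeneous k (c *: a).
Proof.
rewrite /homogeneous => Ha; have -> : comm H (c *: a) = c *: comm H a by ncring.
by rewrite Ha !scalerA mulrC.
Qed.

Lemma homogeneousD k a b :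
  homogeneous k a -> homogeneous k b -> homogeneous k (a + b).
Proof.
rewrite /homogeneous => Ha Hb.
have -> : comm H (a + b) = comm H a + comm H b by ncring.
by rewrite Ha Hb scalerDr.
Qed.

Lemma homogeneous_comm j k a b :
  homogeneous j a -> homogeneous k b -> homogeneous (j + k) (comm a b).
Proof.
move=> Ha Hb; apply: homogeneousD; first exact: homogeneousM.
by rewrite -scaleN1r addrC; apply: homogeneousZ; apply: homogeneousM.
Qed.

Lemma homogeneous_deg_ge j k a : k <= j -> homogeneous j a -> deg_ge k a.
Proof. by move=> kj Ha; rewrite -[a]addr0; apply: deg_geD Ha (deg_ge0 _). Qed.

Lemma deg_ge_add k a b : deg_ge k a -> deg_ge k b -> deg_ge k (a + b).
Proof.
move=> Ha Hb; elim: Ha => [|j a1 a2 kj Ha1 _ IH]; first by rewrite add0r.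
by rewrite -addrA; apply: deg_geD Ha1 IH.
Qed.

Lemma deg_geZ k c a : deg_ge k a -> deg_ge k (c *: a).
Proof.
elim=> [|j a1 a2 kj Ha1 _ IH]; first by rewrite scaler0; exact: deg_ge0.
by rewrite scalerDr; apply: deg_geD kj (homogeneousZ c Ha1) IH.
Qed.

Lemma deg_ge_sub k a b : deg_ge k a -> deg_ge k b -> deg_ge k (a - b).
Proof.
by move=> Ha Hb; apply: deg_ge_add => //; rewrite -scaleN1r; apply: deg_geZ.
Qed.

Lemma deg_ge_le j k a : j <= k -> deg_ge k a -> deg_ge j a.
Proof.
move=> jk; elim=> [|i a1 a2 ki Ha1 _ IH]; first exact: deg_ge0.
exact: deg_geD (le_trans jk ki) Ha1 IH.
Qed.

Lemma deg_geM j k a b : deg_ge j a -> deg_ge k b -> deg_ge (j + k) (a * b).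
Proof.
move=> Ha Hb; elim: Ha => [|i a1 a2 ji Ha1 _ IH].
  by rewrite mul0r; exact: deg_ge0.
rewrite mulrDl; apply: deg_ge_add => //.
elim: Hb => [|l b1 b2 kl Hb1 _ IHb]; first by rewrite mulr0; exact: deg_ge0.
by rewrite mulrDr; apply: deg_geD (lerD ji kl) (homogeneousM Ha1 Hb1) IHb.
Qed.

Lemma deg_ge_comm j k a b :
  deg_ge j a -> deg_ge k b -> deg_ge (j + k) (comm a b).
Proof.
move=> Ha Hb; apply: deg_ge_sub; first exact: deg_geM.
by rewrite addrC; apply: deg_geM.
Qed.

Lemma deg_ge_sum k (I : Type) (s : seq I) (P : pred I) (F : I -> A) :
  (forall i, P i -> deg_ge k (F i)) -> deg_ge k (\sum_(i <- s | P i) F i).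
Proof.
by move=> HF; apply: big_rec => [|i a Pi]; [exact: deg_ge0 |
  apply: deg_ge_add; exact: HF].
Qed.

Variables (w : A) (mu : K).
Hypothesis Hw : H * w = mu *: w.
Hypothesis top : forall (k : nat) z, H * z = (mu + k.+1%:R) *: z -> z = 0.

Lemma homogeneous_mul k (c : K) a z : homogeneous k a -> H * z = c *: z ->
  H * (a * z) = (c + k%:~R) *: (a * z).
Proof.
rewrite /homogeneous /comm => Ha Hz.
have -> : H * (a * z) = (H * a - a * H) * z + a * (H * z) by ncring.
rewrite Ha Hz; ncring.
Qed.

(** A component of positive degree j would carry w to the eigenvalue mu + j, which [top]
    excludes. *)
Lemma deg_ge_kill k a : 1 <= k -> deg_ge k a -> a * w = 0.
Proof.
move=> k1; elim=> [|j a1 a2 kj Ha1 _ IH]; first by rewrite mul0r.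
rewrite mulrDl IH addr0; have := le_trans k1 kj.
case: j Ha1 {kj} => [[|j]|] // Ha1 _.
by apply: (top (k := j)); rewrite (homogeneous_mul Ha1 Hw).
Qed.

End Degrees.

(** * Rank one computation: the parts of degree -1 and 1 of the twisted generators *)

Section HighestWeightVector.
Variables (K : numFieldType) (A : algType K) (d : K) (H e R w : A).
Variables (x xi b h : nat -> A) (mu : K) (gamma : nat -> K).
Hypothesis d0 : d != 0.
Hypothesis xi0x : forall s, comm (xi 0%N) (x s) = (- (2 * d)) *: x s.
Hypothesis ex : forall r, comm e (x r) = xi r.
Hypothesis xix : forall r s,
  comm (xi r.+1) (x s) - comm (xi r) (x s.+1) = (- d) *: acomm (xi r) (x s).
Hypothesis xx : forall r s,
  comm (x r.+1) (x s) - comm (x r) (x s.+1) = (- d) *: acomm (x r) (x s).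
Hypothesis Hx : forall r, homogeneous H (-1) (x r).
Hypothesis Hxi : forall r, homogeneous H 0 (xi r).
Hypothesis He : homogeneous H 1 e.
Hypothesis HR : deg_ge H 2 R.
Hypothesis HRx : forall r, deg_ge H 2 (comm R (x r)).

Local Notation T := (xi 1%N - 2^-1 *: (xi 0%N * xi 0%N)).

Hypothesis h0E : h 0%N = 2 *: T + (2 * d) *: (e * e) + R.
Hypothesis b0E : b 0%N = e - x 0%N.
Hypothesis hb : forall s, comm (h 0%N) (b s) = (4 * d) *: b s.+1.
Hypothesis bb : forall r, comm (b r.+1) (b r) - comm (b r) (b r.+1)
  = d *: acomm (b r) (b r) - (2 * (-1) ^+ r) *: h r.
Hypothesis Hw : H * w = mu *: w.
Hypothesis top : forall (k : nat) z, H * z = (mu + k.+1%:R) *: z -> z = 0.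
Hypothesis xiw : forall r, xi r * w = gamma r *: w.

(* The component of degree 1 of b_{i,r}; the one of degree -1 is
   (-1)^(r+1) x_{i,r}^-. *)
Fixpoint raising_part (r : nat) : A :=
  if r is r'.+1 then
    (2 * d)^-1 *: comm T (raising_part r')
    + ((-1) ^+ r'.+1 / 2) *: acomm e (xi r')
  else e.
Local Notation p := raising_part.

(** The correction by half the square of xi_0 cancels the anticommutator in the relation of xi_1
    with x_s, so T acts as a pure shift of modes. *)
Lemma comm_Tx s : comm T (x s) = (- (2 * d)) *: x s.+1.
Proof.
have E0 := xi0x s; have E1 := xi0x s.+1; have Ex := xix 0%N s.
have F : comm (xi 0%N * xi 0%N) (x s) = (- (2 * d)) *: acomm (xi 0%N) (x s).
  have -> : comm (xi 0%N * xi 0%N) (x s) =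
      acomm (xi 0%N) (comm (xi 0%N) (x s)) by ncring.
  rewrite E0; ncring.
apply: (lincomb3 (k1 := 1) (k2 := - 2^-1) (k3 := 1) Ex F E1).
by rewrite /comm /acomm; ncring_coef; repeat split; field.
Qed.

Lemma homogeneous_T : homogeneous H 0 T.
Proof.
apply: homogeneousD => //; rewrite -scaleNr; apply: homogeneousZ.
by have := homogeneousM (Hxi 0%N) (Hxi 0%N); rewrite addr0.
Qed.

Lemma homogeneous_raising_part r : homogeneous H 1 (p r).
Proof.
elim: r => [|r IHr] //=; apply: homogeneousD; apply: homogeneousZ.
  by have := homogeneous_comm homogeneous_T IHr; rewrite add0r.
apply: homogeneousD; last first.
  by have := homogeneousM (Hxi r) He; rewrite add0r.
by have := homogeneousM He (Hxi r); rewrite addr0.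
Qed.

(** By [hb] each [b r.+1] is a multiple of [comm (h 0) (b r)]. The part of degree -1 is shifted by
    T, the part of degree 1 gains [e^2, x_r] = {e, xi_r}, and whatever involves R has degree at
    least 2. *)
Lemma b_decomp r :
  deg_ge H 2 (b r - (-1) ^+ r.+1 *: x r - p r).
Proof.
elim: r => [|r IHr].
  rewrite b0E expr1 /=; have -> : e - x 0%N - -1 *: x 0%N - e = 0 by ncring.
  exact: deg_ge0.
set q := b r - _ - _ in IHr.
have bE : b r = (-1) ^+ r.+1 *: x r + p r + q by rewrite /q; ncring.
have exE : comm (e * e) (x r) = acomm e (xi r) by rewrite -ex; ncring.
have E : b r.+1 - (-1) ^+ r.+2 *: x r.+1 - p r.+1 =
   (4 * d)^-1 *: ((-1) ^+ r.+1 *: comm R (x r) + (2 * d) *: comm (e * e) (p r)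
     + comm R (p r) + comm (h 0%N) q).
  have bS : b r.+1 = (4 * d)^-1 *: comm (h 0%N) (b r).
    by rewrite hb scalerA mulVf ?scale1r // mulf_neq0 // pnatr_eq0.
  rewrite bS {1}bE.
  have -> : comm (h 0%N) ((-1) ^+ r.+1 *: x r + p r + q) =
      (-1) ^+ r.+1 *: comm (h 0%N) (x r) + comm (h 0%N) (p r) + comm (h 0%N) q.
    ncring.
  have -> : comm (h 0%N) (x r) =
      2 *: comm T (x r) + (2 * d) *: comm (e * e) (x r) + comm R (x r).
    rewrite h0E; ncring.
  rewrite comm_Tx exE.
  have -> : comm (h 0%N) (p r) =
      2 *: comm T (p r) + (2 * d) *: comm (e * e) (p r) + comm R (p r).
    rewrite h0E; ncring.
  rewrite /= [(-1) ^+ r.+2]exprS.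
  move: (comm (h 0%N) q) (comm T (p r)) (acomm e (xi r)) (comm (e * e) (p r)).
  move: (comm R (p r)) (comm R (x r)) => u1 u2 u3 u4 u5 u6.
  by ncring_coef; repeat split; field.
have Ree : deg_ge H 2 (e * e) by apply: homogeneous_deg_ge (homogeneousM He He).
have Dp : deg_ge H 1 (p r) by apply: homogeneous_deg_ge (homogeneous_raising_part r).
have Dh : deg_ge H 0 (h 0%N).
  rewrite h0E; apply: deg_ge_add; first apply: deg_ge_add.
  - by apply: deg_geZ; apply: homogeneous_deg_ge homogeneous_T.
  - by apply: deg_geZ; apply: deg_ge_le Ree.
  - by apply: deg_ge_le HR.
rewrite E; apply: deg_geZ; apply: deg_ge_add; first apply: deg_ge_add;
  first apply: deg_ge_add.
- exact: deg_geZ (HRx r).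
- by apply: deg_geZ; apply: deg_ge_le (deg_ge_comm Ree Dp).
- by apply: deg_ge_le (deg_ge_comm HR Dp).
- exact: (deg_ge_comm Dh IHr).
Qed.

Lemma hw_kill (k : int) a : 1 <= k -> deg_ge H k a -> a * w = 0.
Proof. exact: (deg_ge_kill Hw top). Qed.

Lemma raising_part_hw r : p r * w = 0.
Proof.
apply: (hw_kill (k := 1)) => //.
exact: homogeneous_deg_ge (homogeneous_raising_part r).
Qed.

Lemma raise_hw : e * w = 0. Proof. exact: (raising_part_hw 0). Qed.

Lemma b_hw r : b r * w = (-1) ^+ r.+1 *: (x r * w).
Proof.
have := hw_kill (isT : 1 <= 2 :> int) (b_decomp r); have := raising_part_hw r.
rewrite !mulrBl => ->; rewrite subr0 => /eqP; rewrite subr_eq0 => /eqP ->.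
by rewrite scalerAl.
Qed.

(** The scalar by which e xi_r x_s acts on w; the recursion is the mode relation of xi with x,
    applied to w. *)
Fixpoint raise_xi_coef (r s : nat) : K :=
  if r is r'.+1 then
    gamma r * gamma s + raise_xi_coef r' s.+1 - gamma r' * gamma s.+1
    - d * (raise_xi_coef r' s + gamma r' * gamma s)
  else (gamma 0%N - 2 * d) * gamma s.

Fixpoint raising_coef (r s : nat) : K :=
  if r is r'.+1 then
    raising_coef r' s.+1 + (-1) ^+ r / 2 * (raise_xi_coef r' s + gamma r' * gamma s)
  else gamma s.

Lemma raise_lower_hw s : e * (x s * w) = gamma s *: w.
Proof.
by rewrite mulrA -[e * x s](subrK (x s * e)) mulrDl -mulrA raise_hw mulr0 addr0
  -[_ - _]/(comm e (x s)) ex xiw.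
Qed.

Lemma raise_xi_lower_hw r s : e * (xi r * (x s * w)) = raise_xi_coef r s *: w.
Proof.
elim: r s => [|r IHr] s.
  have -> : xi 0%N * (x s * w) = comm (xi 0%N) (x s) * w + x s * (xi 0%N * w).
    ncring.
  rewrite xi0x xiw /= mulrDr -scalerAl -!scalerAr !raise_lower_hw; ncring.
have -> : xi r.+1 * (x s * w) = x s * (xi r.+1 * w)
    + (comm (xi r.+1) (x s) - comm (xi r) (x s.+1)) * w
    + xi r * (x s.+1 * w) - x s.+1 * (xi r * w) by ncring.
rewrite xix; have -> : (- d *: acomm (xi r) (x s)) * w =
  - d *: (xi r * (x s * w) + x s * (xi r * w)) by ncring.
rewrite !xiw !(mulrDr, mulrBr, mulrN) -!scalerAr !(mulrDr, mulrBr, mulrN).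
rewrite -!scalerAr !raise_lower_hw !IHr /=; ncring.
Qed.

Lemma raising_part_lower_hw r s : p r * (x s * w) = raising_coef r s *: w.
Proof.
elim: r s => [|r IHr] s /=; first exact: raise_lower_hw.
have -> : ((2 * d)^-1 *: comm T (p r) + ((-1) ^+ r.+1 / 2) *: acomm e (xi r))
   * (x s * w) =
  (2 * d)^-1 *: (T * (p r * (x s * w)) - p r * (comm T (x s) * w)
     - p r * (x s * (T * w)))
  + ((-1) ^+ r.+1 / 2) *: (e * (xi r * (x s * w)) + xi r * (e * (x s * w))).
  move: (T) => t; ncring.
have Tw : T * w = (gamma 1%N - 2^-1 * (gamma 0%N * gamma 0%N)) *: w.
  rewrite mulrBl xiw -scalerAl -mulrA xiw -scalerAr xiw; ncring.
rewrite comm_Tx Tw IHr raise_lower_hw raise_xi_lower_hw.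
rewrite -scalerAr Tw -scalerAl -!scalerAr !IHr xiw.
by ncring_coef; repeat split; field.
Qed.

Lemma bb_hw r s : b r * (b s * w) =
  (-1) ^+ (r + s) *: (x r * (x s * w)) - (-1) ^+ s *: (raising_coef r s *: w).
Proof.
rewrite b_hw; set q := b r - (-1) ^+ r.+1 *: x r - p r.
have -> : b r = (-1) ^+ r.+1 *: x r + p r + q by rewrite /q; ncring.
have q0 : q * (x s * w) = 0.
  (* The remainder has degree at least 2 and [x s] has degree -1, so their product still has
     positive degree. This is why [b_decomp] may neglect degree 2. *)
  rewrite mulrA; apply: (hw_kill (k := 2 + -1)) => //.
  by apply: (deg_geM (b_decomp r)); apply: homogeneous_deg_ge (Hx s).
rewrite -scalerAr mulrDl q0 addr0 mulrDl raising_part_lower_hw -scalerAl.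
rewrite exprD !exprS; ncring.
Qed.

(** [h r] is solved from the relation of b_(r+1) with b_r; on w the terms quadratic in x cancel by
    the relation of x_(r+1) with x_r, and scalars remain. *)
Lemma h_hw r : h r * w =
  (raising_coef r.+1 r + raising_coef r r.+1 - d * raising_coef r r) *: w.
Proof.
have s1 : (-1) ^+ r * (-1) ^+ r = 1 :> K by rewrite -expr2 sqrr_sign.
have hE : (-1) ^+ r *: h r = d *: (b r * b r) - comm (b r.+1) (b r).
  apply: (lincomb1 (k := 2^-1) (bb r)).
  by rewrite /comm /acomm; ncring_coef; repeat split; field.
have {}hE : h r = (-1) ^+ r *: (d *: (b r * b r) - comm (b r.+1) (b r)).
  by rewrite -hE scalerA s1 scale1r.
rewrite hE; have -> : ((-1) ^+ r *: (d *: (b r * b r) - comm (b r.+1) (b r))) * w =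
  (-1) ^+ r *: (d *: (b r * (b r * w)) - b r.+1 * (b r * w) + b r * (b r.+1 * w)).
  ncring.
rewrite !bb_hw addSn addnS !exprS !exprD s1.
have E : x r.+1 * (x r * w) - x r * (x r.+1 * w) = - d *: (x r * (x r * w)).
  have := congr1 (fun a => a * w) (xx r r); rewrite /comm /acomm => F.
  apply: (lincomb1 (k := 2^-1) F).
  by ncring_coef; repeat split; field.
apply: (lincomb1 (k := (-1) ^+ r) E).
have -> : (raising_coef r.+1 r + raising_coef r r.+1 - d * raising_coef r r) *: w =
  ((-1) ^+ r * (-1) ^+ r *
   (raising_coef r.+1 r + raising_coef r r.+1 - d * raising_coef r r)) *: w.
  by rewrite s1 mul1r.
move: (raising_coef r.+1 r) => u; ncring.
Qed.

Lemma alt_sum_shift (z : nat -> K) r :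
  \sum_(k < r) (-1) ^+ k * z k.+1 = z 0%N - \sum_(k < r.+1) (-1) ^+ k * z k.
Proof.
elim: r => [|r IHr]; first by rewrite big_ord0 big_ord1 mul1r subrr.
by rewrite big_ord_recr /= IHr [in RHS]big_ord_recr /= exprS; ring.
Qed.

Lemma raising_coefE r s : raising_coef r s = gamma (r + s)%N - 2^-1 *
  \sum_(k < r) (-1) ^+ k *
    (raise_xi_coef k ((r + s).-1 - k)%N + gamma k * gamma ((r + s).-1 - k)%N).
Proof.
elim: r s => [|r IHr] s /=; first by rewrite big_ord0 mulr0 subr0.
by rewrite IHr addnS /= big_ord_recr /= addKn exprS; field.
Qed.

Lemma alt_sum_sym (y : nat -> K) r :
  (forall k, (k <= r + r)%N -> y (r + r - k)%N = y k) ->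
  \sum_(k < (r + r).+1) (-1) ^+ k * y k =
  \sum_(k < r.+1) (-1) ^+ k * y k + \sum_(k < r) (-1) ^+ k * y k.
Proof.
move=> ysym; rewrite -addSn big_split_ord /=; congr (_ + _).
rewrite (reindex_inj rev_ord_inj) /=; apply: eq_bigr => k _.
have kr : (k.+1 <= r)%N by [].
have E : (r.+1 + (r - k.+1) = r + r - k)%N by lia.
rewrite E ysym; last by apply: leq_trans (leq_addr _ _); rewrite ltnW.
congr (_ * _); rewrite -signr_odd oddB ?addnn ?odd_double ?addFb ?signr_odd //.
by rewrite -addnn; apply: leq_trans (leq_addr _ _); rewrite ltnW.
Qed.

(** The recursion of [raise_xi_coef] writes d times the summands as differences in k, so that after
    reindexing all [raise_xi_coef] cancel. The result is the coefficient of u^(-2r-2) in gamma(u)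
    gamma(-u), where gamma(u) = 1 + sum gamma_k u^(-k-1). *)
Lemma h_coefE r : raising_coef r.+1 r + raising_coef r r.+1 - d * raising_coef r r =
  2 * gamma (r + r).+1
  - \sum_(k < (r + r).+1) (-1) ^+ k * (gamma k * gamma (r + r - k)%N).
Proof.
pose y k := gamma k * gamma (r + r - k)%N.
pose z k := raise_xi_coef k (r + r - k)%N.
rewrite (@alt_sum_sym y) => [|k kr]; last first.
  by rewrite /y subKn // mulrC.
rewrite !raising_coefE addSn addnS /=.
have -> : \sum_(k < r) (-1) ^+ k * (raise_xi_coef k ((r + r).-1 - k)%N
      + gamma k * gamma ((r + r).-1 - k)%N) =
    d^-1 * (\sum_(k < r) (-1) ^+ k * y k.+1 - \sum_(k < r) (-1) ^+ k * y k
     - \sum_(k < r) (-1) ^+ k * z k.+1 + \sum_(k < r) (-1) ^+ k * z k).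
  rewrite -!sumrB -big_split mulr_sumr; apply: eq_bigr => k _ /=.
  have -> : ((r + r).-1 - k = r + r - k.+1)%N by lia.
  have E : (r + r - k = (r + r - k.+1).+1)%N.
    by have := ltn_ord k; lia.
  by rewrite /y /z /= E; field.
rewrite !alt_sum_shift.
have -> : \sum_(k < r.+1) (-1) ^+ k * (raise_xi_coef k (r + r - k)%N
   + gamma k * gamma (r + r - k)%N) =
   \sum_(k < r.+1) (-1) ^+ k * z k + \sum_(k < r.+1) (-1) ^+ k * y k.
  by rewrite -big_split; apply: eq_bigr => k _; rewrite /= mulrDr.
have -> : \sum_(k < r) (-1) ^+ k * (raise_xi_coef k (r + r - k)%N
   + gamma k * gamma (r + r - k)%N) =
   \sum_(k < r) (-1) ^+ k * z k + \sum_(k < r) (-1) ^+ k * y k.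
  by rewrite -big_split; apply: eq_bigr => k _; rewrite /= mulrDr.
rewrite /z /y !subn0 /=; move: (\sum_(k < _) _) => s1.
by field.
Qed.

Lemma h_hw_gamma r : h r * w = (2 * gamma (r + r).+1
  - \sum_(k < (r + r).+1) (-1) ^+ k * (gamma k * gamma (r + r - k)%N)) *: w.
Proof. by rewrite h_hw h_coefE. Qed.

End HighestWeightVector.

(** * The group of weights of the required form *)

Section Expansions.
Variable K : fieldType.
Implicit Types (N D P : {poly K}) (l : nat -> K).

(* Multiplying by X^M turns identities between series in X^-1 into polynomial
   identities up to an error of degree bounded independently of M. *)
Definition trunc_series l (M : nat) : {poly K} := \poly_(i < M.+1) l (M - i)%N.

Definition bounded_size (Q : nat -> {poly K}) : Prop :=
  exists C, forall M, (size (Q M) <= C)%N.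

Lemma coef_mul_trunc D l M t (k : int) :
  ((size D).-1 <= t)%N -> t%:Z = M%:Z + k ->
  (D * trunc_series l M)`_t = \sum_(j < size D | k <= j%:Z) D`_j * l `|j%:Z - k|%N.
Proof.
move=> Dt tk; rewrite -[D in LHS]coefK poly_def mulr_suml coef_sum.
rewrite [RHS]big_mkcond; apply: eq_bigr => -[j jD] _ /=.
rewrite -scalerAl coefZ coefXnM coef_poly.
have jt : (t < j)%N = false by lia.
rewrite jt; case: ifP => [tM|/negbT tM].
  have -> : k <= j%:Z by lia.
  by congr (_ * l _); lia.
have -> : (k <= j%:Z) = false by lia.
by rewrite mulr0.
Qed.

(** From X^(deg D) upwards the truncation is exact: the coefficient at X^(M+k) is that of the series
    product at u^k. For the converse M is taken so large that M + k exceeds both the bound and deg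
    D. *)
Lemma expands_toP N D l :
  expands_to N D l <->
  bounded_size (fun M => D * trunc_series l M - N * 'X^M).
Proof.
split=> [E|[C E] k].
  exists (size D) => M; apply/leq_sizeP => t Dt; rewrite coefB.
  rewrite (@coef_mul_trunc D l M t (t%:Z - M%:Z)); last 2 first.
  - by lia.
  - by rewrite addrC subrK.
  rewrite E coefMXn; case: (ltnP t M) => tM.
    by case tE: (t%:Z - M%:Z) => [n|n]; rewrite ?subrr //; lia.
  have -> : t%:Z - M%:Z = (t - M)%N%:Z by lia.
  by rewrite subrr.
pose M := (C + size D + `|k|)%N.
have [t tE] : exists t : nat, t%:Z = M%:Z + k by exists `|(M%:Z + k)%R|%N; lia.
rewrite -(@coef_mul_trunc D l M t k); [|lia|by []].
have /leq_sizeP/(_ t) := E M; rewrite coefB coefMXn => /(_ _)/eqP.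
rewrite subr_eq0 => /(_ _)/eqP ->; last by lia.
case: k @M tE => n M tE; last by have -> : (t < M)%N by lia.
have -> : (t < M)%N = false by lia.
by have -> : (t - M = n)%N by lia.
Qed.

Lemma bounded_sizeD (P Q : nat -> {poly K}) : bounded_size P -> bounded_size Q ->
  bounded_size (fun M => P M + Q M).
Proof.
move=> [C1 E1] [C2 E2]; exists (maxn C1 C2) => M.
by apply: leq_trans (size_polyD _ _) _; rewrite geq_max !leq_max E1 E2 orbT.
Qed.

Lemma bounded_sizeM (R : {poly K}) Q : bounded_size Q ->
  bounded_size (fun M => R * Q M).
Proof.
move=> [C E]; exists (size R + C)%N => M.
apply: leq_trans (size_polyMleq _ _) _.
by apply: leq_trans (leq_pred _) _; rewrite leq_add2l.
Qed.

Lemma bounded_size_cancel (R : {poly K}) Q : R != 0 ->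
  bounded_size (fun M => R * Q M) -> bounded_size Q.
Proof.
move=> R0 [C E]; exists C => M; have [->|Q0] := eqVneq (Q M) 0.
  by rewrite size_poly0.
apply: leq_trans (E M); rewrite size_mul //.
have R1 : (0 < size R)%N by rewrite size_poly_gt0.
move: (size R) (size (Q M)) R1 => r q; lia.
Qed.

Lemma eq_bounded_size (P Q : nat -> {poly K}) :
  (forall M, P M = Q M) -> bounded_size P -> bounded_size Q.
Proof. by move=> E [C F]; exists C => M; rewrite -E. Qed.

(** Multiplying by D' and cancelling D both keep an error bounded, so only the fraction matters. *)
Lemma expands_to_cross N D N' D' l : D != 0 -> N * D' = N' * D ->
  expands_to N D l -> expands_to N' D' l.
Proof.
move=> D0 E /expands_toP/(bounded_sizeM D') B; apply/expands_toP.
apply: (bounded_size_cancel D0); apply: eq_bounded_size B => M.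
by rewrite !mulrBr !mulrA [D * N']mulrC -E [D' * N]mulrC [D' * D]mulrC.
Qed.

End Expansions.

Section WeightGroup.
Variables (K : numFieldType) (d : K).
Implicit Types (P Q Xi : {poly K}) (l lam : nat -> K) (a c : K).

Definition neg_poly P := P \Po (- 'X).
(* No sign normalization as in Xi^-: the signs cancel in the quotient. *)
Definition sq_poly P := P * neg_poly P.
Definition form_num Xi := sq_poly (shift_poly (d / 2) Xi).
Definition form_den Xi := sq_poly (shift_poly (- (d / 2)) Xi).

Definition weight_form l : Prop :=
  exists2 Xi, Xi != 0 &
    expands_to (form_num Xi) (form_den Xi) (even_series l).

Lemma neg_polyM P Q : neg_poly (P * Q) = neg_poly P * neg_poly Q.
Proof. exact: comp_polyM. Qed.

Lemma neg_polyD P Q : neg_poly (P + Q) = neg_poly P + neg_poly Q.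
Proof. exact: comp_polyD. Qed.

Lemma comp_polyNX Q : (- 'X) \Po Q = - Q :> {poly K}.
Proof. by rewrite -scaleN1r comp_polyZ comp_polyX scaleN1r. Qed.

Lemma neg_polyK : involutive neg_poly.
Proof.
by move=> P; rewrite /neg_poly -comp_polyA comp_polyNX opprK comp_polyXr.
Qed.

Lemma size_neg_poly P : size (neg_poly P) = size P.
Proof. by rewrite /neg_poly size_comp_poly2 // size_polyN size_polyX. Qed.

Lemma neg_poly_eq0 P : (neg_poly P == 0) = (P == 0).
Proof. by rewrite -!size_poly_eq0 size_neg_poly. Qed.

Lemma neg_polyXn n : neg_poly 'X^n = (-1) ^+ n *: 'X^n.
Proof. by rewrite /neg_poly comp_Xn_poly -scaleN1r exprZn. Qed.

Lemma sq_polyM P Q : sq_poly (P * Q) = sq_poly P * sq_poly Q.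
Proof. by rewrite /sq_poly neg_polyM mulrACA. Qed.

Lemma sq_poly_eq0 P : (sq_poly P == 0) = (P == 0).
Proof. by rewrite mulf_eq0 neg_poly_eq0 orbb. Qed.

Lemma form_numM P Q : form_num (P * Q) = form_num P * form_num Q.
Proof. by rewrite /form_num shift_polyM sq_polyM. Qed.

Lemma form_denM P Q : form_den (P * Q) = form_den P * form_den Q.
Proof. by rewrite /form_den shift_polyM sq_polyM. Qed.

Lemma form_den_eq0 P : (form_den P == 0) = (P == 0).
Proof. by rewrite sq_poly_eq0 shift_poly_eq0. Qed.

Lemma shift_neg_poly a P :
  shift_poly a (neg_poly P) = neg_poly (shift_poly (- a) P).
Proof.
rewrite /shift_poly /neg_poly -!comp_polyA; congr (_ \Po _).
by rewrite comp_polyNX comp_polyD comp_polyX comp_polyC polyCN opprD.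
Qed.

(** The leading coefficient and the sign in [poly_minus] contribute the same constant to numerator
    and denominator. *)
Lemma weight_form_monic l : weight_form l -> exists Xi : {poly K},
  Xi \is monic /\
  expands_to (shift_poly (d / 2) Xi * shift_poly (- (d / 2)) (poly_minus Xi))
    (shift_poly (- (d / 2)) Xi * shift_poly (d / 2) (poly_minus Xi))
    (even_series l).
Proof.
move=> [Xi Xi0 E]; exists ((lead_coef Xi)^-1 *: Xi).
have lc0 : lead_coef Xi != 0 by rewrite lead_coef_eq0.
split; first by rewrite monicE lead_coefZ mulVf.
apply: expands_to_cross E; first by rewrite form_den_eq0.
set k := (lead_coef Xi)^-1.
have sZ a b P : shift_poly a (b *: P) = b *: shift_poly a P.
  by rewrite /shift_poly comp_polyZ.
rewrite /poly_minus -/(neg_poly _) !sZ !shift_neg_poly !sZ opprK.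
have nZ b P : neg_poly (b *: P) = b *: neg_poly P by rewrite /neg_poly comp_polyZ.
rewrite !nZ /form_num /form_den /sq_poly.
set s := (-1) ^+ _; rewrite -!mul_polyC; ring.
Qed.

Lemma shift_sq_XsubC a y : sq_poly (shift_poly a ('X - y%:P)) =
  - ('X^2 - ((a - y) ^+ 2)%:P).
Proof.
rewrite /sq_poly /shift_poly /neg_poly comp_polyB comp_polyX comp_polyC.
rewrite comp_polyB comp_polyD comp_polyX !comp_polyC.
by rewrite polyC_exp polyCB; ring.
Qed.

(** The linear polynomial X - y contributes (u^2 - (y - d/2)^2) / (u^2 - (y + d/2)^2). For y = a +
    nd/2 this prolongs the string of length n centred at a - d/2, and the inner factors cancel. *)
Lemma shift_factor n a : exists2 Xi, Xi != 0 &
  form_num Xi * ('X^2 - ((a + n%:R * d / 2) ^+ 2)%:P) =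
  form_den Xi * ('X^2 - ((a - n%:R * d / 2) ^+ 2)%:P).
Proof.
elim: n a => [|n IHn] a.
  by exists 1; rewrite ?oner_eq0 // !mul0r addr0 subr0 /form_num /form_den
     /sq_poly /neg_poly /shift_poly !comp_polyC.
have [Xi Xi0 E] := IHn (a - d / 2).
pose y := a + n%:R * d / 2.
have nE : form_num ('X - y%:P) = - ('X^2 - ((a - d / 2 + n%:R * d / 2) ^+ 2)%:P).
  by rewrite /form_num shift_sq_XsubC /y; congr (- ('X^2 - _%:P)); field.
have dE : form_den ('X - y%:P) = - ('X^2 - ((a + n.+1%:R * d / 2) ^+ 2)%:P).
  rewrite /form_den shift_sq_XsubC /y -natr1.
  by congr (- ('X^2 - _%:P)); field.
exists (Xi * ('X - y%:P)); first by rewrite mulf_neq0 // polyXsubC_eq0.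
rewrite form_numM form_denM nE dE.
have -> : a - n.+1%:R * d / 2 = a - d / 2 - n%:R * d / 2 by rewrite -natr1; ring.
rewrite mulrN mulNr E; ring.
Qed.

Lemma shift_factor_int (n : int) a : exists2 Xi, Xi != 0 &
  form_num Xi * ('X^2 - ((a + n%:~R * d / 2) ^+ 2)%:P) =
  form_den Xi * ('X^2 - ((a - n%:~R * d / 2) ^+ 2)%:P).
Proof.
case: n => n; first exact: shift_factor.
(* Negating both a and n changes a + c and a - c only in sign, and only their squares occur. *)
have [Xi Xi0 E] := shift_factor n.+1 (- a); exists Xi => //.
rewrite NegzE rmorphN /= !mulNr opprK.
set c := _ / 2 in E *.
have -> : (a + c) ^+ 2 = (- a - c) ^+ 2 by ring.
by have -> : (a - c) ^+ 2 = (- a + c) ^+ 2 by ring.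
Qed.

(** With c = nd/2 the two equations are the coefficients of l(u) (u^2 - (a+c)^2) = lam(u) (u^2 -
    (a-c)^2). *)
Lemma weight_form_shift (n : int) a l lam :
  l 0%N = lam 0%N + 4 * (n%:~R * d / 2) * a ->
  (forall k, l k.+1 = lam k.+1 + l k * (a + n%:~R * d / 2) ^+ 2
                      - lam k * (a - n%:~R * d / 2) ^+ 2) ->
  weight_form lam -> weight_form l.
Proof.
set c := _ * d / 2 => l0 lS [Xi Xi0 /expands_toP E].
have [Xi' Xi'0 F] := shift_factor_int n a; rewrite -/c in F.
pose D1 : {poly K} := 'X^2 - ((a + c) ^+ 2)%:P.
pose N1 : {poly K} := 'X^2 - ((a - c) ^+ 2)%:P.
exists (Xi * Xi'); first by rewrite mulf_neq0.
have D10 : D1 != 0 by rewrite -size_poly_gt0 size_XnsubC.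
apply: (@expands_to_cross _ (N1 * form_num Xi) (D1 * form_den Xi)).
- by rewrite mulf_neq0 // form_den_eq0.
- rewrite form_numM form_denM.
  transitivity ((form_num Xi * form_den Xi) * (form_den Xi' * N1)); first by ring.
  by rewrite -F -/D1; ring.
apply/expands_toP.
have B : bounded_size (fun M => D1 * trunc_series (even_series l) M
    - N1 * trunc_series (even_series lam) M).
  have key m : even_series l m - even_series lam m =
      if (m < 2)%N then 0 else (a + c) ^+ 2 * even_series l (m - 2)
        - (a - c) ^+ 2 * even_series lam (m - 2).
    case: m => [|[|m]]; rewrite ?subrr // -addn2 addnK /even_series /= addn2 /=.
    rewrite negbK; case: m => [|m] /=; first by rewrite l0; ring.
    case: ifP => om; first by rewrite !mulr0 !subrr.
    case: m om => // m _ /=.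
    by rewrite lS; ring.
  exists 2 => M; apply/leq_sizeP => -[|[|t]] // _.
  rewrite /D1 /N1 !mulrBl !coefB !coefXnM !coefCM !coef_poly /= subn2 /=.
  case: (ltnP t M.+1) => tM.
    have [m ->] : exists m, M = (t + m)%N by exists (M - t)%N; lia.
    have := key m; rewrite addKn; case: (ltnP m 2) => m2.
      have -> : (t.+2 < (t + m).+1)%N = false by lia.
      by move=> /eqP; rewrite subr_eq0 => /eqP ->; ring.
    have -> : (t.+2 < (t + m).+1)%N by lia.
    have -> : (t + m - t.+2 = m - 2)%N by lia.
    by move=> E1; apply: (lincomb1 (V := K^o) (k := 1) E1); rewrite scale1r; ring.
  have -> : (t.+2 < M.+1)%N = false by lia.
  by rewrite !mulr0 !subrr.
have := bounded_sizeD (bounded_sizeM (form_den Xi) B) (bounded_sizeM N1 E).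
by apply: eq_bounded_size => M; ring.
Qed.

End WeightGroup.

(** * The weight gamma(u) gamma(-u) of a highest weight vector *)

Section BaseWeight.
Variables (K : numFieldType) (d : K) (chi : {poly K}) (gamma : nat -> K).
Hypothesis chi_monic : chi \is monic.
Hypothesis grec : forall r, \sum_(k < size chi) chi`_k * gamma (r + k)%N = 0.
Local Notation N := (weight_num chi gamma).

Definition weight_series (m : nat) : K := if m is m'.+1 then gamma m' else 1.

Lemma weight_num_expands : expands_to N chi weight_series.
Proof.
case=> k; last first.
  rewrite -[RHS](grec k); apply: congr_big => //= j _.
  by rewrite addnS addnC.
rewrite /weight_num coefD coef_sum.
under [X in _ = _ + X]eq_bigr => r _ do rewrite coefZ coef_drop_poly.
have [ck|ck] := ltnP k (size chi); last first.
  rewrite big1 => [|[j jk] /=]; last first.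
    by rewrite lez_nat leqNgt (leq_trans jk ck).
  rewrite nth_default // add0r big1 // => r _.
  by rewrite nth_default ?mulr0 // (leq_trans ck) // leq_addr.
have [s sE] : exists s, size chi = (k + s.+1)%N.
  by exists (size chi - k.+1)%N; rewrite -addSnnS subnKC.
rewrite sE big_split_ord /= big_pred0 => [|[j jk] /=]; last first.
  by rewrite lez_nat; lia.
rewrite add0r (eq_bigl predT) => [|[j jk] /=]; last first.
  by rewrite lez_nat; lia.
rewrite big_ord_recl /= addn0 subrr mulr1; congr (_ + _).
rewrite addnS -addSn addnC big_split_ord /= [X in _ = _ + X]big1 ?addr0 => [|j _].
  apply: eq_bigr => j _; rewrite /bump /= add1n mulrC addnS.
  by rewrite [absz _](_ : _ = j.+1) ?[(j + k)%N]addnC //; lia.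
by rewrite [chi`__]nth_default ?mulr0 // sE; lia.
Qed.

Lemma even_series_sq lam n :
  (forall r, lam r = 2 * gamma (r + r).+1
    - \sum_(k < (r + r).+1) (-1) ^+ k * (gamma k * gamma (r + r - k)%N)) ->
  even_series lam n =
  \sum_(m < n.+1) (-1) ^+ m * (weight_series m * weight_series (n - m)%N).
Proof.
move=> lamE; set g := weight_series.
have [on|en] := boolP (odd n).
  have -> : even_series lam n = 0 by rewrite /even_series on; case: n on.
  set s := \sum_(_ < _) _; suff : s = - s.
    move/eqP; rewrite -subr_eq0 opprK -mulr2n -mulr_natr mulf_eq0 pnatr_eq0.
    by rewrite orbF => /eqP.
  rewrite {1}/s (reindex_inj rev_ord_inj) /= -sumrN; apply: eq_bigr => -[m mn] _ /=.
  rewrite subSS subKn // [g _ * g m]mulrC -mulNr; congr (_ * _).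
  by rewrite -signr_odd oddB // on addTb signrN signr_odd.
have [r nr] : exists r, n = (r + r)%N.
  by exists n./2; rewrite addnn -[LHS]odd_double_half (negPf en).
case: r nr => [|r] ->.
  by rewrite big_ord1 /= /even_series /= !mul1r.
have -> : even_series lam (r.+1 + r.+1) = lam r.
  by rewrite /even_series addnn odd_double /= doubleK.
rewrite lamE addSn addnS [RHS]big_ord_recl [X in _ = _ + X]big_ord_recr /=.
rewrite /bump /= !add1n subnn expr0 !mul1r mulr1.
have -> : (-1) ^+ (r + r).+2 = 1 :> K.
  by rewrite !exprS addnn -signr_odd odd_double expr0 !mulN1r opprK.
have -> : \sum_(i < (r + r).+1) (-1) ^+ (1 + i) *
      (gamma (0 + i) * g ((r + r).+2 - (1 + i))%N) =
    - \sum_(k < (r + r).+1) (-1) ^+ k * (gamma k * gamma (r + r - k)%N).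
  rewrite -sumrN; apply: eq_bigr => -[k kr] _ /=.
  rewrite add1n exprS mulN1r mulNr subSS.
  by have -> : ((r + r).+1 - k = (r + r - k).+1)%N by lia.
rewrite mul1r add0n /g /=; ring.
Qed.

(** Terms lost by truncating gamma(u) and gamma(-u) affect only degrees below M in the product; the
    sign is that of X^M under reflection. *)
Lemma sq_trunc_series lam M :
  (forall r, lam r = 2 * gamma (r + r).+1
    - \sum_(k < (r + r).+1) (-1) ^+ k * (gamma k * gamma (r + r - k)%N)) ->
  (size (sq_poly (trunc_series weight_series M)
    - (-1) ^+ M *: ('X^M * trunc_series (even_series lam) M))%R <= M)%N.
Proof.
move=> lamE; apply/leq_sizeP => t Mt.
rewrite coefB coefZ coefXnM ltnNge Mt /= coef_poly.
set g := weight_series.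
have negE : neg_poly (trunc_series g M) =
    \poly_(i < M.+1) ((-1) ^+ i * g (M - i)%N).
  rewrite /neg_poly /trunc_series poly_def [RHS]poly_def.
  rewrite (raddf_sum (comp_poly (- 'X))) /=; apply: eq_bigr => i _.
  rewrite comp_polyZ -/(neg_poly _) neg_polyXn scalerA mulrC //.
rewrite /sq_poly negE coefM.
case: (ltnP (t - M) M.+1) => tM; last first.
  rewrite mulr0 subr0 big1 // => -[j jt] _ /=; rewrite !coef_poly.
  case: ifP => j1; last by rewrite mul0r.
  by case: ifP => j2; [lia | rewrite mulr0].
have [a [n [ME tE]]] : exists a n, M = (a + n)%N /\ t = (a + (n.+1 + a)).-1.
  by exists (t - M)%N, (M + M - t)%N; lia.
have -> : (M - (t - M) = n)%N by lia.
rewrite even_series_sq // -/g.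
have -> : t.+1 = (a + (n.+1 + a))%N by lia.
rewrite big_split_ord /= big1 ?add0r => [|[j ja] _ /=]; last first.
  rewrite !coef_poly; have -> : (t - j < M.+1)%N = false by lia.
  by rewrite mulr0.
rewrite big_split_ord /= [X in _ + X - _]big1 ?addr0 => [|[j ja] _ /=]; last first.
  rewrite !coef_poly; have -> : (a + (n.+1 + j) < M.+1)%N = false by lia.
  by rewrite mul0r.
apply/eqP; rewrite subr_eq0 mulr_sumr; apply/eqP.
apply: eq_bigr => -[j jn] _ /=.
rewrite !coef_poly !ifT; [|lia|lia].
have -> : (M - (a + j) = n - j)%N by lia.
have -> : (M - (t - (a + j)) = j)%N by lia.
have -> : (-1) ^+ (t - (a + j)) = (-1) ^+ M * (-1) ^+ j :> K.
  have -> : M = (t - (a + j) + j)%N by lia.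
  by rewrite exprD -mulrA -expr2 sqrr_sign mulr1.
ring.
Qed.

Lemma weight_form_base lam (F : {poly K}) k :
  (forall r, lam r = 2 * gamma (r + r).+1
    - \sum_(k < (r + r).+1) (-1) ^+ k * (gamma k * gamma (r + r - k)%N)) ->
  F != 0 -> N * shift_poly d F = F * shift_poly (d *+ k) chi ->
  weight_form d lam.
Proof.
move=> lamE F0 NF.
pose G M := trunc_series weight_series M.
pose L M := trunc_series (even_series lam) M.
have chi0 : chi != 0 by rewrite monic_neq0.
have E1 : expands_to (sq_poly N) (sq_poly chi) (even_series lam).
  apply/expands_toP.
  have /expands_toP[C EC] := weight_num_expands.
  pose E M := chi * G M - N * 'X^M.
  have sq0 M : (size (sq_poly (G M) - (-1) ^+ M *: ('X^M * L M))%R <= M)%N.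
    exact: sq_trunc_series.
  pose C' := (size chi + size chi + size N + C + C).+1%N.
  exists C' => M.
  have key : 'X^M * ((-1) ^+ M *: (sq_poly chi * L M - sq_poly N * 'X^M)) =
    - (sq_poly chi * (sq_poly (G M) - (-1) ^+ M *: ('X^M * L M)))
    + (N * 'X^M) * neg_poly (E M) + E M * neg_poly (N * 'X^M)
    + E M * neg_poly (E M).
    have : sq_poly (chi * G M) = sq_poly (N * 'X^M + E M).
      by rewrite /E addrC subrK.
    rewrite sq_polyM; move: (E M) (weight_num _ _) => e n H1.
    rewrite mulrBr H1 /sq_poly !neg_polyD !neg_polyM neg_polyXn -!mul_polyC.
    ring.
  have szM (p q : {poly K}) a b : (size p <= a)%N -> (size q <= b)%N ->
      (size (p * q)%R <= a + b)%N.
    move=> pa qb; apply: leq_trans (size_polyMleq _ _) _.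
    by apply: leq_trans (leq_pred _) _; apply: leq_add.
  have szD (p q : {poly K}) a : (size p <= a)%N -> (size q <= a)%N ->
      (size (p + q)%R <= a)%N.
    by move=> pa qa; apply: leq_trans (size_polyD _ _) _; rewrite geq_max pa.
  have sE : (size (E M) <= C)%N by exact: EC.
  have snE : (size (neg_poly (E M))%R <= C)%N by rewrite size_neg_poly.
  have sN : (size (N * 'X^M)%R <= size N + M.+1)%N by rewrite szM ?size_polyXn.
  have snN : (size (neg_poly (N * 'X^M))%R <= size N + M.+1)%N.
    by rewrite size_neg_poly.
  have schi : (size (sq_poly chi)%R <= size chi + size chi)%N.
    by rewrite szM ?size_neg_poly.
  have := szM _ _ _ _ schi (sq0 M); rewrite -size_polyN => s1.
  have s2 := szM _ _ _ _ sN snE; have s3 := szM _ _ _ _ sE snN.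
  have s4 := szM _ _ _ _ sE snE.
  set Q := _ - _ in key *; have [->|Q0] := eqVneq Q 0; first by rewrite size_poly0.
  have := congr1 (fun p : {poly K} => size p) key.
  rewrite size_mul ?expf_neq0 ?polyX_eq0 ?scaler_eq0 ?signr_eq0 //.
  rewrite size_polyXn size_scale ?signr_eq0 //= => key2.
  suff : (M + size Q <= M + C')%N by rewrite leq_add2l.
  rewrite key2.
  apply: (@szD _ _ _); first apply: (@szD _ _ _); first apply: (@szD _ _ _).
  - by apply: leq_trans s1 _; rewrite /C'; lia.
  - by apply: leq_trans s2 _; rewrite /C'; lia.
  - by apply: leq_trans s3 _; rewrite /C'; lia.
  - by apply: leq_trans s4 _; rewrite /C'; lia.
pose B := chi_string d chi k.
(* Here gamma(u) = p(u+d)/p(u) with p = B/F, and Xi should be p(u + d/2). The numerator gives [Xi1];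
   for the denominator F is reflected as well, since reflection exchanges [form_num] and [form_den]
   and so inverts the weight. *)
pose Xi1 := \prod_(j < k) shift_poly (d / 2 + d *+ j) chi.
pose Xi2 := neg_poly (shift_poly (d / 2) F).
have shiftD a b (p : {poly K}) : shift_poly a (shift_poly b p) = shift_poly (a + b) p.
  rewrite /shift_poly -comp_polyA comp_polyD comp_polyX comp_polyC.
  by rewrite -addrA -polyCD.
have shift0 (p : {poly K}) : shift_poly 0 p = p.
  by rewrite /shift_poly polyC0 addr0 comp_polyXr.
have Xi1m : shift_poly (- (d / 2)) Xi1 = B.
  rewrite /Xi1 /shift_poly (big_morph (fun p => p \Po ('X + (- (d / 2))%:P))
    (fun p q => comp_polyM p q _) (comp_polyC _ _)).
  apply: eq_bigr => j _; rewrite -!/(shift_poly _ _) shiftD.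
  by rewrite addKr.
have Xi1p : shift_poly (d / 2) Xi1 = shift_poly d B.
  by rewrite -Xi1m shiftD; congr shift_poly; field.
exists (Xi1 * Xi2).
  rewrite mulf_neq0 //; first by apply/prodf_neq0 => j _; rewrite shift_poly_eq0.
  by rewrite neg_poly_eq0 shift_poly_eq0.
apply: expands_to_cross E1; first by rewrite sq_poly_eq0.
rewrite form_numM form_denM /form_num /form_den Xi1p Xi1m /Xi2 !shift_neg_poly.
rewrite opprK !shiftD addNr shift0 -splitr.
rewrite [sq_poly (neg_poly F)](_ : _ = sq_poly F); last first.
  by rewrite /sq_poly neg_polyK mulrC.
rewrite [sq_poly (neg_poly (shift_poly d F))](_ : _ = sq_poly (shift_poly d F)); last first.
  by rewrite /sq_poly neg_polyK mulrC.
rewrite -!sq_polyM; congr sq_poly.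
have Bl := chi_string_recl d chi k.
have Br : chi_string d chi k.+1 = B * shift_poly (d *+ k) chi.
  by rewrite /chi_string big_ord_recr.
transitivity (N * shift_poly d F * B); first by ring.
rewrite NF; transitivity (F * chi_string d chi k.+1); first by rewrite Br; ring.
by rewrite Bl -/B; ring.
Qed.

End BaseWeight.

(** * Linear algebra *)

Section Subspaces.
Import VectorInternalTheory.
Variables (K : fieldType) (V : vectType K).
Implicit Types (U N : {vspace V}) (P : V -> Prop).

Lemma max_subspace (Q : {vspace V} -> Prop) U0 : Q U0 ->
  exists2 U, Q U & forall U', Q U' -> (\dim U' <= \dim U)%N.
Proof.
have [n] := ubnP (\dim {:V} - \dim U0)%N.
elim: n U0 => // n IHn U0 Un QU0.
have [[U1 [QU1 dU]]|noU] := pselect (exists U1, Q U1 /\ (\dim U0 < \dim U1)%N).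
  apply: IHn QU1; have := dimvS (subvf U1); lia.
exists U0 => // U' QU'; rewrite leqNgt; apply/negP => dU.
by apply: noU; exists U'.
Qed.

Definition linear_pred P : Prop :=
  P 0 /\ forall (a : K) u v, P u -> P v -> P (a *: u + v).

Lemma linear_pred_subspace P : linear_pred P ->
  exists U : {vspace V}, forall v, v \in U <-> P v.
Proof.
move=> [P0 Plin].
have [U UP Umax] := @max_subspace (fun U => forall v, v \in U -> P v) 0%VS
  (fun v v0 => eq_ind_r P P0 (eqP (etrans (esym (memv0 v)) v0))).
exists U => v; split=> [/UP //|Pv].
have : (\dim (U + <[v]>) <= \dim U)%N.
  apply: Umax => _ /memv_addP[u uU [_ /vlineP[k ->] ->]].
  by rewrite addrC; apply: Plin => //; apply: UP.
move=> dU; have /eqP -> : U == (U + <[v]>)%VS by rewrite eqEdim addvSl.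
by rewrite (subvP (addvSr U <[v]>)) // memv_line.
Qed.

Lemma linear_relation (x : nat -> V) :
  exists2 p : {poly K}, p \is monic & \sum_(k < size p) p`_k *: x k = 0.
Proof.
pose n := \dim {:V}.
pose A : 'M[K]_(n.+1, dim V) := \matrix_(i, j) v2r (x i) 0 j.
have : kermx A != 0.
  rewrite kermx_eq0 /row_free neq_ltn ltnS.
  by rewrite (leq_trans (rank_leq_col A)) // /n dimvf.
case/rowV0Pn => u /sub_kermxP uA u0.
pose p := \poly_(i < n.+1) u 0 (inord i).
have p0 : p != 0.
  apply: contraNneq u0 => p0; apply/eqP/rowP => j; rewrite mxE.
  by have /(congr1 (fun q : {poly K} => q`_j)) := p0; rewrite coef_poly ltn_ord inord_val coef0.
have sum0 : \sum_(i < n.+1) p`_i *: x i = 0.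
  apply: (can_inj v2rK); rewrite linear0 linear_sum /=; apply/rowP => j.
  rewrite summxE; have /rowP/(_ j) := uA; rewrite !mxE => uAj; rewrite -[RHS]uAj.
  apply: eq_bigr => i _; rewrite linearZ /= !mxE coef_poly ltn_ord inord_val.
  by [].
have sump : \sum_(i < size p) p`_i *: x i = 0.
  rewrite -[RHS]sum0 (big_ord_widen n.+1 (fun i => p`_i *: x i)) ?size_poly //.
  rewrite big_mkcond; apply: eq_bigr => i _; case: ltnP => // pi.
  by rewrite nth_default // scale0r.
exists ((lead_coef p)^-1 *: p).
  by rewrite monicE lead_coefZ mulVf // lead_coef_eq0.
rewrite size_scale ?invr_eq0 ?lead_coef_eq0 //.
rewrite -[RHS](scaler0 _ (lead_coef p)^-1) -[in RHS]sump scaler_sumr.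
by apply: eq_bigr => i _; rewrite coefZ scalerA.
Qed.

End Subspaces.

(** * Eigenvectors modulo a subspace and common eigenvectors *)

Section Eigenvectors.
Variables (K : closedFieldType) (V : vectType K).
Implicit Types (U N : {vspace V}).

Definition poly_orbit (f : V -> V) (v : V) (p : {poly K}) : V :=
  \sum_(k < size p) p`_k *: iter k f v.

Lemma poly_orbit_widen f v (p : {poly K}) n : (size p <= n)%N ->
  poly_orbit f v p = \sum_(k < n) p`_k *: iter k f v.
Proof.
move=> pn; rewrite /poly_orbit (big_ord_widen n (fun i => p`_i *: iter i f v)) //.
rewrite big_mkcond; apply: eq_bigr => i _; case: ltnP => // pi.
by rewrite nth_default // scale0r.
Qed.

(** Split a linear factor off a polynomial p of least degree with p(f) v in N. The eigenvector is
    delivered as q(f) v so that the same q can be applied along a sequence that f shifts. *)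
Lemma eigenvector_mod (f : {linear V -> V}) N v :
  (forall u, u \in N -> f u \in N) -> v \notin N ->
  exists a (q : {poly K}),
    poly_orbit f v q \notin N /\
    f (poly_orbit f v q) - a *: poly_orbit f v q \in N.
Proof.
move=> fN vN.
pose good n := exists p : {poly K}, [/\ size p = n, p != 0 & poly_orbit f v p \in N].
have ex : exists n, `[< good n >].
  have [p pm pv] := linear_relation (fun k => iter k f v).
  exists (size p); apply/asboolP; exists p; split; rewrite ?monic_neq0 //.
  by rewrite /poly_orbit pv mem0v.
case: (ex_minnP ex) => n /asboolP[p [pn p0 pN]] nmin.
have p1 : size p != 1%N.
  apply: contra vN => /size_poly1P[c c0 pE]; move: pN.
  rewrite pE /poly_orbit size_polyC c0 big_ord1 coefC /= => /(memvZ c^-1).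
  by rewrite scalerA mulVf // scale1r.
have [a /factor_theorem[q pE]] := closed_rootP _ p1.
have q0 : q != 0 by apply: contraNneq p0 => q0; rewrite pE q0 mul0r.
have sp : size p = (size q).+1 by rewrite pE size_Mmonic ?monicXsubC // size_XsubC addn2.
exists a, q; split.
  apply/negP => qN; have := nmin (size q); rewrite -pn sp ltnn => /(_ _)/negP.
  by apply=> //; apply/asboolP; exists q.
rewrite [X in X \in N](_ : _ = poly_orbit f v p) //.
have -> : f (poly_orbit f v q) = \sum_(k < size q) q`_k *: iter k.+1 f v.
  by rewrite linear_sum; apply: eq_bigr => k _; rewrite linearZ.
have -> : a *: poly_orbit f v q =
    \sum_(k < (size q).+1) (a * q`_k) *: iter k f v.
  rewrite (@poly_orbit_widen f v q (size q).+1) // scaler_sumr.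
  by apply: eq_bigr => k _; rewrite scalerA.
rewrite (@poly_orbit_widen f v p (size q).+1) ?sp // !big_ord_recl.
have cE k : p`_k = (if k is k'.+1 then q`_k' else 0) - a * q`_k.
  by rewrite pE mulrBr coefB coefMX coefMC mulrC; case: k.
rewrite cE sub0r scaleNr opprD addrCA; congr (_ + _).
rewrite -sumrB; apply: eq_bigr => i _.
by rewrite cE scalerBl.
Qed.

Lemma eigenvector (f : {linear V -> V}) U :
  (forall u, u \in U -> f u \in U) -> U != 0%VS ->
  exists a v, [/\ v \in U, v != 0 & f v = a *: v].
Proof.
move=> fU U0; have v0 : vpick U \notin (0 : {vspace V})%VS by rewrite memv0 vpick0.
have f0 u : u \in (0 : {vspace V})%VS -> f u \in (0 : {vspace V})%VS.
  by rewrite !memv0 => /eqP ->; rewrite linear0.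
have [a [q []]] := eigenvector_mod f0 v0.
set y := poly_orbit _ _ _; rewrite !memv0 subr_eq0 => y0 /eqP fy.
exists a, y; split=> //; apply: memv_suml => k _; apply: memvZ.
by elim: {k}(k : nat) => [|k IHk]; [exact: memv_pick | exact: fU].
Qed.

(** In a stable nonzero subspace of least dimension an eigenspace of any [f j] is again stable,
    hence is the whole subspace. *)
Lemma common_eigenvector (J : Type) (f : J -> {linear V -> V}) U :
  (forall i j v, f i (f j v) = f j (f i v)) ->
  (forall j u, u \in U -> f j u \in U) -> U != 0%VS ->
  exists2 v, v \in U & v != 0 /\ forall j, exists a, f j v = a *: v.
Proof.
move=> fC fU U0.
pose stable n := exists U' : {vspace V}, [/\ \dim U' = n, U' != 0%VS,
  (U' <= U)%VS & forall j u, u \in U' -> f j u \in U'].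
have ex : exists n, `[< stable n >] by exists (\dim U); apply/asboolP; exists U.
case: (ex_minnP ex) => n /asboolP[U' [dU U'0 U'U fU']] nmin.
exists (vpick U'); first by rewrite (subvP U'U) // memv_pick.
split; first by rewrite vpick0.
move=> j; have [a [v [vU v0 fv]]] := eigenvector (fU' j) U'0.
exists a; pose E := (U' :&: lker (linfun (f j) - a *: \1%VF)%R)%VS.
have mE u : (u \in E) = (u \in U') && (f j u == a *: u).
  rewrite memv_cap memv_ker add_lfunE opp_lfunE scale_lfunE id_lfunE lfunE.
  by rewrite subr_eq0.
have vE : v \in E by rewrite mE vU fv eqxx.
have E0 : E != 0%VS by apply: contraNneq v0 => E0; rewrite -memv0 -E0.
have dE : (\dim U' <= \dim E)%N.
  rewrite dU; apply: nmin; apply/asboolP; exists E; split=> //.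
    by apply: subv_trans U'U; apply: capvSl.
  move=> i u; rewrite !mE => /andP[uU /eqP fu].
  by rewrite fU' //= fC fu linearZ.
have /eqP EU : E == U' by rewrite eqEdim dE capvSl.
by have := memv_pick U'; rewrite -EU mE EU => /andP[_ /eqP].
Qed.

End Eigenvectors.

(** * Cartan data *)

Lemma linfun_appE (K : fieldType) (U V : vectType K) (f : U -> V) :
  linear f -> linfun f =1 f.
Proof.
move=> fl; pose F : {linear U -> V} :=
  HB.pack f (GRing.isLinear.Build K U V *:%R f fl).
exact: (lfunE F).
Qed.

Section VectorTrace.
Import VectorInternalTheory.

(** A commutator has trace 0, while the scalar a has trace a times the dimension. *)
Lemma comm_scalar_eq0 (K : numFieldType) (V : vectType K) (A B : 'End(V)) a :
  (forall u, A (B u) - B (A u) = a *: u) -> (0 < \dim {:V})%N -> a = 0.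
Proof.
move=> AB; rewrite dimvf => V0.
have mE (f : 'End(V)) u : v2r (f u) = v2r u *m f2mx f.
  by rewrite unlock /= r2vK.
have E : f2mx B *m f2mx A - f2mx A *m f2mx B = a%:M.
  apply/row_matrixP => i; rewrite !rowE -[delta_mx _ _]r2vK.
  by rewrite mulmxBr !mulmxA -!mE -linearB AB linearZ /= mul_mx_scalar.
have := congr1 mxtrace E; rewrite linearB /= mxtrace_mulC subrr.
rewrite mxtrace_scalar => /esym/eqP.
by rewrite -mulr_natr mulf_eq0 pnatr_eq0 -leqn0 leqNgt V0 orbF => /eqP.
Qed.

End VectorTrace.

Section LieFacts.
Variables (K : numFieldType) (g : lie_algebra K) (I : finType).
Variable D : chevalley_data g I.
Local Notation h := (cd_cartan D).
Local Notation form := (cd_form D).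
Local Notation al := (cd_simple D).
Implicit Types x y z : g.

Lemma lie_opp x y : lie x y = - lie y x.
Proof.
have := lie_alt (x + y); have Dl u v w : lie (u + v) w = lie u w + lie v w.
  by have := lie_linear_l w 1 u v; rewrite !scale1r.
have Dr u v w : lie w (u + v) = lie w u + lie w v.
  by have := lie_linear_r w 1 u v; rewrite !scale1r.
by rewrite Dl !Dr !lie_alt add0r addr0 => /eqP; rewrite addr_eq0 => /eqP.
Qed.

Lemma lieZr x a y : lie x (a *: y) = a *: lie x y.
Proof.
have l0 : lie x 0 = 0.
  have := lie_linear_r x 0 0 0; rewrite !scale0r !add0r.
  by have := lie_linear_r x (-1) 0 0; rewrite scaler0 add0r scaleN1r addNr.
by have := lie_linear_r x a y 0; rewrite l0 !addr0.
Qed.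

Lemma lie_derivation x y z : lie x (lie y z) = lie (lie x y) z + lie y (lie x z).
Proof.
have /eqP := lie_jacobi x y z; rewrite -addrA addr_eq0 => /eqP ->.
have lieN (u v : g) : lie u (- v) = - lie u v by have := lieZr u (-1) v; rewrite !scaleN1r.
rewrite [lie z x]lie_opp lieN opprD opprK.
by rewrite [lie z _]lie_opp opprK addrC.
Qed.

Lemma lieZl x a y : lie (a *: x) y = a *: lie x y.
Proof. by rewrite lie_opp lieZr [in RHS]lie_opp scalerN. Qed.

Lemma formP : [/\ forall y, scalar (form^~ y), forall x y, form x y = form y x,
  forall x, (forall y, form x y = 0) -> x = 0
  & forall x y z, form (lie x y) z = form x (lie y z)].
Proof. exact: (cd_formP D). Qed.

Lemma formZr x a y : form x (a *: y) = a * form x y.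
Proof.
have [lin sym _ _] := formP; have l0 : form 0 x = 0.
  have := lin x (-1) 0 0; rewrite scaler0 add0r /= mulN1r => E.
  by rewrite E addNr.
have := lin x a y 0; rewrite addr0 l0 addr0 /= => E.
by rewrite sym E sym.
Qed.

Lemma riesz_appE (a b : subvs_of h) : riesz form h a b = form (vsval a) (vsval b).
Proof.
have [lin sym _ _] := formP.
have linr y : linear (fun b : subvs_of h => form y (vsval b) : K^o).
  by move=> k u v; rewrite linearP /= sym lin !(sym _ y).
rewrite linfun_appE; first by rewrite linfun_appE.
move=> k u v; apply/lfunP => z.
by rewrite add_lfunE scale_lfunE !linfun_appE // linearP /= lin.
Qed.

Lemma simple_pos i : al i \in cd_pos D.
Proof.
apply/cd_posP; have [_ ri _] := cd_simpleP D; split; first exact: ri.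
exists (fun j => (j == i) : nat); rewrite (bigD1 i) //= eqxx mulr1n big1 ?addr0 //.
by move=> j /negPf ->.
Qed.

Lemma root_action alpha y : alpha \in cd_pos D -> y \in h ->
  lie y (cd_xp alpha) = alpha (vsproj h y) *: cd_xp alpha.
Proof. by move=> /cd_xpP E yh; rewrite -E vsprojK. Qed.

Lemma root_actionN alpha y : alpha \in cd_pos D -> y \in h ->
  lie y (cd_xm alpha) = - alpha (vsproj h y) *: cd_xm alpha.
Proof. by move=> /cd_xmP E yh; rewrite -opp_lfunE -E vsprojK. Qed.

Lemma chev_xi_cartan i : chev_xi D i \in h.
Proof.
have [_ _ hmax] := cd_cartanP D; apply: hmax => y yh.
rewrite lie_opp lie_derivation (root_action (simple_pos i) yh).
rewrite (root_actionN (simple_pos i) yh) lieZr lieZl scaleNr.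
by rewrite addrN oppr0.
Qed.

Definition cartan_xi i : subvs_of h := vsproj h (chev_xi D i).

Lemma cartan_xiE i : vsval (cartan_xi i) = chev_xi D i.
Proof. by rewrite vsprojK // chev_xi_cartan. Qed.

Lemma riesz_xi i : riesz form h (cartan_xi i) = al i.
Proof.
have [_ _ _ inv] := formP.
apply/lfunP => b; rewrite riesz_appE cartan_xiE inv lie_opp.
rewrite (root_actionN (simple_pos i) (subvsP b)) vsvalK scaleNr opprK formZr.
by rewrite cd_form_x ?simple_pos // mulr1.
Qed.

Lemma span_simple : <<[seq al i | i : I]>>%VS = fullv.
Proof. by have [/span_basis] := cd_simpleP D. Qed.

(** Each simple root is the image of its xi_i and the simple roots span the dual, so the map is
    onto; equal dimensions make it injective. *)
Lemma riesz_ker0 : lker (riesz form h) == 0%VS.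
Proof.
have full : limg (riesz form h) = fullv.
  apply/eqP; rewrite eqEsubv subvf -span_simple; apply/span_subvP => _ /imageP[i _ ->].
  by rewrite -riesz_xi memv_img // memvf.
have := limg_ker_dim (riesz form h) fullv; rewrite full capfv.
rewrite !dimvf /dim /= muln1 -[X in _ = X]add0n => /eqP.
by rewrite eqn_add2r dimv_eq0.
Qed.

Lemma dual_vanish (a : subvs_of h) : (forall j, al j a = 0) -> a = 0.
Proof.
move=> al0; have [_ sym _ _] := formP.
suff f0 (f : cartan_dual h) : f a = 0.
  apply/eqP; rewrite -memv0 -(eqP riesz_ker0) memv_ker; apply/eqP/lfunP => b.
  by rewrite zero_lfunE riesz_appE sym -riesz_appE f0.
pose ev (f : cartan_dual h) : K^o := f a.
have evl : linear ev by move=> k u v; rewrite /ev add_lfunE scale_lfunE.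
have : (fullv <= lker (linfun ev))%VS.
  rewrite -span_simple; apply/span_subvP => _ /imageP[i _ ->].
  by rewrite memv_ker linfun_appE // /ev al0.
by move/subvP/(_ f (memvf f)); rewrite memv_ker linfun_appE // => /eqP.
Qed.

Lemma cd_spE i j : cd_sp D i j = al j (cartan_xi i).
Proof.
rewrite /cd_sp /cd_ip /dual_form -!riesz_xi !lker0_lfunK ?riesz_ker0 //.
by have [_ sym _ _] := formP; rewrite riesz_appE sym.
Qed.

Lemma chev_xp_neq0 i : chev_xp D i != 0.
Proof.
have [_ sym _ _] := formP.
have f0 y : form y 0 = 0 by rewrite -(scale0r (0 : g)) formZr mul0r.
apply/eqP => x0; have := cd_form_x (simple_pos i).
by rewrite sym -/(chev_xp D i) x0 f0 => /eqP; rewrite eq_sym oner_eq0.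
Qed.

(** If alpha_i were isotropic, xi_i would commute with x_i^+ and x_i^-, which then act on each
    eigenspace of ad xi_i with commutator the eigenvalue. By the trace the eigenvalue is 0, so the
    diagonalizable ad xi_i vanishes, all simple roots kill xi_i, and alpha_i = 0. *)
Lemma cd_d_neq0 i : cd_d D i != 0.
Proof.
apply/negP => /eqP d0; pose xi := chev_xi D i.
have a0 : al i (cartan_xi i) = 0.
  by rewrite -cd_spE; move/eqP: d0; rewrite /cd_d mulf_eq0 invr_eq0 pnatr_eq0 orbF => /eqP.
have xih : xi \in h := chev_xi_cartan i.
have xp0 : lie xi (chev_xp D i) = 0.
  by rewrite (root_action (simple_pos i) xih) a0 scale0r.
have xm0 : lie xi (chev_xm D i) = 0.
  by rewrite (root_actionN (simple_pos i) xih) a0 oppr0 scale0r.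
have lz0 z : lie z 0 = 0 by have := lieZr z 0 0; rewrite !scale0r.
have l0z z : lie 0 z = 0 by rewrite lie_opp lz0 oppr0.
have adl z : linear (fun y => lie z y) by move=> k u v; rewrite lie_linear_r.
have central z : lie xi z = 0.
  have [_ diag _] := cd_cartanP D; have [s [sb sE]] := diag _ xih.
  have : (fullv <= lker (linfun (fun y => lie xi y)))%VS.
    rewrite -(span_basis sb); apply/span_subvP => v vs.
    rewrite memv_ker linfun_appE //; have [a va] := sE v vs.
    have [->|v0] := eqVneq v 0; first by rewrite lz0.
    rewrite va; suff -> : a = 0 by rewrite scale0r.
    pose E := lker (linfun (fun y => lie xi y) - a *: \1%VF)%R.
    have mE u : (u \in E) = (lie xi u == a *: u).
      rewrite memv_ker add_lfunE opp_lfunE scale_lfunE id_lfunE linfun_appE //.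
      by rewrite subr_eq0.
    have stab y u : lie xi y = 0 -> u \in E -> lie y u \in E.
      rewrite !mE => y0 /eqP uE.
      by rewrite lie_derivation y0 l0z add0r uE lieZr.
    pose op y (u : subvs_of E) := vsproj E (lie y (vsval u)).
    have opl y : linear (op y).
      by move=> k u v'; rewrite /op linearP lie_linear_r linearP.
    apply: (@comm_scalar_eq0 K (subvs_of E) (linfun (op (chev_xp D i)))
       (linfun (op (chev_xm D i)))); last first.
      rewrite dimvf /dim /= lt0n dimv_eq0; apply: contraNneq v0 => E0.
      by rewrite -memv0 -E0 mE va.
    move=> u; rewrite !linfun_appE //; apply: val_inj => /=.
    have uE := subvsP u.
    rewrite /op !vsprojK ?stab //.
    move: uE; rewrite mE /xi => /eqP <-; rewrite /chev_xi.
    by rewrite lie_derivation addrK.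
  by move/subvP/(_ z (memvf z)); rewrite memv_ker linfun_appE // => /eqP.
have : cartan_xi i = 0.
  apply: dual_vanish => j; have := central (chev_xp D j).
  rewrite (root_action (simple_pos j) xih) => /eqP.
  by rewrite scaler_eq0 (negPf (chev_xp_neq0 j)) orbF => /eqP.
have [_ ri _] := cd_simpleP D; have [al0 _] := ri i.
by move=> E; move: al0; rewrite -riesz_xi E linear0 eqxx.
Qed.

Lemma free_simple : free [seq al i | i : I].
Proof. by have [/basis_free] := cd_simpleP D. Qed.

(** The Gram matrix of the simple roots is invertible: a kernel vector gives a Cartan element killed
    by all simple roots, hence a relation among them. The c k define the element that measures
    height. *)
Lemma coweight_exists : exists c : I -> K, forall j, \sum_k c k * cd_sp D k j = 1.
Proof.
pose S : 'M[K]_#|I| := \matrix_(k, j) cd_sp D (enum_val k) (enum_val j).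
have S_free : row_free S.
  rewrite -kermx_eq0; apply/eqP/row_matrixP => r; rewrite row0.
  set u := row r _; have uS : u *m S = 0.
    by apply/sub_kermxP; exact: row_sub.
  have a0 : \sum_k u 0 k *: cartan_xi (enum_val k) = 0.
    apply: dual_vanish => j; rewrite linear_sum /=.
    have /rowP/(_ (enum_rank j)) := uS; rewrite !mxE => uSj; rewrite -[RHS]uSj.
    by apply: eq_bigr => k _; rewrite linearZ /= [S _ _]mxE enum_rankK cd_spE.
  have := congr1 (riesz form h) a0; rewrite linear0 linear_sum /=.
  under eq_bigr => k _ do rewrite linearZ /= riesz_xi.
  move=> al0; apply/rowP => k; rewrite [RHS]mxE.
  have szI : size [seq al i | i : I] == #|I| by rewrite size_image.
  have /(@freeP _ _ _ (Tuple szI)) fr := free_simple.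
  apply: (fr (fun k => u 0 k)); rewrite -[RHS]al0; apply: eq_bigr => j _ /=.
  by rewrite (nth_image 0).
pose v := (const_mx 1 : 'rV_#|I|) *m invmx S.
have vS : v *m S = const_mx 1.
  by rewrite -mulmxA mulVmx ?mulmx1 // -row_free_unit.
exists (fun i => v 0 (enum_rank i)) => j.
have /rowP/(_ (enum_rank j)) := vS; rewrite !mxE => vSj; rewrite -[RHS]vSj.
rewrite (reindex_onto enum_val enum_rank) => [|i _]; last exact: enum_rankK.
apply: eq_big => [k|k _]; first by rewrite enum_valK eqxx.
by rewrite enum_valK [S _ _]mxE enum_rankK.
Qed.

Section Coweight.
Variable c : I -> K.
Hypothesis cE : forall j, \sum_k c k * cd_sp D k j = 1.

Definition coweight : subvs_of h := \sum_k c k *: cartan_xi k.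

Lemma simple_coweight j : al j coweight = 1.
Proof.
rewrite linear_sum /= -(cE j); apply: eq_bigr => k _.
by rewrite linearZ /= cd_spE.
Qed.

Lemma root_height alpha : alpha \in cd_pos D -> exists n : nat,
  [/\ alpha coweight = n.+1%:R & n = 0%N -> exists j, alpha = al j].
Proof.
move=> /cd_posP[[alpha0 _] [n alphaE]].
have alpha_c : alpha coweight = (\sum_i n i)%N%:R.
  rewrite alphaE sum_lfunE natr_sum; apply: eq_bigr => i _.
  rewrite -scaler_nat scale_lfunE simple_coweight.
  by rewrite /GRing.scale /= mulr1.
case N : (\sum_i n i)%N alpha_c => [|m] alpha_c.
  move: alpha0; rewrite alphaE big1 ?eqxx // => i _.
  by have /eqP := N; rewrite sum_nat_eq0 => /forallP/(_ i)/= /eqP ->.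
exists m; split=> // m0; rewrite m0 in N.
have [j nj] : exists j, n j != 0%N.
  apply/existsP; rewrite -negb_forall; apply/negP => /forallP n0.
  by have := N; rewrite big1 // => i _; apply/eqP.
exists j; rewrite alphaE (bigD1 j) //= big1 ?addr0 => [|i ij].
  have : (n j <= 1)%N by rewrite -N (bigD1 j) //= leq_addr.
  by case: (n j) nj => [|[|]].
have := N; rewrite (bigD1 j) //= (bigD1 i) //=.
by case: (n j) nj (n i) => [|k] // _ [|k'] //=; rewrite addnS.
Qed.

End Coweight.

End LieFacts.

(** * Generators and relations *)

Section PresentedInduction.
Variables (K : fieldType) (X : choiceType) (R : relators K X).

(** Every element lifts to a linear combination of words, and a word is built by left multiplication
    with generators. *)
Lemma pres_alg_ind (P : pres_alg R -> Prop) :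
  P 1 -> (forall (k : K) a b, P a -> P b -> P (k *: a + b)) ->
  (forall x a, P a -> P (pgen R x * a)) -> forall a, P a.
Proof.
move=> P1 Plin Pgen.
have P0 : P 0 by have := Plin (-1) 1 1 P1 P1; rewrite scaleN1r addNr.
elim/pres_ind => -[m].
pose Q (m : {malg K[{fmonom X}]}) := P (pres_pi R (FreeAlg m)).
suff : Q m by [].
have Q0 : Q 0.
  have E : FreeAlg (0 : {malg K[{fmonom X}]}) = 0 :> free_alg K X.
    by rewrite -[RHS]/(free_zero K X) unlock.
  by rewrite /Q E linear0.
have Qlin k m1 m2 : Q m1 -> Q m2 -> Q (k *: m1 + m2).
  rewrite /Q => Q1 Q2.
  have -> : FreeAlg (k *: m1 + m2) = k *: FreeAlg m1 + FreeAlg m2 :> free_alg K X.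
    rewrite -[RHS]/(free_add (free_scale k (FreeAlg m1)) (FreeAlg m2)).
    by rewrite !unlock.
  by rewrite linearP; apply: Plin.
rewrite (monalgE m); apply: big_rec => [//|k m' _ Qm'].
suff Qk : Q << k >>.
  have -> : << m@_k *g k >> = m@_k *: << k >> :> {malg K[{fmonom X}]}.
    by apply/malgP => k'; rewrite mcoeffZ !mcoeffU mulrnAr mulr1.
  exact: Qlin.
case: k => s; elim: s => [|x s IHs].
  have E : FreeAlg << FMonom [::] >> = 1 :> free_alg K X.
    rewrite -[RHS]/(free_one K X) unlock.
    by rewrite -[FMonom [::]]fmoneE.
  by rewrite /Q E rmorph1.
have E : FreeAlg << FMonom (x :: s) >> = fgen K x * FreeAlg << FMonom s >>
    :> free_alg K X.
  rewrite -[RHS]/(free_mul (fgen K x) (FreeAlg << FMonom s >>)) !unlock /=.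
  congr FreeAlg; rewrite malgM_def fgmulUU mulr1.
  by rewrite -[FMonom (x :: s)](@fmmulE X (FMonom [:: x]) (FMonom s)) fmuE.
by rewrite /Q E rmorphM; apply: Pgen.
Qed.

End PresentedInduction.

Section YangianRelations.
Variables (K : numFieldType) (I : finType) (c : I -> I -> int) (sp : I -> I -> K).
Local Notation Y := (yangian c sp).
Local Notation x e i r := (Yx c sp e i r).
Local Notation xi i r := (Yxi c sp i r).
Local Notation pi := (pres_pi (Relators (@yangian_rel_const K I c sp))).

Lemma pi_comm f g : pi (comm f g) = comm (pi f) (pi g).
Proof. by rewrite /comm rmorphB !rmorphM. Qed.

Lemma pi_acomm f g : pi (acomm f g) = acomm (pi f) (pi g).
Proof. by rewrite /acomm rmorphD !rmorphM. Qed.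

Lemma Yxi_xi i j r s : comm (xi i r) (xi j s) = 0.
Proof.
have := @pres_rel _ _ (Relators (@yangian_rel_const K I c sp)) _
  (yangian_xi_xi c sp i j r s).
by rewrite pi_comm.
Qed.

Lemma Yxi0_x e i j s : comm (xi i 0%N) (x e j s) = (pm K e * sp i j) *: x e j s.
Proof.
have := @pres_rel _ _ (Relators (@yangian_rel_const K I c sp)) _
  (yangian_xi0_x c sp e i j s).
by rewrite rmorphB /= pi_comm linearZ /= => /eqP; rewrite subr_eq0 => /eqP.
Qed.

Lemma Yxp_xm i j r s :
  comm (x true i r) (x false j s) = if i == j then xi i (r + s)%N else 0.
Proof.
have := @pres_rel _ _ (Relators (@yangian_rel_const K I c sp)) _
  (yangian_xp_xm c sp i j r s).
rewrite rmorphB /= pi_comm => /eqP; rewrite subr_eq0 => /eqP ->.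
by case: ifP; rewrite ?rmorph0.
Qed.

Lemma Yxi_x e i j r s :
  comm (xi i r.+1) (x e j s) - comm (xi i r) (x e j s.+1) =
  (pm K e * (sp i j / 2)) *: acomm (xi i r) (x e j s).
Proof.
have := @pres_rel _ _ (Relators (@yangian_rel_const K I c sp)) _
  (yangian_xi_x c sp e i j r s).
rewrite [pi (comm _ _ - _ - _)]rmorphB /= [pi (comm _ _ - _)]rmorphB /= !pi_comm.
by rewrite linearZ /= pi_acomm => /eqP; rewrite subr_eq0 => /eqP.
Qed.

Lemma Yx_x e i j r s :
  comm (x e i r.+1) (x e j s) - comm (x e i r) (x e j s.+1) =
  (pm K e * (sp i j / 2)) *: acomm (x e i r) (x e j s).
Proof.
have := @pres_rel _ _ (Relators (@yangian_rel_const K I c sp)) _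
  (yangian_x_x c sp e i j r s).
rewrite [pi (comm _ _ - _ - _)]rmorphB /= [pi (comm _ _ - _)]rmorphB /= !pi_comm.
by rewrite linearZ /= pi_acomm => /eqP; rewrite subr_eq0 => /eqP.
Qed.

End YangianRelations.

Section TwistedRelations.
Variables (K : numFieldType) (I : finType) (c : I -> I -> int) (sp : I -> I -> K).
Local Notation T := (twisted_yangian c sp).
Local Notation h i r := (Th c sp i r).
Local Notation b i r := (Tb c sp i r).
Local Notation pi := (pres_pi (Relators (@twisted_rel_const K I c sp))).

Lemma piT_comm f g : pi (comm f g) = comm (pi f) (pi g).
Proof. by rewrite /comm rmorphB !rmorphM. Qed.

Lemma piT_acomm f g : pi (acomm f g) = acomm (pi f) (pi g).
Proof. by rewrite /acomm rmorphD !rmorphM. Qed.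

Lemma hfree_odd i k :
  hfree K i (Posz k.*2.+1) = fgen K (inl (i, k) : tgen_index I).
Proof. by rewrite /hfree /= odd_double /= uphalf_double. Qed.

Lemma Th0_b i j s : comm (h i 0%N) (b j s) = (2 * sp i j) *: b j s.+1.
Proof.
(* At r = 0 the convention h_{i,-1} = 1 kills the commutators with it and doubles the
   anticommutator. *)
have := @pres_rel _ _ (Relators (@twisted_rel_const K I c sp)) _
  (twisted_h_b c sp i j 0 s).
rewrite [pi (comm _ _ - _ - _)]rmorphB /= [pi (comm _ _ - _)]rmorphB /=
  [pi (_ *: _ + _ *: _)]rmorphD /= !piT_comm !linearZ /= piT_acomm piT_comm !rmorph1.
move=> E; apply: (lincomb1 (k := 1) E); rewrite /Tb /Th /pgen.
ncring.
Qed.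

Lemma ThS_b i j k s :
  comm (h i k.+1) (b j s) - comm (h i k) (b j s.+2) =
  sp i j *: acomm (h i k) (b j s.+1) + (sp i j ^+ 2 / 4) *: comm (h i k) (b j s).
Proof.
(* The choice r = 2k+2 makes r+1 and r-1 the odd indices of [h i k.+1] and [h i k]; for odd r the
   defining relation is trivial. *)
have := @pres_rel _ _ (Relators (@twisted_rel_const K I c sp)) _
  (twisted_h_b c sp i j (k.*2.+2) s).
have -> : (k.*2.+2)%:Z + 1 = Posz k.+1.*2.+1 by rewrite -PoszD addn1.
have -> : (k.*2.+2)%:Z - 1 = Posz k.*2.+1 by lia.
rewrite !hfree_odd.
rewrite [pi (comm _ _ - _ - _)]rmorphB /= [pi (comm _ _ - _)]rmorphB /=
  [pi (_ *: _ + _ *: _)]rmorphD /= !piT_comm !linearZ /= piT_acomm piT_comm.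
by move=> /eqP; rewrite subr_eq0 => /eqP.
Qed.

Lemma Tb_b i r :
  comm (b i r.+1) (b i r) - comm (b i r) (b i r.+1) =
  (sp i i / 2) *: acomm (b i r) (b i r) - (2 * (-1) ^+ r) *: h i r.
Proof.
have := @pres_rel _ _ (Relators (@twisted_rel_const K I c sp)) _
  (twisted_b_b c sp i i r r).
have -> : r%:Z + r%:Z + 1 = Posz r.*2.+1 by rewrite -!PoszD addn1 addnn.
rewrite eqxx hfree_odd.
rewrite [pi (comm _ _ - _ - _)]rmorphB /= [pi (comm _ _ - _)]rmorphB /=
  [pi (_ *: _ - _ *: _)]rmorphB /= !piT_comm !linearZ /= piT_acomm.
by move=> /eqP; rewrite subr_eq0 => /eqP.
Qed.

End TwistedRelations.

(** * Highest weight vectors of the Yangian *)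

Section RootTruncation.
Variable K : numFieldType.

Lemma poly_natr_bound (p : {poly K}) : p != 0 ->
  exists B, forall k, (B <= k)%N -> p.[k%:R] != 0.
Proof.
have [n] := ubnP (size p); elim: n p => // n IHn p pn p0.
have [[k pk]|nok] := pselect (exists k : nat, root p k%:R); last first.
  by exists 0%N => k _; apply/negP => pk; apply: nok; exists k.
have /factor_theorem[q pE] := pk.
have q0 : q != 0 by apply: contraNneq p0 => q0; rewrite pE q0 mul0r.
have [|B Bq] := IHn q _ q0.
  by move: pn; rewrite pE size_Mmonic ?monicXsubC // size_XsubC addn2.
exists (maxn B k.+1) => j; rewrite geq_max => /andP[Bj kj].
rewrite pE hornerM mulf_neq0 ?Bq // !hornerE subr_eq0 eqr_nat.
by rewrite neq_ltn kj orbT.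
Qed.

Variables (n : nat) (H : 'M[K]_n.+1).

(** The transpose appears because [eigenvalue] refers to row vectors, whereas H acts on columns. *)
Lemma eigen_root (c : K) (v : 'cV_n.+1) :
  v != 0 -> H *m v = c *: v -> root (char_poly H^T) c.
Proof.
move=> v0 Hv; rewrite -eigenvalue_root_char; apply/eigenvalueP; exists v^T.
  by rewrite -trmx_mul Hv linearZ.
by rewrite -(inj_eq (@trmx_inj _ _ _)) trmxK trmx0.
Qed.

Lemma not_root_eigen0 (c : K) m (Z : 'M_(n.+1, m)) :
  ~~ root (char_poly H^T) c -> H *m Z = c *: Z -> Z = 0.
Proof.
move=> nr HZ; apply/matrixP => i j; rewrite mxE.
suff : col j Z = 0 by move/matrixP/(_ i 0); rewrite !mxE.
apply/eqP; apply: contraT => v0; move: nr.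
rewrite (eigen_root v0) //; apply/matrixP => a b; rewrite !mxE.
have /matrixP/(_ a j) := HZ; rewrite !mxE => <-.
by apply: eq_bigr => k _; rewrite mxE.
Qed.

Lemma char_poly_comp_neq0 (q : {poly K}) : (1 < size q)%N ->
  char_poly H^T \Po q != 0.
Proof.
move=> sq; rewrite -size_poly_eq0.
have := size_comp_poly (char_poly H^T) q.
rewrite size_char_poly /= => E; apply/eqP => E0; move: E; rewrite E0.
by move=> /esym/eqP; rewrite muln_eq0 -subn1 subn_eq0 leqNgt sq.
Qed.

Lemma low_not_eigen (mu : K) :
  exists M, ~~ root (char_poly H^T) (mu - M%:R).
Proof.
have := @poly_natr_bound (char_poly H^T \Po (mu%:P - 'X)).
case=> [|B Bp].
  by apply: char_poly_comp_neq0; rewrite -size_polyN opprB size_XsubC.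
exists B; have := Bp B (leqnn B).
by rewrite horner_comp !hornerE.
Qed.

(** Only finitely many a + k are roots, so the last root on this ray serves as mu; eigenvalues off
    the ray need not be compared. *)
Lemma top_root (a : K) : root (char_poly H^T) a ->
  exists2 mu, root (char_poly H^T) mu &
    forall k : nat, ~~ root (char_poly H^T) (mu + k.+1%:R).
Proof.
move=> ra; have := @poly_natr_bound (char_poly H^T \Po ('X + a%:P)).
case=> [|B Bp]; first by apply: char_poly_comp_neq0; rewrite size_XaddC.
pose P k := root (char_poly H^T) (a + k%:R).
have ex : exists k, P k by exists 0%N; rewrite /P addr0.
have ub k : P k -> (k <= B)%N.
  move=> Pk; rewrite leqNgt; apply/negP => /ltnW/Bp.
  rewrite horner_comp; have -> : ('X + a%:P).[k%:R] = a + k%:R.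
    by rewrite !hornerE addrC.
  by rewrite (eqP Pk) eqxx.
case: (ex_maxnP ex ub) => k Pk kmax; exists (a + k%:R) => // j.
apply/negP => rj; have : (k + j.+1 <= k)%N by apply: kmax; rewrite /P natrD addrA.
by lia.
Qed.

End RootTruncation.

Lemma deg_ge_morph (K : numFieldType) (A B : algType K)
    (f : {lrmorphism A -> B}) (H : A) k a :
  deg_ge H k a -> deg_ge (f H) k (f a).
Proof.
elim=> [|j a1 a2 kj Ha1 _ IH]; first by rewrite rmorph0; exact: deg_ge0.
rewrite rmorphD; apply: deg_geD kj _ IH.
by rewrite /homogeneous /comm -!rmorphM -rmorphB -linearZ; congr (f _).
Qed.

Lemma morph_comm (K : fieldType) (A B : algType K) (f : {lrmorphism A -> B}) a b :
  f (comm a b) = comm (f a) (f b).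
Proof. by rewrite /comm rmorphB !rmorphM. Qed.

Lemma morph_acomm (K : fieldType) (A B : algType K) (f : {lrmorphism A -> B}) a b :
  f (acomm a b) = acomm (f a) (f b).
Proof. by rewrite /acomm rmorphD !rmorphM. Qed.

Lemma morph_rel (K : fieldType) (A B : algType K) (f : {lrmorphism A -> B})
    a1 b1 a2 b2 k a b :
  comm a1 b1 - comm a2 b2 = k *: acomm a b ->
  comm (f a1) (f b1) - comm (f a2) (f b2) = k *: acomm (f a) (f b).
Proof.
move=> E; rewrite -!morph_comm -morph_acomm -[RHS]linearZ /= -E.
by rewrite [f (comm _ _ - _)]rmorphB.
Qed.

(** * Images of the twisted generators, graded by height *)

Section Embedded.
Variables (K : numFieldType) (g : lie_algebra K) (I : finType).
Variable D : chevalley_data g I.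
Variable (iota : {linear g -> Yangian D}).
Hypothesis iotaP : is_lie_inclusion iota.
Variable phi : {lrmorphism TwistedYangian D -> Yangian D}.
Hypothesis phiP : is_twisted_embedding iota phi.
Variable c : I -> K.
Hypothesis cE : forall j, \sum_k c k * cd_sp D k j = 1.

Local Notation Y := (Yangian D).
Local Notation x e i r := (Yx (cd_c D) (cd_sp D) e i r : Y).
Local Notation xi i r := (Yxi (cd_c D) (cd_sp D) i r : Y).
Local Notation b i r := (phi (Tb (cd_c D) (cd_sp D) i r) : Y).
Local Notation h i r := (phi (Th (cd_c D) (cd_sp D) i r) : Y).
Local Notation d i := (cd_d D i).

(** Image of the Cartan element on which every simple root is 1; its adjoint action on a root vector
    is multiplication by the height. *)
Definition rho_elt : Y := \sum_k c k *: xi k 0%N.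

Lemma comm_rho z : comm rho_elt z = \sum_k c k *: comm (xi k 0%N) z.
Proof.
rewrite /comm mulr_suml mulr_sumr -sumrB; apply: eq_bigr => k _.
by rewrite scalerBr -scalerAl -scalerAr.
Qed.

Lemma rho_x e j r : comm rho_elt (x e j r) = pm K e *: x e j r.
Proof.
rewrite comm_rho -[pm K e]mulr1 -(cE j) mulr_sumr scaler_suml.
by apply: eq_bigr => k _; rewrite Yxi0_x scalerA mulrCA.
Qed.

Lemma rho_xi j r : comm rho_elt (xi j r) = 0.
Proof.
by rewrite comm_rho big1 // => k _; rewrite Yxi_xi scaler0.
Qed.

Lemma rho_iota : rho_elt = iota (vsval (coweight D c)).
Proof.
have [_ ixi _ _] := iotaP.
rewrite /coweight !linear_sum /=; apply: eq_bigr => k _.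
by rewrite !linearZ /= cartan_xiE ixi.
Qed.

Lemma rho_root alpha : alpha \in cd_pos D ->
  comm rho_elt (iota (cd_xp alpha)) =
  alpha (coweight D c) *: iota (cd_xp alpha).
Proof.
move=> /cd_xpP E; have [il _ _ _] := iotaP.
by rewrite rho_iota -il E linearZ.
Qed.

Lemma homogeneous_x e i r :
  homogeneous rho_elt (if e then 1 else -1) (x e i r).
Proof. by rewrite /homogeneous rho_x; case: e. Qed.

Lemma homogeneous_xi i r : homogeneous rho_elt 0 (xi i r).
Proof. by rewrite /homogeneous rho_xi scale0r. Qed.

Lemma homogeneous_root alpha : alpha \in cd_pos D -> exists n : nat,
  homogeneous rho_elt n.+1 (iota (cd_xp alpha)) /\
  (n = 0%N -> exists j, alpha = cd_simple D j).
Proof.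
move=> ap; have [n [an n0]] := root_height cE ap.
by exists n; split=> //; rewrite /homogeneous (rho_root ap) an.
Qed.

Definition root_rest i : Y :=
  \sum_(alpha <- cd_pos D | alpha != cd_simple D i)
    cd_ip alpha (cd_simple D i) *: (iota (cd_xp alpha) * iota (cd_xp alpha)).

Lemma phi_b0 i : b i 0%N = x true i 0%N - x false i 0%N.
Proof. by have [-> _] := phiP; have [_ _ -> ->] := iotaP. Qed.

Local Notation T i := (xi i 1%N - 2^-1 *: (xi i 0%N * xi i 0%N)).

Lemma phi_h0_all i : h i 0%N = 2 *: T i +
  \sum_(alpha <- cd_pos D)
     cd_ip alpha (cd_simple D i) *: (iota (cd_xp alpha) * iota (cd_xp alpha)).
Proof.
have [_ ->] := phiP; have [_ -> _ _] := iotaP; congr (_ + _).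
by rewrite expr2 scalerBr scalerA divff ?pnatr_eq0 // scale1r.
Qed.

Lemma phi_h0 i : h i 0%N = 2 *: T i
  + (2 * d i) *: (x true i 0%N * x true i 0%N) + root_rest i.
Proof.
rewrite phi_h0_all -addrA; congr (_ + _).
rewrite (bigD1_seq (cd_simple D i)) ?simple_pos ?cd_pos_uniq //=.
congr (_ + _); have [_ _ ixp _] := iotaP; rewrite -/(chev_xp D i) ixp.
congr (_ *: _); rewrite /cd_d /cd_sp mulrC divfK ?pnatr_eq0 //.
Qed.

Lemma root_rest_ge i : deg_ge rho_elt 2 (root_rest i).
Proof.
rewrite /root_rest big_seq_cond; apply: deg_ge_sum => alpha /andP[ap _].
apply: deg_geZ; have [n [Hn _]] := homogeneous_root ap.
by apply: homogeneous_deg_ge (homogeneousM Hn Hn); lia.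
Qed.

(** The raising vector of a simple root other than alpha_i commutes with [x false i r]. For any
    other root in the sum the height is at least 2, so the commutator has degree at least 4 - 1. *)
Lemma root_rest_comm_ge i r : deg_ge rho_elt 2 (comm (root_rest i) (x false i r)).
Proof.
have -> : comm (root_rest i) (x false i r) =
  \sum_(alpha <- cd_pos D | alpha != cd_simple D i)
    cd_ip alpha (cd_simple D i) *:
      comm (iota (cd_xp alpha) * iota (cd_xp alpha)) (x false i r).
  rewrite /comm /root_rest mulr_suml mulr_sumr -sumrB; apply: eq_bigr => k _.
  by rewrite scalerBr -scalerAl -scalerAr.
rewrite big_seq_cond; apply: deg_ge_sum => alpha /andP[ap ai].
apply: deg_geZ; have [[|n] [Hn n0]] := homogeneous_root ap.
  have [j aj] := n0 erefl; have ji : j != i by apply: contraNneq ai => <-; rewrite aj.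
  have [_ _ ixp _] := iotaP; rewrite aj -/(chev_xp D j) ixp.
  have x0 : comm (x true j 0%N) (x false i r) = 0 by rewrite Yxp_xm (negPf ji).
  have -> : comm (x true j 0%N * x true j 0%N) (x false i r) =
     acomm (x true j 0%N) (comm (x true j 0%N) (x false i r)) by ncring.
  by rewrite x0 /acomm mulr0 mul0r addr0; exact: deg_ge0.
have H2 := homogeneousM Hn Hn.
apply: homogeneous_deg_ge (homogeneous_comm H2 (homogeneous_x false i r)).
by rewrite -PoszD; lia.
Qed.

Lemma phi_hb i j s : comm (h i 0%N) (b j s) = (2 * cd_sp D i j) *: b j s.+1.
Proof. by rewrite -morph_comm Th0_b linearZ. Qed.

Lemma phi_bb i r : comm (b i r.+1) (b i r) - comm (b i r) (b i r.+1) =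
  d i *: acomm (b i r) (b i r) - (2 * (-1) ^+ r) *: h i r.
Proof.
have := congr1 phi (Tb_b (cd_c D) (cd_sp D) i r).
rewrite [phi (comm _ _ - _)]rmorphB /= !morph_comm => ->.
have phiZ k a : phi (k *: a) = k *: phi a by rewrite linearZ.
by rewrite [phi (_ *: _ - _)]rmorphB /= !phiZ morph_acomm.
Qed.

End Embedded.

Section Representation.
Variables (K : numClosedFieldType) (g : lie_algebra K) (I : finType).
Variable D : chevalley_data g I.
Variable (iota : {linear g -> Yangian D}).
Hypothesis iotaP : is_lie_inclusion iota.
Variable phi : {lrmorphism TwistedYangian D -> Yangian D}.
Hypothesis phiP : is_twisted_embedding iota phi.
Variable c : I -> K.
Hypothesis cE : forall j, \sum_k c k * cd_sp D k j = 1.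
Variables (n : nat) (rho : {lrmorphism Yangian D -> 'M[K]_n.+1}).

Local Notation Y := (Yangian D).
Local Notation x e i r := (Yx (cd_c D) (cd_sp D) e i r : Y).
Local Notation xi i r := (Yxi (cd_c D) (cd_sp D) i r : Y).
Local Notation b i r := (phi (Tb (cd_c D) (cd_sp D) i r) : Y).
Local Notation h i r := (phi (Th (cd_c D) (cd_sp D) i r) : Y).
Local Notation d i := (cd_d D i).
Local Notation H := (rho_elt D c).
Local Notation T i := (xi i 1%N - 2^-1 *: (xi i 0%N * xi i 0%N)).
Local Notation isroot := (root (char_poly (rho H)^T)).

(** The commuting xi preserve the eigenspace of H for a topmost eigenvalue, so they have a common
    eigenvector there. *)
Lemma highest_weight_vector : exists mu (w : 'cV[K]_n.+1) (gamma : I -> nat -> K),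
  [/\ w != 0, rho H *m w = mu *: w, forall k : nat, ~~ isroot (mu + k.+1%:R)
    & forall j r, rho (xi j r) *m w = gamma j r *: w].
Proof.
have [a ra] : exists a, isroot a.
  by apply/closed_rootP; rewrite size_char_poly.
have [mu rmu top] := top_root ra.
pose V : vectType K := 'cV[K]_n.+1.
pose f (jr : I * nat) : {linear V -> V} := mulmx (rho (xi jr.1 jr.2)).
pose U : {vspace V} := lker (linfun (mulmx (rho H) : V -> V) - mu *: \1%VF)%R.
have mU (u : V) : (u \in U) = (rho H *m u == mu *: u).
  rewrite memv_ker add_lfunE opp_lfunE scale_lfunE id_lfunE.
  by rewrite linfun_appE ?subr_eq0 //; exact: linearP.
have fC i j (v : V) : f i (f j v) = f j (f i v).
  rewrite /f /= !mulmxA; congr (_ *m _).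
  rewrite !mulmxE -!(rmorphM rho); congr (rho _).
  by apply/eqP; rewrite -subr_eq0; apply/eqP; exact: (Yxi_xi (cd_c D) (cd_sp D) i.1 j.1 i.2 j.2).
have fU j (u : V) : u \in U -> f j u \in U.
  rewrite !mU /f /= => /eqP uU; rewrite mulmxA mulmxE -rmorphM.
  have -> : H * xi j.1 j.2 = xi j.1 j.2 * H.
    by apply/eqP; rewrite -subr_eq0; apply/eqP; exact: rho_xi.
  by rewrite rmorphM -mulmxE -mulmxA uU -scalemxAr.
have U0 : U != 0%VS.
  move: rmu; rewrite -eigenvalue_root_char => /eigenvalueP[v vH v0].
  apply: contraNneq v0 => U0.
  have : (v^T : V) \in U.
    by rewrite mU -[X in X == _]trmxK trmx_mul trmxK vH linearZ.
  by rewrite U0 memv0 -(inj_eq (@trmx_inj _ _ _)) trmx0.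
have [w wU [w0 wE]] := common_eigenvector fC fU U0.
have [gamma gE] := choice wE.
exists mu, w, (fun j r => gamma (j, r)); split=> //.
- by apply/eqP; rewrite -mU.
- by move=> j r; exact: (gE (j, r)).
Qed.

Variables (mu : K) (w : 'cV[K]_n.+1) (gamma : I -> nat -> K).
Hypothesis w0 : w != 0.
Hypothesis Hw : rho H *m w = mu *: w.
Hypothesis top : forall k : nat, ~~ isroot (mu + k.+1%:R).
Hypothesis xiw : forall j r, rho (xi j r) *m w = gamma j r *: w.

(* W is w padded with zero columns, so that identities about the action on w
   take place in the matrix algebra. *)
Definition square_vector : 'M[K]_n.+1 := w *m (delta_mx 0 0 : 'rV_n.+1).
Local Notation W := square_vector.

Lemma square_vectorK : W *m (delta_mx 0 0 : 'cV_n.+1) = w.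
Proof.
rewrite /W -mulmxA mul_delta_mx -[RHS]mulmx1; congr (_ *m _).
by apply/matrixP => i j; rewrite !mxE !ord1.
Qed.

Lemma square_vector_eq a k : rho a *m w = k *: w <-> rho a * W = k *: W.
Proof.
split=> E; first by rewrite -mulmxE mulmxA E -scalemxAl.
by rewrite -square_vectorK mulmxA mulmxE E -scalemxAl.
Qed.

Lemma square_vector_neq0 : W != 0.
Proof. by apply: contraNneq w0 => W0; rewrite -square_vectorK W0 mul0mx. Qed.

Lemma homogeneous_morph k a : homogeneous H k a -> homogeneous (rho H) k (rho a).
Proof. by rewrite /homogeneous => E; rewrite -morph_comm E linearZ. Qed.

Lemma top_square (k : nat) (z : 'M[K]_n.+1) :
  rho H * z = (mu + k.+1%:R) *: z -> z = 0.
Proof. exact: (not_root_eigen0 (top k)). Qed.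

Lemma rho_square_vector : rho H * W = mu *: W.
Proof. exact/square_vector_eq. Qed.

Let rhoZ k a : rho (k *: a) = k *: rho a. Proof. by rewrite linearZ. Qed.

Section Simple.
Variable i : I.

Let X r := rho (x false i r).
Let XI r := rho (xi i r).
Let E := rho (x true i 0%N).

Let d0 : d i != 0. Proof. exact: cd_d_neq0. Qed.

Let spE : cd_sp D i i = 2 * d i.
Proof. by rewrite /cd_d mulrC divfK // pnatr_eq0. Qed.

Let xi0x s : comm (XI 0%N) (X s) = (- (2 * d i)) *: X s.
Proof. by rewrite -morph_comm Yxi0_x linearZ /= mulN1r spE. Qed.

Let ex r : comm E (X r) = XI r.
Proof. by rewrite -morph_comm Yxp_xm eqxx. Qed.

Let xix r s : comm (XI r.+1) (X s) - comm (XI r) (X s.+1) =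
  (- d i) *: acomm (XI r) (X s).
Proof.
apply: morph_rel.
by rewrite Yxi_x mulN1r.
Qed.

Let xx r s : comm (X r.+1) (X s) - comm (X r) (X s.+1) =
  (- d i) *: acomm (X r) (X s).
Proof.
apply: morph_rel.
by rewrite Yx_x mulN1r.
Qed.

Let Hx r : homogeneous (rho H) (-1) (X r).
Proof. exact: (homogeneous_morph (homogeneous_x cE false i r)). Qed.

Let Hxi r : homogeneous (rho H) 0 (XI r).
Proof. exact: (homogeneous_morph (homogeneous_xi D c i r)). Qed.

Let He : homogeneous (rho H) 1 E.
Proof. exact: (homogeneous_morph (homogeneous_x cE true i 0)). Qed.

Let WXI r : XI r * W = gamma i r *: W.
Proof. exact/square_vector_eq. Qed.

Lemma lambda_formula k : rho (h i k) *m w =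
  (2 * gamma i (k + k).+1 - \sum_(j < (k + k).+1)
     (-1) ^+ j * (gamma i j * gamma i (k + k - j)%N)) *: w.
Proof.
apply/square_vector_eq.
apply: (@h_hw_gamma K _ (d i) (rho H) E (rho (root_rest iota i)) W X XI
  (fun r => rho (b i r)) (fun r => rho (h i r)) mu (gamma i)) => //.
- by apply: deg_ge_morph; exact: root_rest_ge.
- by move=> r; rewrite -morph_comm; apply: deg_ge_morph; exact: root_rest_comm_ge.
- rewrite (phi_h0 iotaP phiP) /XI /E [rho (_ + _)]rmorphD /=.
  by rewrite [rho (_ + _)]rmorphD /= !rhoZ [rho (_ - _)]rmorphB /= !rhoZ !(rmorphM rho).
- by rewrite (phi_b0 iotaP phiP) rmorphB.
- move=> s; rewrite -morph_comm phi_hb linearZ /= spE mulrA.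
  by congr (_ * _ *: _); rewrite -natrM.
- move=> r; have := congr1 rho (phi_bb phi i r).
  rewrite [rho (comm _ _ - _)]rmorphB /= !morph_comm => ->.
  by rewrite [rho (_ *: _ - _)]rmorphB /= !rhoZ morph_acomm.
- exact: rho_square_vector.
- exact: top_square.
Qed.

Let comm_TX s : comm (rho (T i)) (X s) = (- (2 * d i)) *: X s.+1.
Proof.
have := comm_Tx xi0x xix s; rewrite /XI.
by rewrite [rho (_ - _)]rmorphB /= rhoZ (rmorphM rho).
Qed.

Lemma lambda_form : exists2 lam : nat -> K, weight_form (d i) lam &
  forall k, rho (h i k) *m w = lam k *: w.
Proof.
pose lam k := 2 * gamma i (k + k).+1 - \sum_(j < (k + k).+1)
     (-1) ^+ j * (gamma i j * gamma i (k + k - j)%N).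
exists lam; last exact: lambda_formula.
have [chi chim chi0] := linear_relation X.
(* A single linear relation among the modes propagates to all shifts, since commutation with T sends
   each [X r] to a fixed nonzero multiple of [X r.+1]. *)
have xrec : chi_recurrent chi X.
  elim=> [|r IHr]; first by rewrite -[RHS]chi0; apply: eq_bigr.
  have := congr1 (fun z => comm (rho (T i)) z) IHr.
  rewrite /comm mulr0 mul0r subrr mulr_sumr mulr_suml -sumrB.
  rewrite (eq_bigr (fun k : 'I__ => (- (2 * d i)) *: (chi`_k *: X (r.+1 + k)%N))).
    rewrite -scaler_sumr => /eqP; rewrite scaler_eq0 oppr_eq0 mulf_eq0.
    by rewrite pnatr_eq0 /= (negPf d0) /= => /eqP.
  move=> k _; have := comm_TX (r + k); rewrite /comm => F.
  by rewrite -scalerAr -scalerAl -scalerBr F !scalerA mulrC.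
have xirec := xi_recurrent ex xrec.
have grec r : \sum_(k < size chi) chi`_k * gamma i (r + k)%N = 0.
  have := congr1 (fun z => z * W) (xirec r); rewrite mul0r mulr_suml.
  rewrite (eq_bigr (fun k : 'I__ => (chi`_k * gamma i (r + k)%N) *: W)).
    rewrite -scaler_suml => /eqP; rewrite scaler_eq0 (negPf square_vector_neq0).
    by rewrite orbF => /eqP.
  by move=> k _; rewrite -scalerAl WXI scalerA.
(* The M-th power lowers the eigenvalue to mu - M, which for suitable M is outside the spectrum; M
   does not depend on v. *)
have nil : exists M, forall v, current chi v X ^+ M * W = 0.
  have [M nr] := low_not_eigen (rho H) mu; exists M => v.
  apply: (not_root_eigen0 nr).
  have Hf : homogeneous (rho H) (-1) (current chi v X).
    rewrite /current; apply: (big_rec (homogeneous (rho H) (-1))) => [|r a _ Ha].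
      by rewrite /homogeneous /comm mulr0 mul0r subrr scaler0.
    by apply: homogeneousD => //; apply: homogeneousZ.
  elim: M {nr} => [|M IHM]; first by rewrite expr0 mul1r subr0 mulmxE rho_square_vector.
  rewrite exprS -mulrA mulmxE (homogeneous_mul Hf IHM).
  by congr (_ *: _); rewrite -natr1 opprD addrA.
have eW : E * W = 0.
  by apply: (top_square (k := 0)); rewrite (homogeneous_mul He rho_square_vector).
have [F [k [F0 FE]]] := weight_num_factor d0 xi0x ex xix xx xrec eW WXI
  (monic_neq0 chim) square_vector_neq0 nil.
exact: (weight_form_base chim grec _ F0 FE).
Qed.

End Simple.
(** The eigenspace of H for mu - k in the Yangian module generated by w. It is encoded by generation
    so that the relations can be used by induction; [lowered_eigenP] returns from eigenvalues to
    this form. *)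
Inductive lowered : nat -> 'cV[K]_n.+1 -> Prop :=
| lowered_w : lowered 0 w
| lowered0 k : lowered k 0
| loweredL k a u v : lowered k u -> lowered k v -> lowered k (a *: u + v)
| loweredX k j s u : lowered k u -> lowered k.+1 (rho (x false j s) *m u).

Lemma loweredZ k a u : lowered k u -> lowered k (a *: u).
Proof. by move=> Lu; rewrite -[_ *: _]addr0; apply: loweredL => //; exact: lowered0. Qed.

Lemma loweredD k u v : lowered k u -> lowered k v -> lowered k (u + v).
Proof. by move=> Lu Lv; rewrite -[u]scale1r; apply: loweredL. Qed.

Lemma loweredB k u v : lowered k u -> lowered k v -> lowered k (u - v).
Proof. by move=> Lu Lv; rewrite addrC -scaleN1r; apply: loweredL. Qed.

Lemma act_comm a1 a2 (u : 'cV[K]_n.+1) :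
  rho a1 *m (rho a2 *m u) = rho a2 *m (rho a1 *m u) + rho (comm a1 a2) *m u.
Proof.
by rewrite /comm rmorphB /= !(rmorphM rho) -!mulmxE mulmxBl !mulmxA addrC subrK.
Qed.

(** Passing xi_(r+1) across x_s leaves xi_r together with x_(s+1), so r is lowered at the cost of s;
    hence the inner induction on r with s general. *)
Lemma lowered_xi k j r u : lowered k u -> lowered k (rho (xi j r) *m u).
Proof.
move=> Lu; elim: Lu r => {k u} [|k|k a u v _ IHu _ IHv|k l s u Lu IHu] r.
- by rewrite xiw; apply: loweredZ; exact: lowered_w.
- by rewrite mulmx0; exact: lowered0.
- by rewrite mulmxDr -scalemxAr; apply: loweredL.
elim: r s => [|r IHr] s.
  rewrite act_comm Yxi0_x rhoZ -scalemxAl; apply: loweredD.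
    exact: loweredX.
  by apply: loweredZ; exact: loweredX.
rewrite act_comm; apply: loweredD; first exact: loweredX.
have -> : comm (xi j r.+1) (x false l s) = comm (xi j r) (x false l s.+1)
    + (pm K false * (cd_sp D j l / 2)) *: acomm (xi j r) (x false l s).
  by rewrite -Yxi_x addrC subrK.
rewrite [rho (_ + _)]rmorphD /= rhoZ mulmxDl -scalemxAl.
rewrite /comm /acomm [rho (_ - _)]rmorphB [rho (_ + _)]rmorphD /= !(rmorphM rho).
rewrite mulmxBl mulmxDl -!mulmxE -!mulmxA; apply: loweredD.
  by apply: loweredB; [exact: IHr | apply: loweredX; exact: IHu].
by apply: loweredZ; apply: loweredD; [exact: IHr | apply: loweredX; exact: IHu].
Qed.

Lemma raise_eigen a k (u : 'cV[K]_n.+1) (t : K) : homogeneous H k a ->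
  rho H *m u = t *: u -> rho H *m (rho a *m u) = (t + k%:~R) *: (rho a *m u).
Proof.
rewrite /homogeneous => Ha Hu.
rewrite act_comm Ha rhoZ Hu -scalemxAl -scalemxAr -scalerDl //.
Qed.

Lemma lowered_eigen k u : lowered k u -> rho H *m u = (mu - k%:R) *: u.
Proof.
elim=> {k u} [|k|k a u v _ IHu _ IHv|k l s u Lu IHu].
- by rewrite subr0.
- by rewrite mulmx0 scaler0.
- by rewrite mulmxDr -scalemxAr IHu IHv scalerDr !scalerA [a * _]mulrC.
rewrite (raise_eigen (homogeneous_x cE false l s) IHu).
by congr (_ *: _); rewrite -natr1 opprD addrA.
Qed.

Lemma raised_eq0 (u : 'cV[K]_n.+1) (k : nat) :
  rho H *m u = (mu + k.+1%:R) *: u -> u = 0.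
Proof. exact: (not_root_eigen0 (top k)). Qed.

Lemma lowered_xp k j r u : lowered k u ->
  if k is k'.+1 then lowered k' (rho (x true j r) *m u)
  else rho (x true j r) *m u = 0.
Proof.
elim=> {k u} [|[|k]|k a u v _ IHu _ IHv|k l s u Lu IHu].
- apply: (@raised_eq0 _ 0).
  exact: (raise_eigen (homogeneous_x cE true j r) Hw).
- by rewrite mulmx0.
- by rewrite mulmx0; exact: lowered0.
- case: k IHu IHv => [|k] IHu IHv; rewrite mulmxDr -scalemxAr.
    by rewrite IHu IHv scaler0 addr0.
  exact: loweredL.
rewrite act_comm Yxp_xm; apply: loweredD.
  case: k Lu IHu => [|k] _ IHu; first by rewrite IHu mulmx0; exact: lowered0.
  exact: loweredX.
case: eqP => _; first exact: lowered_xi.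
by rewrite rmorph0 mul0mx; exact: lowered0.
Qed.

Definition lowered_sum (u : 'cV[K]_n.+1) : Prop :=
  exists m (f : nat -> 'cV[K]_n.+1), (forall k, lowered k (f k)) /\
    u = \sum_(k < m) f k.

Lemma lowered_sumL a u v :
  lowered_sum u -> lowered_sum v -> lowered_sum (a *: u + v).
Proof.
move=> [m1 [f1 [L1 ->]]] [m2 [f2 [L2 ->]]].
pose cut m (f : nat -> 'cV[K]_n.+1) k := if (k < m)%N then f k else 0.
have Lcut m f : (forall k, lowered k (f k)) -> forall k, lowered k (cut m f k).
  by move=> L k; rewrite /cut; case: ifP => // _; exact: lowered0.
have cutE m (f : nat -> 'cV[K]_n.+1) p : (m <= p)%N -> \sum_(k < m) f k = \sum_(k < p) cut m f k.
  by move=> mp; rewrite (big_ord_widen p f mp) big_mkcond.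
exists (maxn m1 m2), (fun k => a *: cut m1 f1 k + cut m2 f2 k); split.
  by move=> k; apply: loweredL; apply: Lcut.
rewrite (cutE _ f1 _ (leq_maxl m1 m2)) (cutE _ f2 _ (leq_maxr m1 m2)).
by rewrite scaler_sumr -big_split.
Qed.

Lemma lowered_sum_lowered k u : lowered k u -> lowered_sum u.
Proof.
move=> Lu; exists k.+1, (fun j => if j == k then u else 0); split=> [j|].
  by case: eqP => [->|_] //; exact: lowered0.
by rewrite big_ord_recr /= eqxx big1 ?add0r // => j _; rewrite ltn_eqF.
Qed.

(** Each generator changes k by at most 1, so these sums form a Yangian submodule: the lowering
    modes alone generate everything from w. *)
Lemma lowered_sum_act a u : lowered_sum u -> lowered_sum (rho a *m u).
Proof.
have S0 : lowered_sum 0.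
  by apply: (lowered_sum_lowered (k := 0%N)); exact: lowered0.
have SD m (F : 'I_m -> 'cV[K]_n.+1) : (forall k, lowered_sum (F k)) ->
    lowered_sum (\sum_k F k).
  move=> SF; apply: big_rec => // k v _ Sv; rewrite -[F k]scale1r.
  exact: lowered_sumL.
elim/pres_alg_ind: a u => [|k a1 a2 IH1 IH2|y a IHa] u Su.
- by rewrite rmorph1 mul1mx.
- rewrite [rho (_ + _)]rmorphD /= rhoZ mulmxDl -scalemxAl.
  by apply: lowered_sumL; [exact: IH1 | exact: IH2].
rewrite rmorphM -mulmxE -mulmxA.
have [m [f [Lf ->]]] := IHa u Su; rewrite mulmx_sumr; apply: SD => k.
case: y => [[[[] j] r]|[j r]].
- have := lowered_xp j r (Lf k); case: (k : nat) => [|k'] Lk.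
    by rewrite -/(x true j r) Lk; exact: S0.
  exact: lowered_sum_lowered Lk.
- exact: (lowered_sum_lowered (loweredX j r (Lf k))).
- exact: (lowered_sum_lowered (lowered_xi j r (Lf k))).
Qed.

Lemma eigen_sum_eq0 m (f : nat -> 'cV[K]_n.+1) :
  (forall k, rho H *m f k = (mu - k%:R) *: f k) ->
  \sum_(k < m) f k = 0 -> forall k, (k < m)%N -> f k = 0.
Proof.
elim: m f => // m IHm f Hf; rewrite big_ord_recr /= => S0.
have f0 k : (k < m)%N -> f k = 0.
  move=> km; have : (m%:R - k%:R) *: f k = 0.
    apply: (IHm (fun k => (m%:R - k%:R) *: f k)) km => [j|].
      by rewrite -scalemxAr Hf !scalerA mulrC.
    have := congr1 (mulmx (rho H)) S0; rewrite mulmx0 mulmxDr mulmx_sumr Hf.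
    have -> : f m = - \sum_(k < m) f k by apply/eqP; rewrite -addr_eq0 addrC S0.
    rewrite scalerN scaler_sumr -sumrB => E; rewrite -[RHS]E.
    apply: eq_bigr => j _; rewrite Hf -scalerBl; congr (_ *: _); ring.
  move/eqP; rewrite scaler_eq0 subr_eq0 eqr_nat => /orP[/eqP mk|/eqP //].
  by move: km; rewrite mk ltnn.
have fm : f m = 0.
  by move: S0; rewrite big1 ?add0r // => j _; apply: f0.
by move=> k; rewrite ltnS leq_eqVlt => /predU1P[-> //|]; exact: f0.
Qed.

Lemma lowered_eigenP k u :
  lowered_sum u -> rho H *m u = (mu - k%:R) *: u -> lowered k u.
Proof.
move=> [m [f [Lf ->]]] Hu.
have g0 j : (j < m)%N -> (k%:R - j%:R) *: f j = 0.
  apply: (@eigen_sum_eq0 m (fun j => (k%:R - j%:R) *: f j)) => [i|].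
    by rewrite -scalemxAr (lowered_eigen (Lf i)) !scalerA mulrC.
  move: Hu; rewrite mulmx_sumr scaler_sumr => /eqP.
  rewrite -subr_eq0 -sumrB => /eqP E; rewrite -[RHS]E; apply: eq_bigr => i _.
  rewrite (lowered_eigen (Lf i)) -scalerBl; congr (_ *: _); ring.
have fE j : (j < m)%N -> j != k -> f j = 0.
  move=> jm jk; have /eqP := g0 j jm.
  rewrite scaler_eq0 subr_eq0 eqr_nat => /orP[/eqP kj|/eqP //].
  by move: jk; rewrite kj eqxx.
have [km|mk] := ltnP k m.
  rewrite (bigD1 (Ordinal km)) //= big1 ?addr0 // => j jk; apply: fE => //.
rewrite big1; first exact: lowered0.
by move=> j _; apply: fE => //; rewrite neq_ltn (leq_trans (ltn_ord j) mk).
Qed.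

(** A general root vector is not among the generators, so its effect is read off its degree: k drops
    by the height, and beyond mu the vector is 0. *)
Lemma lowered_root alpha k u : alpha \in cd_pos D -> lowered k u ->
  exists2 j, (j <= k.-1)%N & lowered j (rho (iota (cd_xp alpha)) *m u).
Proof.
move=> ap Lu; have [t [Ht _]] := homogeneous_root iotaP cE ap.
have := raise_eigen Ht (lowered_eigen Lu).
set v := rho _ *m u => Hv; have Sv : lowered_sum v.
  by apply: lowered_sum_act; exact: lowered_sum_lowered Lu.
have [tk|kt] := ltnP t k.
  exists (k - t.+1)%N; first by lia.
  apply: lowered_eigenP => //; rewrite Hv natrB //; congr (_ *: _).
  by rewrite opprB -[_%:~R]/(t.+1%:R) -addrA [- _ + _]addrC.
exists 0%N => //; have -> : v = 0; last exact: lowered0.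
apply: (@raised_eq0 _ (t - k)%N); rewrite Hv; congr (_ *: _).
rewrite -addrA; congr (_ + _); rewrite -subSn // natrB ?leqW //.
by rewrite addrC.
Qed.

(** Induction on k, and inside it on the mode s. For s = 0, x^- is x^+ minus b. For s + 1, x^- is a
    multiple of [T, x_s^-], where T is half of h_{i,1} minus squares of raising root vectors; these
    squares send [lowered k.+1] to some [lowered j] with j at most k. *)
Lemma iwasawa (P : 'cV[K]_n.+1 -> Prop) :
  linear_pred P -> (forall j s u, P u -> P (rho (b j s) *m u)) -> P w ->
  forall a, P (rho a *m w).
Proof.
move=> [P0 PL] Pb Pw.
have PZ k u : P u -> P (k *: u) by move=> Pu; rewrite -[_ *: _]addr0; apply: (PL).
have PD u v : P u -> P v -> P (u + v) by move=> Pu Pv; rewrite -[u]scale1r; apply: (PL).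
have PB u v : P u -> P v -> P (u - v).
  by move=> Pu Pv; rewrite addrC -scaleN1r; apply: (PL).
have Ph j u : P u -> P (rho (h j 0%N) *m u).
  move=> Pu; have hE : h j 0%N = d j *: (b j 0%N * b j 0%N) - comm (b j 1%N) (b j 0%N).
    apply: (lincomb1 (k := 2^-1) (phi_bb phi j 0)).
    by rewrite /comm /acomm expr0; ncring_coef; repeat split; field.
  rewrite hE [rho (_ - _)]rmorphB /= rhoZ morph_comm /comm (rmorphM rho) -!mulmxE.
  rewrite !mulmxBl -scalemxAl -!mulmxA.
  by apply: (PB); [apply: (PZ) | apply: (PB)]; do 2 apply: (Pb).
have PL' k : forall j u, (j <= k)%N -> lowered j u -> P u.
  elim: k => [|k IHk] j u.
    rewrite leqn0 => /eqP -> Lu; have [i iE] : exists i, i = 0%N by exists 0%N.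
    rewrite -iE in Lu; elim: Lu iE => {u} // k a u v _ IHu _ IHv k0.
    by apply: (PL); [exact: IHu | exact: IHv].
  rewrite leq_eqVlt => /predU1P[->|]; last by rewrite ltnS => jk; exact: (IHk).
  have Px i s v : lowered k v -> P (rho (x false i s) *m v).
    elim: s v => [|s IHs] v Lv.
      have -> : x false i 0%N = x true i 0%N - b i 0%N.
        by rewrite (phi_b0 iotaP phiP) opprB addrC subrK.
      rewrite [rho (_ - _)]rmorphB mulmxBl; apply: (PB).
        have := lowered_xp i 0 Lv; case kE: k => [|k'] Lk; first by rewrite Lk.
        by apply: (IHk k' _ _ Lk); rewrite kE.
      by apply: (Pb); exact: (IHk k).
    have d0 := cd_d_neq0 D i.
    have xE : x false i s.+1 = (- (2 * d i))^-1 *: comm (T i) (x false i s).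
      have -> : comm (T i) (x false i s) = (- (2 * d i)) *: x false i s.+1.
        apply: comm_Tx => [t|t t'].
          by rewrite Yxi0_x mulN1r /cd_d; congr (- _ *: _); rewrite mulrC divfK ?pnatr_eq0.
        by rewrite Yxi_x mulN1r.
      by rewrite scalerA mulVf ?scale1r // oppr_eq0 mulf_neq0 ?pnatr_eq0.
    rewrite xE rhoZ -scalemxAl; apply: (PZ).
    rewrite morph_comm /comm -!mulmxE mulmxBl -!mulmxA.
    have LT u' k' : lowered k' u' -> lowered k' (rho (T i) *m u').
      move=> Lu'; rewrite [rho (_ - _)]rmorphB /= rhoZ (rmorphM rho) -mulmxE.
      rewrite mulmxBl -scalemxAl -mulmxA; apply: loweredB; first exact: lowered_xi.
      by apply: loweredZ; do 2 apply: lowered_xi.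
    (* T preserves [lowered k], so in the second half of the commutator the inner hypothesis applies
       to T v. *)
    apply: (PB); last by apply: (IHs); exact: LT.
    set z := rho (x false i s) *m v.
    have Lz : lowered k.+1 z by exact: loweredX.
    have Pz : P z by exact: (IHs).
    have -> : T i = 2^-1 *: (h i 0%N - \sum_(alpha <- cd_pos D)
        cd_ip alpha (cd_simple D i) *: (iota (cd_xp alpha) * iota (cd_xp alpha))).
      by rewrite (phi_h0_all iotaP phiP) addrK scalerA mulVf ?scale1r ?pnatr_eq0.
    rewrite rhoZ -scalemxAl; apply: (PZ); rewrite [rho (_ - _)]rmorphB mulmxBl.
    apply: (PB); first exact: (Ph).
    rewrite rmorph_sum mulmx_suml big_seq; apply: big_rec => // alpha u' ap Pu'.
    apply: (PD) => //; rewrite /= rhoZ -scalemxAl; apply: (PZ).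
    rewrite (rmorphM rho) -mulmxE -mulmxA.
    have [j1 j1k L1] := lowered_root ap Lz.
    have [j2 j2k L2] := lowered_root ap L1.
    by apply: (IHk j2) L2; lia.
  move=> Lu; have [i iE] : exists i, i = k.+1 by exists k.+1.
  rewrite -iE in Lu; elim: Lu iE => {u} // [k' a u v _ IHu _ IHv k0|k' i' s u Lu _ [kE]].
    by apply: (PL); [exact: IHu | exact: IHv].
  by apply: (Px); rewrite -kE.
move=> a; have [m [f [Lf ->]]] :
  lowered_sum (rho a *m w) by apply: lowered_sum_act; exact: (lowered_sum_lowered lowered_w).
by apply: big_rec => // k v _ Pv; apply: (PD) => //; exact: (PL' k k).
Qed.

End Representation.

(** * Weights of restricted modules *)

(** The quotient is modelled on a complement of F written in a basis; F being proper makes the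
    matrix size a successor. *)
Lemma quotient_rep (K : fieldType) (A : algType K) (V : fd_module A)
    (F : {vspace V}) :
  (forall a v, v \in F -> fdm_act V a v \in F) -> F != fullv ->
  exists n (rho : {lrmorphism A -> 'M[K]_n.+1}) (pr : {linear V -> 'cV[K]_n.+1}),
    [/\ forall a v, pr (fdm_act V a v) = rho a *m pr v,
        forall v, (pr v == 0) = (v \in F) & forall q, exists v, pr v = q].
Proof.
move=> stab Ff; pose C := (F^C)%VS.
have [n dE] : exists n, \dim C = n.+1.
  case dC : (\dim C) => [|n]; last by exists n.
  move/eqP: dC; rewrite dimv_eq0 => /eqP C0; move: Ff.
  by rewrite -(addv_complf F) -/C C0 addv0 eqxx.
have [X XB] : exists X : n.+1.-tuple V, basis_of C X.
  by rewrite -dE; exists (vbasis C); exact: vbasisP.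
have CF : (C :&: F = 0)%VS by rewrite capvC capv_compl.
pose P := daddv_pi C F.
have PC v : P v \in C by exact: memv_pi.
have PF v : v - P v \in F.
  have := daddv_pi_add CF (w := v); rewrite addvC addv_complf memvf => /(_ isT).
  by move=> {1}<-; rewrite addrC addKr memv_pi.
have Pid v : v \in C -> P v = v by move=> vC; rewrite /P daddv_pi_id.
have P0 v : (P v == 0) = (v \in F).
  apply/idP/idP => [/eqP Pv|vF]; first by have := PF v; rewrite Pv subr0.
  rewrite -memv0 -CF memv_cap PC -[P v]opprK -[- P v](addKr v) memvN.
  by rewrite memvD ?memvN // PF.
pose pf v : 'cV[K]_n.+1 := \col_i coord X i (P v).
have pl : linear pf by move=> k u v; apply/colP => i; rewrite !mxE !linearP.
pose pr : {linear V -> 'cV[K]_n.+1} :=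
  HB.pack pf (GRing.isLinear.Build K V 'cV[K]_n.+1 *:%R pf pl).
pose sec (q : 'cV[K]_n.+1) : V := \sum_i q i 0 *: X`_i.
have secl : linear sec.
  move=> k u v; rewrite /sec scaler_sumr -big_split; apply: eq_bigr => i _.
  by rewrite !mxE /= scalerDl scalerA.
have Xfree := basis_free XB.
have secC q : sec q \in C.
  apply: memv_suml => i _; apply: memvZ; apply: (basis_mem XB).
  by apply: mem_nth; rewrite size_tuple.
have prsec q : pr (sec q) = q.
  apply/colP => i; rewrite mxE Pid //.
  rewrite /sec linear_sum /= (bigD1 i) //= big1 => [|j ji].
    by rewrite linearZ /= coord_free // eqxx addr0 /GRing.scale /= mulr1.
  by rewrite linearZ /= coord_free // (negPf ji) mulr0.
have pr0 v : (pr v == 0) = (v \in F).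
  rewrite -P0; apply/eqP/eqP => [/colP pv|Pv].
    rewrite (coord_basis XB (PC v)) big1 // => i _.
    by have := pv i; rewrite !mxE => ->; rewrite scale0r.
  by apply/colP => i; rewrite !mxE Pv linear0.
pose rf a : 'M[K]_n.+1 := \matrix_(i, j) pr (fdm_act V a X`_j) i 0.
have prZ k v : pr (k *: v) = k *: pr v by exact: linearZ.
have prB u v : pr (u - v) = pr u - pr v by exact: linearB.
have rfE a q : rf a *m q = pr (fdm_act V a (sec q)).
  rewrite /sec linear_sum (linear_sum pr); apply/colP => i; rewrite summxE mxE.
  apply: eq_bigr => j _; rewrite [rf a _ _]mxE linearZ prZ [RHS]mxE.
  by rewrite mulrC.
have prE a v : pr (fdm_act V a v) = rf a *m pr v.
  rewrite rfE; apply/eqP; rewrite -subr_eq0 -prB -linearB pr0; apply: stab.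
  by rewrite -pr0 prB prsec subrr.
have ext (B1 B2 : 'M[K]_n.+1) : (forall q : 'cV_n.+1, B1 *m q = B2 *m q) -> B1 = B2.
  by move=> E; apply/matrixP => i j; have := E (delta_mx j 0);
     rewrite -!colE => /colP/(_ i); rewrite !mxE.
have rf_zmod : zmod_morphism rf.
  by move=> a b; apply: ext => q; rewrite mulmxBl !rfE !linearB add_lfunE opp_lfunE prB.
have rf_mon : monoid_morphism rf.
  split=> [|a b]; apply: ext => q.
    by rewrite rfE fdm_act1 id_lfunE prsec mul1mx.
  by rewrite -mulmxE -mulmxA !rfE fdm_actM comp_lfunE prE -rfE rfE prE.
have rf_scal : scalable rf.
  by move=> k a; apply: ext => q; rewrite -scalemxAl !rfE linearZ scale_lfunE prZ.
pose rho : {lrmorphism A -> 'M[K]_n.+1} := HB.pack rf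
  (GRing.isZmodMorphism.Build A 'M[K]_n.+1 rf rf_zmod)
  (GRing.isMonoidMorphism.Build A 'M[K]_n.+1 rf rf_mon)
  (GRing.isScalable.Build K A 'M[K]_n.+1 *:%R rf rf_scal).
exists n, rho, pr; split=> // q.
by exists (sec q).
Qed.

(** * Flags of weights of the required form for a fixed node *)

Section YangianModule.
Variables (K : numClosedFieldType) (g : lie_algebra K) (I : finType).
Variable D : chevalley_data g I.
Variable (iota : {linear g -> Yangian D}).
Hypothesis iotaP : is_lie_inclusion iota.
Variable phi : {lrmorphism TwistedYangian D -> Yangian D}.
Hypothesis phiP : is_twisted_embedding iota phi.
Variables (V : fd_module (Yangian D)) (i : I).

Local Notation b j s := (fdm_act V (phi (Tb (cd_c D) (cd_sp D) j s))).
Local Notation h k := (fdm_act V (phi (Th (cd_c D) (cd_sp D) i k))).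

Let actZ a t (v : V) : fdm_act V a (t *: v) = t *: fdm_act V a v.
Proof. exact: linearZ. Qed.

Let actD a (u v : V) : fdm_act V a (u + v) = fdm_act V a u + fdm_act V a v.
Proof. exact: linearD. Qed.

Let actB a (u v : V) : fdm_act V a (u - v) = fdm_act V a u - fdm_act V a v.
Proof. exact: linearB. Qed.

Let act_sum a p (F : 'I_p -> V) :
  fdm_act V a (\sum_m F m) = \sum_m fdm_act V a (F m).
Proof. exact: linear_sum. Qed.

(** Flags take the place of sums of generalized weight spaces: maximality then means that any vector
    with an admissible weight modulo N already lies in N. *)
Inductive triangular : {vspace V} -> Prop :=
| triangular0 : triangular 0%VS
| triangularS U w lam : triangular U -> weight_form (cd_d D i) lam ->
    (forall k, h k w - lam k *: w \in U) -> triangular (U + <[w]>)%VS.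

Lemma triangular_stable U k u : triangular U -> u \in U -> h k u \in U.
Proof.
move=> tU; elim: tU u => {U} [|U w lam _ IHU _ wU] u.
  by rewrite !memv0 => /eqP ->; rewrite linear0.
move=> /memv_addP[u1 u1U [_ /vlineP[c ->] ->]]; rewrite actD actZ.
apply: memvD; first by apply: (subvP (addvSl U <[w]>)); exact: IHU.
apply: memvZ; rewrite -[h k w](subrK (lam k *: w)); apply: memvD.
  by apply: (subvP (addvSl U <[w]>)); exact: wU.
by apply: memvZ; apply: (subvP (addvSr U <[w]>)); exact: memv_line.
Qed.

(** At the step of the flag where v appears, v is a nonzero multiple of w modulo the previous
    subspace. There [h k - l k] acts by [lam k - l k], which is 0 because a power of it is. *)
Lemma triangular_weight U (l : nat -> K) v : triangular U -> v \in U -> v != 0 ->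
  (forall k, exists p, iter p (fun z => h k z - l k *: z) v = 0) ->
  weight_form (cd_d D i) l.
Proof.
move=> tU; elim: tU v => {U} [|U w lam tU IHU lamP wU] v.
  by rewrite memv0 => /eqP ->; rewrite eqxx.
have [vU|vU] := boolP (v \in U); first by move=> _; exact: IHU.
move=> /memv_addP[u1 u1U [_ /vlineP[c ->] vE]] v0 vl.
have cw : c *: w \notin U.
  by apply: contra vU => cwU; rewrite vE memvD.
have st k z (t : K) e : z - e *: (c *: w) \in U ->
    (h k z - t *: z) - ((lam k - t) * e) *: (c *: w) \in U.
  move=> zU; set u := z - e *: (c *: w) in zU.
  have -> : h k z - t *: z - ((lam k - t) * e) *: (c *: w) =
      h k u - t *: u + (e * c) *: (h k w - lam k *: w).
    rewrite /u actB !actZ; lmring.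
  by rewrite memvD ?memvB ?memvZ ?triangular_stable.
suff E k : l k = lam k by have -> : l = lam by apply/funext.
have [p vp] := vl k.
have : iter p (fun z => h k z - l k *: z) v - ((lam k - l k) ^+ p) *: (c *: w) \in U.
  elim: p {vp} => [|p IHp] /=; first by rewrite expr0 scale1r vE addrK.
  by rewrite exprS; exact: st.
rewrite vp sub0r memvN => memU.
apply/eqP; rewrite eq_sym -subr_eq0; apply: contraNT cw => ne.
have := memvZ ((lam k - l k) ^+ p)^-1 memU.
by rewrite scalerA mulVf ?expf_neq0 // scale1r.
Qed.

Section Maximal.
Variable N : {vspace V}.
Hypothesis tN : triangular N.
Hypothesis Nmax : forall w lam, weight_form (cd_d D i) lam ->
  (forall k, h k w - lam k *: w \in N) -> w \in N.

Lemma act_hb0 j s w : h 0%N (b j s w) =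
  b j s (h 0%N w) + (2 * cd_sp D i j) *: b j s.+1 w.
Proof.
have := congr1 (fun a => fdm_act V a w) (phi_hb phi i j s).
rewrite linearZ /= scale_lfunE /comm linearB !fdm_actM.
rewrite add_lfunE opp_lfunE !comp_lfunE => <-.
by rewrite addrC subrK.
Qed.

Lemma act_hbS j k s w : h k.+1 (b j s w) =
  b j s (h k.+1 w) + h k (b j s.+2 w) - b j s.+2 (h k w)
  + cd_sp D i j *: (h k (b j s.+1 w) + b j s.+1 (h k w))
  + (cd_sp D i j ^+ 2 / 4) *: (h k (b j s w) - b j s (h k w)).
Proof.
have E := congr1 phi (ThS_b (cd_c D) (cd_sp D) i j k s).
have := congr1 (fun a => fdm_act V a w) E.
have phiZ t a : phi (t *: a) = t *: phi a by rewrite linearZ.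
rewrite [phi (comm _ _ - _)]rmorphB [phi (_ *: _ + _)]rmorphD /= !phiZ.
rewrite !morph_comm morph_acomm /comm /acomm.
rewrite !(linearB, linearD, linearZ) /= !fdm_actM.
rewrite !(add_lfunE, opp_lfunE, scale_lfunE) !comp_lfunE => F.
by apply: (lincomb1 (k := 1) F); lmring.
Qed.

(** Modulo N a multiple of [h 0 - lam 0] shifts b_{j,s} w to b_{j,s+1} w. If one of these were
    outside N, an eigenvector of the shift would have a weight supplied by [weight_form_shift],
    against maximality. *)
Lemma triangular_b j U : triangular U -> forall u s, u \in U -> b j s u \in N.
Proof.
elim=> {U} [|U w lam _ IHU lamP wU] u s.
  by rewrite memv0 => /eqP ->; rewrite linear0 mem0v.
suff bw : b j s w \in N.
  move=> /memv_addP[u1 u1U [_ /vlineP[t ->] ->]].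
  by rewrite actD actZ memvD ?memvZ // IHU.
pose be s := b j s w.
have bh k t : b j t (h k w) - lam k *: be t \in N.
  have -> : b j t (h k w) - lam k *: be t = b j t (h k w - lam k *: w).
    by rewrite actB actZ.
  exact: (IHU _ _ (wU k)).
have hN k u' : u' \in N -> h k u' \in N by exact: triangular_stable.
set sp := cd_sp D i j.
have R0 t : h 0%N (be t) - lam 0%N *: be t - (2 * sp) *: be t.+1 \in N.
  by rewrite /be act_hb0 -/sp [X in X - _]addrAC addrK; exact: bh.
have RS k t : h k.+1 (be t) - lam k.+1 *: be t - h k (be t.+2) + lam k *: be t.+2
   - sp *: (h k (be t.+1) + lam k *: be t.+1)
   - (sp ^+ 2 / 4) *: (h k (be t) - lam k *: be t) \in N.
  rewrite /be act_hbS -/sp.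
  set X := (X in X \in N).
  have -> : X = (b j t (h k.+1 w) - lam k.+1 *: be t)
    - (b j t.+2 (h k w) - lam k *: be t.+2)
    + sp *: (b j t.+1 (h k w) - lam k *: be t.+1)
    - (sp ^+ 2 / 4) *: (b j t (h k w) - lam k *: be t).
    rewrite /X /be; lmring.
  by rewrite memvB ?memvZ // memvD ?memvZ // memvB.
(* For orthogonal roots no shift operator is available, but then b_{j,s} w has the weight of w
   modulo N. *)
have [sp0|sp0] := eqVneq sp 0.
  apply: (Nmax lamP) => k; rewrite -/(be s).
  elim: k s => [|k IHk] s; first by have := R0 s; rewrite sp0 mulr0 scale0r subr0.
  have := RS k s; rewrite sp0 expr2 !mul0r !scale0r !subr0 => F.
  have := memvD F (IHk s.+2); set X := (X in X \in N).
  by have -> : X = h k.+1 (be s) - lam k.+1 *: be s by rewrite /X; lmring.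
have cij : sp = (cd_c D i j)%:~R * cd_d D i.
  by rewrite /sp /cd_sp /cd_ip -cd_cP mulrC.
apply: contrapT => /negP bsN.
pose sf v := (2 * sp)^-1 *: (h 0%N v - lam 0%N *: v).
have sfl : linear sf.
  by move=> t u1 u2; rewrite /sf actD actZ; lmring.
pose sg : {linear V -> V} := HB.pack sf (GRing.isLinear.Build K V V *:%R sf sfl).
have sgZ t v : sg (t *: v) = t *: sg v by exact: linearZ.
have sgB u1 u2 : sg (u1 - u2) = sg u1 - sg u2 by exact: linearB.
have sgN u' : u' \in N -> sg u' \in N.
  by move=> u'N; apply: memvZ; rewrite memvB ?memvZ ?hN.
have sp2 : 2 * sp != 0 by rewrite mulf_neq0 ?pnatr_eq0.
have sgbe t : be t.+1 - sg (be t) \in N.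
  have := memvZ (- (2 * sp)^-1) (R0 t); set X := (X in X \in N).
  suff -> : be t.+1 - sg (be t) = X by [].
  by rewrite /X /sg /= /sf; lmring_coef; repeat split; field.
have be0 : be 0%N \notin N.
  apply: contra bsN => be0; rewrite -/(be s); elim: s => // s IHs.
  by rewrite -[be s.+1](subrK (sg (be s))) memvD // sgN.
have [a [q [yN syN]]] := eigenvector_mod sgN be0.
(* A whole family is kept because h_(k+1) on y_t involves h_k on y_(t+1) and y_(t+2); modulo N it is
   geometric with ratio a. *)
pose y t := \sum_(k < size q) q`_k *: be (t + k)%N.
have memsum (F : nat -> V) : (forall k, F k \in N) ->
    \sum_(k < size q) q`_k *: F k \in N.
  by move=> FN; apply: memv_suml => k _; apply: memvZ.
have y0 : y 0%N - poly_orbit sg (be 0%N) q \in N.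
  rewrite /y /poly_orbit -sumrB.
  have -> : \sum_(k < size q) (q`_k *: be (0 + k)%N - q`_k *: iter k sg (be 0%N)) =
     \sum_(k < size q) q`_k *: (be k - iter k sg (be 0%N)).
    by apply: eq_bigr => k _; rewrite scalerBr.
  apply: (memsum (fun k => be k - iter k sg (be 0%N))); elim=> [|k IHk] /=.
    by rewrite subrr mem0v.
  have -> : be k.+1 - sg (iter k sg (be 0%N)) =
     (be k.+1 - sg (be k)) + sg (be k - iter k sg (be 0%N)).
    by rewrite sgB; lmring.
  by rewrite memvD // sgN.
have sgy t : y t.+1 - sg (y t) \in N.
  rewrite /y linear_sum -sumrB.
  have -> : \sum_(k < size q) (q`_k *: be (t.+1 + k)%N - sg (q`_k *: be (t + k)%N))
    = \sum_(k < size q) q`_k *: (be (t + k).+1 - sg (be (t + k)%N)).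
    by apply: eq_bigr => k _; rewrite sgZ scalerBr.
  exact: (memsum (fun k => be (t + k).+1 - sg (be (t + k)%N))).
have ya t : y t.+1 - a *: y t \in N.
  have sgN' u1 u2 : u1 - u2 \in N -> sg u1 - sg u2 \in N.
    by move=> uN; rewrite -sgB sgN.
  elim: t => [|t IHt].
    set o := poly_orbit _ _ _ in y0 syN.
    have := memvD (memvD (sgy 0%N) (sgN' _ _ y0)) (memvB syN (memvZ a y0)).
    set X := (X in X \in N); suff -> : X = y 1%N - a *: y 0%N by [].
    by rewrite /X; lmring.
  have := memvB (memvD (sgy t.+1) (sgN' _ _ IHt)) (memvZ a (sgy t)).
  rewrite sgZ; set X := (X in X \in N).
  suff -> : X = y t.+2 - a *: y t.+1 by [].
  by rewrite /X; lmring.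
have y0N : y 0%N \notin N.
  apply: contra yN => y0N; rewrite -[poly_orbit _ _ _](subKr (y 0%N)).
  by rewrite memvB.
(* Integrality of the Cartan matrix enters here: c is an integral multiple of d_i/2, so the new
   factor belongs to the group. *)
pose c := (cd_c D i j)%:~R * cd_d D i / 2.
have cE : sp = 2 * c by rewrite cij /c; field.
have c0 : c != 0 by apply: contraNneq sp0 => c0; rewrite cE c0 mulr0.
(* Setting y_(t+1) = a y_t in the relation of h with b produces a^2 + a sp + sp^2/4 = (a+c)^2 for
   the new weight and (a-c)^2 for the old one. *)
pose lam' := fix lam' k := if k is k'.+1 then
    lam k + lam' k' * (a + c) ^+ 2 - lam k' * (a - c) ^+ 2
  else lam 0%N + 4 * c * a.
have lamP' : weight_form (cd_d D i) lam'.
  by apply: (@weight_form_shift _ (cd_d D i) (cd_c D i j) a lam' lam).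
have sumR k t : \sum_(m < size q) q`_m *: (h k.+1 (be (t + m)%N)
    - lam k.+1 *: be (t + m)%N - h k (be (t + m).+2) + lam k *: be (t + m).+2
   - sp *: (h k (be (t + m).+1) + lam k *: be (t + m).+1)
   - (sp ^+ 2 / 4) *: (h k (be (t + m)%N) - lam k *: be (t + m)%N)) \in N.
  exact: (memsum (fun m => _) (fun m => RS k (t + m)%N)).
have hy k t : h k (y t) = \sum_(m < size q) q`_m *: h k (be (t + m)%N).
  by rewrite /y act_sum; apply: eq_bigr => m _; rewrite actZ.
have RSy k t : h k.+1 (y t) - lam k.+1 *: y t - h k (y t.+2) + lam k *: y t.+2
   - sp *: (h k (y t.+1) + lam k *: y t.+1)
   - (sp ^+ 2 / 4) *: (h k (y t) - lam k *: y t) \in N.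
  have := sumR k t; set X := (X in X \in N -> _).
  suff -> : X = h k.+1 (y t) - lam k.+1 *: y t - h k (y t.+2) + lam k *: y t.+2
   - sp *: (h k (y t.+1) + lam k *: y t.+1)
   - (sp ^+ 2 / 4) *: (h k (y t) - lam k *: y t) by [].
  rewrite !hy /y !(scaler_sumr, =^~ big_split, =^~ sumrB) /=.
  rewrite /X; apply: eq_bigr => m _; rewrite !addSn; lmring.
have eig k : forall t, h k (y t) - lam' k *: y t \in N.
  elim: k => [|k IHk] t /=.
    rewrite [X in X \in N](_ : _ = - (2 * sp) *: (y t.+1 - sg (y t))
      + (2 * sp) *: (y t.+1 - a *: y t)); first by rewrite memvD ?memvZ.
    rewrite /sg /= /sf cE.
    by lmring_coef; repeat split; field.
  rewrite [X in X \in N](_ : _ = (h k.+1 (y t) - lam k.+1 *: y t - h k (y t.+2)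
     + lam k *: y t.+2 - sp *: (h k (y t.+1) + lam k *: y t.+1)
     - (sp ^+ 2 / 4) *: (h k (y t) - lam k *: y t))
     + (h k (y t.+2) - lam' k *: y t.+2) + sp *: (h k (y t.+1) - lam' k *: y t.+1)
     + (sp ^+ 2 / 4) *: (h k (y t) - lam' k *: y t)
     + (lam' k - lam k) *: (y t.+2 - a *: y t.+1)
     + ((lam' k - lam k) * a + sp * (lam' k + lam k)) *: (y t.+1 - a *: y t)).
    exact: (memvD (memvD (memvD (memvD (memvD (RSy k t) (IHk t.+2))
      (memvZ _ (IHk t.+1))) (memvZ _ (IHk t))) (memvZ _ (ya t.+1)))
      (memvZ _ (ya t))).
  by rewrite cE; lmring_coef; repeat split; field.
by move: y0N; rewrite (Nmax lamP' (fun k => eig k 0%N)).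
Qed.

End Maximal.
Lemma highest_weight_mod (F : {vspace V}) :
  (forall a v, v \in F -> fdm_act V a v \in F) -> F != fullv ->
  exists w lam, [/\ w \notin F, weight_form (cd_d D i) lam,
    forall k, h k w - lam k *: w \in F
    & forall N : {vspace V}, (F <= N)%VS ->
        (forall j s u, u \in N -> b j s u \in N) -> w \in N ->
        forall a, fdm_act V a w \in N].
Proof.
move=> Fstab Ffull; have [c cE] := coweight_exists D.
have [n [rho [pr [prE pr0 prsurj]]]] := quotient_rep Fstab Ffull.
have [mu [w' [gamma [w0 Hw top xiw]]]] := highest_weight_vector c rho.
have [w prw] := prsurj w'.
have [lam lamP hw] := lambda_form iotaP phiP cE w0 Hw top xiw i.
have prB u v : pr (u - v) = pr u - pr v by exact: linearB.
have prZ k u : pr (k *: u) = k *: pr u by exact: linearZ.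
exists w, lam; split=> //.
- by rewrite -pr0 prw.
- by move=> k; rewrite -pr0 prB prZ prE prw hw subrr.
move=> N FN Nb wN a.
(* As F lies in N, membership in N can be tested on images, so the generation statement is applied
   in the quotient. *)
pose P (q : 'cV[K]_n.+1) := exists2 v, v \in N & pr v = q.
have lP : linear_pred P.
  split; first by exists 0; rewrite ?mem0v // linear0.
  move=> k q1 q2 [v1 v1N <-] [v2 v2N <-]; exists (k *: v1 + v2).
    by rewrite memvD ?memvZ.
  by rewrite linearP.
have Pb j s u : P u -> P (rho (phi (Tb (cd_c D) (cd_sp D) j s)) *m u).
  by move=> [v vN <-]; exists (b j s v); rewrite ?Nb ?prE.
have Pw : P w' by exists w.
have [v vN vE] := iwasawa iotaP phiP cE w0 Hw top xiw lP Pb Pw a.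
rewrite -[fdm_act V a w](subrK v) memvD // (subvP FN) //.
by rewrite -pr0 prB vE prE prw subrr.
Qed.

Lemma module_weight (l : nat -> K) v : v != 0 ->
  (forall k, exists p, iter p (fun z => h k z - l k *: z) v = 0) ->
  weight_form (cd_d D i) l.
Proof.
move=> v0 vl; have [N tN Ndim] := max_subspace triangular0.
have Nmax w lam : weight_form (cd_d D i) lam ->
    (forall k, h k w - lam k *: w \in N) -> w \in N.
  move=> lamP wN; have dN := Ndim _ (triangularS tN lamP wN).
  have /eqP -> : N == (N + <[w]>)%VS by rewrite eqEdim addvSl.
  by apply: (subvP (addvSr N <[w]>)); exact: memv_line.
have Nb j s u : u \in N -> b j s u \in N.
  by move=> uN; apply: (triangular_b tN Nmax j tN).
have [F FE] : exists F : {vspace V}, forall u, u \in F <-> forall a, fdm_act V a u \in N.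
  apply: linear_pred_subspace; split=> [a|k u1 u2 u1N u2N a].
    by rewrite linear0 mem0v.
  by rewrite actD actZ memvD ?memvZ.
have FN : (F <= N)%VS.
  by apply/subvP => u /FE/(_ 1); rewrite fdm_act1 id_lfunE.
have Fstab a u : u \in F -> fdm_act V a u \in F.
  by move=> /FE uF; apply/FE => a'; rewrite -comp_lfunE -fdm_actM.
suff Nfull : N = fullv by apply: (triangular_weight tN _ v0 vl); rewrite Nfull memvf.
apply: contrapT => /eqP Nn.
have Ff : F != fullv.
  by apply: contraNneq Nn => Ff; rewrite eqEsubv subvf -Ff FN.
have [w [lam [wF lamP wE wN]]] := highest_weight_mod Fstab Ff.
have : w \in N by apply: (Nmax _ _ lamP) => k; apply: (subvP FN).
by move=> /(wN N FN Nb) /FE; rewrite (negPf wF).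
Qed.

End YangianModule.

Theorem corollary5p3 (R : realType) (g : lie_algebra R[i])
    (g_simple : lie_simple g)
    (I : finType) (D : chevalley_data g I) (g_not_G2 : ~ type_G2 D)
    (iota : {linear g -> Yangian D}) (iotaP : is_lie_inclusion iota)
    (phi : {lrmorphism TwistedYangian D -> Yangian D})
    (phiP : is_twisted_embedding iota phi)
    (V : fd_module (Yangian D)) (lam : il_weight R[i] I) :
  is_il_weight (restrict_module phi V) lam ->
  exists Xi : I -> {poly R[i]}, forall i : I,
    Xi i \is monic /\
    expands_to
      (shift_poly (cd_d D i / 2) (Xi i)
         * shift_poly (- (cd_d D i / 2)) (poly_minus (Xi i)))
      (shift_poly (- (cd_d D i / 2)) (Xi i)
         * shift_poly (cd_d D i / 2) (poly_minus (Xi i)))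
      (even_series (lam i)).
Proof.
move=> [v v0 vlam].
have lamP i : weight_form (cd_d D i) (lam i).
  apply: (module_weight iotaP phiP v0) => k.
  by have [p _ vp] := vlam i k; exists p.
have [Xi XiP] := choice (fun i => weight_form_monic (lamP i)).
exists Xi => i; exact: XiP.
Qed.
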